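(* Let $N\ge1$, $\alpha\in(0,1]$, and let $(r_n)_{n\ge0}$ satisfy $0\le r_n<1$ and $\lim_{n\to\infty}n^\gamma r_n=c>0$ for some $\gamma\in(\tfrac12,1]$. Let $Z_n(i)\in[0,1]$ ($i=1,\dots,N$, $n\ge0$) evolve by $Z_{n+1}(i)=(1-r_n)Z_n(i)+r_n I_{n+1}(i)$, where, with $\mathcal F_n=\sigma(Z_k(i):\,1\le i\le N,\ 0\le k\le n)$ and $Z_n=\frac1N\sum_{i=1}^N Z_n(i)$, the $I_{n+1}(1),\dots,I_{n+1}(N)\in\{0,1\}$ are conditionally independent given $\mathcal F_n$ with $P(I_{n+1}(i)=1\mid\mathcal F_n)=(1-\alpha)Z_n(i)+\alpha Z_n$. Assume the law of $(Z_0(1),\dots,Z_0(N))$ is permutation invariant, $E[Z_0(i)]=\tfrac12$ and $E[Z_0(1-Z_0)]>0$. Let $Z$ be the almost sure limit of $Z_n$. Then $P(Z\in\{0,1\})<1$ and $P(Z=z)=0$ for all $z\in(0,1)$. Moreover \[\Big(t^{2\gamma-1}n^{\gamma-\frac12}(Z_{\lfloor nt\rfloor}-Z)\Big)_{t\ge0}\xrightarrow{d}(W_{V_t})_{t\ge0},\qquad V_t=\frac{c^2}{N(2\gamma-1)}Z(1-Z)t^{2\gamma-1},\] where $W=(W_t)_{t\ge0}$ is a Wiener process independent of $V=(V_t)_{t\ge0}$, and convergence in distribution is with respect to the Skorohod topology on $D[0,+\infty)$.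
   Context: This is the interacting model with $\rho=1$ (pure reinforcement, no drift towards a fixed $q$). The almost sure limit $Z$ of $Z_n$ exists since $(Z_n)$ is then a bounded martingale. *)

(* Defs.v *)
From HB Require Import structures.
From mathcomp Require Import all_boot all_order all_algebra all_fingroup.
From mathcomp Require Import all_classical all_reals all_analysis.
Set Implicit Arguments. Unset Strict Implicit. Unset Printing Implicit Defensive.
Import Order.TTheory GRing.Theory Num.Theory Num.Def.
Import numFieldNormedType.Exports.
Local Open Scope classical_set_scope.
Local Open Scope ring_scope.

Section Defs.
Context {R : realType}.

(** Elements of D[0,+oo): we represent a path as a function R -> R which is
    identically 0 on (-oo,0) (normalisation), right-continuous at every t >= 0
    and has a left limit at every t > 0. *)
Definition cadlag (x : R -> R) : Prop :=
  (forall t, t < 0 -> x t = 0) /\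
  (forall t, 0 <= t -> x s @[s --> t^'+] --> x t) /\
  (forall t, 0 < t -> exists l : R, x s @[s --> t^'-] --> l).

Definition time_change (l : R -> R) : Prop :=
  {within `[0, +oo[%classic, continuous l} /\
  (forall s t, 0 <= s -> s < t -> l s < l t) /\
  (forall t, 0 <= t -> 0 <= l t) /\
  (forall u, 0 <= u -> exists2 t, 0 <= t & l t = u).

(** Convergence in the Skorohod (J1) topology of D[0,+oo)
    (Ethier--Kurtz, Prop. 3.5.3): there are time changes lam_k with
    lam_k -> id and x_k o lam_k -> y, both uniformly on compacts of [0,+oo). *)
Definition skorohod_cvg (xs : nat -> R -> R) (y : R -> R) : Prop :=
  exists lam : nat -> R -> R, (forall k, time_change (lam k)) /\
    forall T : R, 0 < T -> forall e : R, 0 < e ->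
      \forall k \near \oo, forall t, 0 <= t <= T ->
        `|lam k t - t| <= e /\ `|xs k (lam k t) - y t| <= e.

(** Bounded real functionals on path space that are continuous on D[0,+oo)
    for the Skorohod topology (D is metrisable, so sequential continuity). *)
Definition skorohod_bcont (f : (R -> R) -> R) : Prop :=
  (exists M : R, forall x, `|f x| <= M) /\
  (forall xs y, (forall k, cadlag (xs k)) -> cadlag y -> skorohod_cvg xs y ->
     f (xs k) @[k --> \oo] --> f y).

Definition cvg_dist_skorohod {d d'} {Om : measurableType d}
  {Om' : measurableType d'} (P : probability Om R) (X : nat -> Om -> R -> R)
  (P' : probability Om' R) (Y : Om' -> R -> R) : Prop :=
  forall f, skorohod_bcont f ->
    (\int[P]_w (f (X n w))%:E)%E @[n --> \oo] --> (\int[P']_w (f (Y w))%:E)%E.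

Definition zmean {Om : Type} (N : nat) (Z : nat -> 'I_N -> Om -> R)
  (n : nat) (w : Om) : R := (\sum_(i < N) Z n i w) / N%:R.

Definition filtr {d} {Om : measurableType d} (N : nat)
  (Z : nat -> 'I_N -> Om -> R) (n : nat) : set (set Om) :=
  <<s [set A | exists k (i : 'I_N) (B : set R),
        (k <= n)%N /\ measurable B /\ A = Z k i @^-1` B] >>.

Definition rescaled {Om : Type} (N : nat) (Z : nat -> 'I_N -> Om -> R)
  (Zlim : Om -> R) (g : R) (n : nat) (w : Om) (t : R) : R :=
  if t < 0 then 0 else
  powR t (2 * g - 1) * powR n%:R (g - 2^-1)
    * (zmean Z (truncn (n%:R * t)) w - Zlim w).

Definition time_changed_bm {Om : Type} (N : nat) (c g : R) (W : R -> Om -> R)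
  (Zl : Om -> R) (w : Om) (t : R) : R :=
  if t < 0 then 0 else
  W (c ^+ 2 / (N%:R * (2 * g - 1)) * (Zl w * (1 - Zl w)) * powR t (2 * g - 1)) w.

End Defs.

(* Main.v *)
Require Import Defs.
From HB Require Import structures.
From mathcomp Require Import all_boot all_order all_algebra all_fingroup.
From mathcomp Require Import all_classical all_reals all_analysis.
From mathcomp Require Import measurable_realfun ring lra zify.
Set Implicit Arguments. Unset Strict Implicit. Unset Printing Implicit Defensive.
Import Order.TTheory GRing.Theory Num.Theory Num.Def.
Import numFieldNormedType.Exports.
Local Open Scope classical_set_scope.
Local Open Scope ring_scope.

(* The mean Z_n is a martingale whose steps are bounded by r_n and whose conditional variance is
   asymptotically r_n^2 Z (1 - Z) / N, because interaction contracts the deviations Z_n(i) - Z_n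
   at the non-summable rate alpha r_n. Lindeberg replacement of the remaining steps by Gaussian
   ones, frozen at the variance of a past time, shows that deterministic linear combinations of
   the future increments are mixed Gaussian, jointly with the past. Applied to the single
   combination n^(gamma - 1/2) (Z - Z_n), this makes E[cos(theta (Z - z))] decay in mean over
   theta on the event that Z_n is near z, which by a Fejer kernel argument excludes atoms in
   (0,1); the product of the numbers 1 - r_n^2 bounds E[Z (1 - Z)] away from 0, so that Z is not
   supported by {0,1}. Applied to several times, it gives the finite-dimensional limits.
   Tightness follows from the fourth-moment maximal inequality on small cells and, near time 0,
   from summation by parts against the weight t^(2 gamma - 1). Convergence in the Skorohod space
   is then obtained by approximating a path functional from below by functionals that are
   Lipschitz for the uniform norm, which only see finitely many values of a path. *)

(** * Bounded random variables and their expectations *)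

Definition bmfun {R : realType} {d} {T : measurableType d} (X : T -> R) : Prop :=
  measurable_fun setT X /\ exists M : R, forall w, `|X w| <= M.

Definition expect {R : realType} {d} {T : measurableType d} (P : probability T R)
  (X : T -> R) : R := \int[P]_w X w.

Lemma norm_cosB_le {R : realType} (x y : R) : `|cos x - cos y| <= `|x - y|.
Proof.
wlog xy : x y / x < y => [cos_le|].
  have [xy|yx|->] := ltgtP x y; [exact: cos_le| |by rewrite !subrr].
  by rewrite distrC [leRHS]distrC; exact: cos_le.
have [z _] := MVT xy (fun z _ => is_derive_cos z) (continuous_subspaceT (@continuous_cos R)).
by rewrite distrC [leRHS]distrC => ->; rewrite normrM ler_piMl// normrN sin_max.
Qed.

Lemma measurable_preimageT {d d'} {T : measurableType d} {T' : measurableType d'}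
    (f : T -> T') (B : set T') :
  measurable_fun setT f -> measurable B -> measurable (f @^-1` B).
Proof. by move=> mf mB; rewrite -[_ @^-1` _]setTI; exact: mf. Qed.

Section bounded_measurable.
Context {R : realType} {d} {T : measurableType d}.
Implicit Types (X Y : T -> R) (c : R).

Lemma bmfun_measurable X : bmfun X -> measurable_fun setT X.
Proof. by case. Qed.

Lemma bmfun_cst c : bmfun (fun _ : T => c).
Proof. by split; [exact: measurable_cst|exists `|c|]. Qed.

Lemma bmfunD X Y : bmfun X -> bmfun Y -> bmfun (fun w => X w + Y w).
Proof.
move=> [mX [M XM]] [mY [M' YM]]; split; first exact: measurable_funD.
by exists (M + M') => w; apply: le_trans (ler_normD _ _) _; exact: lerD.
Qed.

Lemma bmfunN X : bmfun X -> bmfun (fun w => - X w).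
Proof.
move=> [mX [M XM]]; split; first exact: measurableT_comp.
by exists M => w; rewrite normrN.
Qed.

Lemma bmfunM X Y : bmfun X -> bmfun Y -> bmfun (fun w => X w * Y w).
Proof.
move=> [mX [M XM]] [mY [M' YM]]; split; first exact: measurable_funM.
by exists (M * M') => w; rewrite normrM; exact: ler_pM.
Qed.

Lemma bmfun_sum (J : Type) (s : seq J) (Q : pred J) (F : J -> T -> R) :
  (forall i, Q i -> bmfun (F i)) -> bmfun (fun w => \sum_(i <- s | Q i) F i w).
Proof.
move=> bF; elim: s => [|i s ih].
  by under eq_fun do rewrite big_nil; exact: bmfun_cst.
under eq_fun do rewrite big_cons.
by case: (boolP (Q i)) => [Qi|//]; apply: bmfunD => //; exact: bF.
Qed.

Lemma bmfun_prod (J : Type) (s : seq J) (Q : pred J) (F : J -> T -> R) :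
  (forall i, Q i -> bmfun (F i)) -> bmfun (fun w => \prod_(i <- s | Q i) F i w).
Proof.
move=> bF; elim: s => [|i s ih].
  by under eq_fun do rewrite big_nil; exact: bmfun_cst.
under eq_fun do rewrite big_cons.
by case: (boolP (Q i)) => [Qi|//]; apply: bmfunM => //; exact: bF.
Qed.

Lemma bmfunX n X : bmfun X -> bmfun (fun w => X w ^+ n).
Proof.
move=> bX; elim: n => [|n ih]; first exact: bmfun_cst.
by under eq_fun do rewrite exprS; exact: bmfunM.
Qed.

Lemma bmfun_norm X : bmfun X -> bmfun (fun w => `|X w|).
Proof.
move=> [mX [M XM]]; split; first exact: measurableT_comp.
by exists M => w; rewrite normr_id.
Qed.

Lemma indic_itv01 (A : set T) w : 0 <= (\1_A w : R) <= 1.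
Proof. by rewrite indicE; case: (_ \in _); rewrite ?lexx ler01. Qed.

Lemma bmfun_indic (A : set T) : measurable A -> bmfun (\1_A : T -> R).
Proof.
move=> mA; split; first exact: measurable_indic.
by exists 1 => w; have /andP[? ?] := indic_itv01 A w; rewrite ger0_norm.
Qed.

Lemma bmfun_comp (g : R -> R) (M : R) X : continuous g -> (forall x, `|g x| <= M) ->
  measurable_fun setT X -> bmfun (fun w => g (X w)).
Proof.
move=> cg gM mX; split; last by exists M => w.
by apply: measurableT_comp => //; exact: continuous_measurable_fun.
Qed.

Lemma bmfun_cos X : measurable_fun setT X -> bmfun (fun w => cos (X w)).
Proof. by apply: (@bmfun_comp cos 1); [exact: continuous_cos|exact: cos_max]. Qed.

Lemma bmfun_sin X : measurable_fun setT X -> bmfun (fun w => sin (X w)).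
Proof. by apply: (@bmfun_comp sin 1); [exact: continuous_sin|exact: sin_max]. Qed.

Lemma bmfun_itv X (a b : R) : measurable_fun setT X -> (forall w, a <= X w <= b) -> bmfun X.
Proof.
move=> mX Xab; split => //; exists (`|a| + `|b|) => w; have /andP[aX Xb] := Xab w.
have := ler_norm (- a); have := ler_norm b; rewrite normrN => bb aa.
by have := normr_ge0 a; have := normr_ge0 b; rewrite ler_norml => ? ?; apply/andP; split; lra.
Qed.

Lemma expRN_le1 (x : R) : 0 <= x -> `|expR (- x)| <= 1.
Proof. by move=> x0; rewrite ger0_norm ?expR_ge0// -[leRHS]expR0 ler_expR oppr_le0. Qed.

Lemma bmfun_expRN X : measurable_fun setT X -> (forall w, 0 <= X w) ->
  bmfun (fun w => expR (- X w)).
Proof.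
move=> mX X0; split; last by exists 1 => w; exact: expRN_le1.
by apply: measurableT_comp => //; exact: measurableT_comp.
Qed.

End bounded_measurable.

Ltac bmfun_step :=
  lazymatch goal with
  | |- @bmfun ?R ?d ?T (fun _ => ?c) => exact: bmfun_cst
  | |- @bmfun ?R ?d ?T (fun w => @?X w + @?Y w) => apply: (@bmfunD R d T X Y)
  | |- @bmfun ?R ?d ?T (fun w => - @?X w) => apply: (@bmfunN R d T X)
  | |- @bmfun ?R ?d ?T (fun w => @?X w * @?Y w) => apply: (@bmfunM R d T X Y)
  | |- @bmfun ?R ?d ?T (fun w => @?X w ^+ ?n) => apply: (@bmfunX R d T n X)
  | |- @bmfun ?R ?d ?T (fun w => `|@?X w|) => apply: (@bmfun_norm R d T X)
  | |- @bmfun ?R ?d ?T (fun w => cos (@?X w)) => apply: (@bmfun_cos R d T X); apply: (@bmfun_measurable R d T)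
  | |- @bmfun ?R ?d ?T (fun w => sin (@?X w)) => apply: (@bmfun_sin R d T X); apply: (@bmfun_measurable R d T)
  | |- @bmfun ?R ?d ?T (fun w => \sum_(i <- _ | _) _) => apply: bmfun_sum => ? ?
  | |- @bmfun ?R ?d ?T (fun w => \prod_(i <- _ | _) _) => apply: bmfun_prod => ? ?
  end.
Create HintDb bmfun.
#[local] Hint Resolve bmfun_indic : bmfun.
Ltac bmfun := repeat bmfun_step; eauto 4 with bmfun nocore.
#[local] Hint Extern 0 (bmfun _) => solve [bmfun] : core.

Section expectation.
Context {R : realType} {d} {T : measurableType d} (P : probability T R).
Implicit Types (X Y : T -> R) (c M : R).

Lemma bmfun_integrable X : bmfun X -> P.-integrable setT (EFin \o X).
Proof.
move=> [mX [M XM]]; apply: measurable_bounded_integrable => //.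
  by rewrite (le_lt_trans (@probability_le1 _ _ _ P _ _))// ltry.
exists M; split; first exact: num_real.
by move=> x Mx t _ /=; rewrite (le_trans (XM t))// ltW.
Qed.

Lemma eq_expect X Y : (forall w, X w = Y w) -> expect P X = expect P Y.
Proof. by move=> XY; congr expect; exact/funext. Qed.

Lemma integral_expect X : bmfun X -> (\int[P]_w (X w)%:E)%E = (expect P X)%:E.
Proof. by move=> /bmfun_integrable iX; rewrite fineK//; exact: integrable_fin_num. Qed.

Lemma expectD X Y : bmfun X -> bmfun Y ->
  expect P (fun w => X w + Y w) = expect P X + expect P Y.
Proof. by move=> bX bY; rewrite /expect RintegralD//; exact: bmfun_integrable. Qed.

Lemma expectB X Y : bmfun X -> bmfun Y ->
  expect P (fun w => X w - Y w) = expect P X - expect P Y.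
Proof. by move=> bX bY; rewrite /expect RintegralB//; exact: bmfun_integrable. Qed.

Lemma expectZ c X : bmfun X -> expect P (fun w => c * X w) = c * expect P X.
Proof. by move=> bX; rewrite /expect RintegralZl//; exact: bmfun_integrable. Qed.

Lemma expectN X : bmfun X -> expect P (fun w => - X w) = - expect P X.
Proof. by move=> bX; rewrite -mulN1r -expectZ//; apply: eq_expect => w; rewrite mulN1r. Qed.

Lemma expect_cst c : expect P (fun _ => c) = c.
Proof. by rewrite /expect Rintegral_cst// [X in fine X]probability_setT mulr1. Qed.

Lemma expect_sum (J : Type) (s : seq J) (Q : pred J) (F : J -> T -> R) :
  (forall i, Q i -> bmfun (F i)) ->
  expect P (fun w => \sum_(i <- s | Q i) F i w) = \sum_(i <- s | Q i) expect P (F i).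
Proof.
move=> bF; elim: s => [|i s ih].
  by rewrite big_nil; under eq_fun do rewrite big_nil; exact: expect_cst.
rewrite big_cons; under eq_fun do rewrite big_cons.
by case: (boolP (Q i)) => [Qi|//]; rewrite expectD ?ih//.
Qed.

Lemma expect_ge0 X : (forall w, 0 <= X w) -> 0 <= expect P X.
Proof. by move=> X0; apply: Rintegral_ge0. Qed.

Lemma le_expect X Y : bmfun X -> bmfun Y -> (forall w, X w <= Y w) -> expect P X <= expect P Y.
Proof. by move=> bX bY XY; apply: le_Rintegral => //; exact: bmfun_integrable. Qed.

Lemma norm_expect_le X Y : bmfun X -> bmfun Y -> (forall w, `|X w| <= Y w) ->
  `|expect P X| <= expect P Y.
Proof.
move=> bX bY XY; apply: le_trans (le_normr_Rintegral _ (bmfun_integrable bX)) _ => //.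
exact: (@le_expect (fun w => `|X w|)).
Qed.

Lemma norm_expect_le_cst X M : bmfun X -> (forall w, `|X w| <= M) -> `|expect P X| <= M.
Proof. by move=> bX XM; rewrite -[leRHS](expect_cst M); exact: norm_expect_le. Qed.

Lemma expect_le_cst X M : bmfun X -> (forall w, X w <= M) -> expect P X <= M.
Proof. by move=> bX XM; rewrite -[leRHS](expect_cst M); exact: le_expect. Qed.

Lemma expect_dist_le X Y M : bmfun X -> bmfun Y -> (forall w, `|X w - Y w| <= M) ->
  `|expect P X - expect P Y| <= M.
Proof. by move=> bX bY XYM; rewrite -expectB//; exact: norm_expect_le_cst. Qed.

Lemma expect_indic (A : set T) : measurable A -> expect P (\1_A) = fine (P A).
Proof. by move=> mA; rewrite /expect /Rintegral integral_indic// setIT. Qed.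

Lemma ae_eq_expect X Y : bmfun X -> bmfun Y -> {ae P, forall w, X w = Y w} ->
  expect P X = expect P Y.
Proof.
move=> [mX _] [mY _] XY; rewrite /expect /Rintegral; congr fine.
apply: ae_eq_integral => //; try exact/measurable_EFinP.
by apply: filterS XY => w /= + _ => ->.
Qed.

Lemma bounded_convergence (X_ : nat -> T -> R) X M : (forall n, measurable_fun setT (X_ n)) ->
  measurable_fun setT X -> (forall n w, `|X_ n w| <= M) ->
  {ae P, forall w, X_ n w @[n --> \oo] --> X w} ->
  expect P (X_ n) @[n --> \oo] --> expect P X.
Proof.
move=> mX_ mX X_M X_X.
have [] := @dominated_convergence _ _ _ P setT measurableT (fun n => EFin \o X_ n) (EFin \o X)
  (fun=> M%:E) (fun n => (measurable_EFinP _ _).2 (mX_ n)) ((measurable_EFinP _ _).2 mX).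
- by apply: filterS X_X => w /= Xw _; apply: cvg_EFin => //; exact: nearW.
- exact: (bmfun_integrable (bmfun_cst M)).
- by apply: aeW => /= w n _; rewrite lee_fin.
by move=> iX _ cvgX; apply: fine_cvg; rewrite fineK//; exact: integrable_fin_num.
Qed.

Lemma expect_markov X (l : R) (A : set T) : bmfun X -> measurable A -> 0 < l ->
  (forall w, 0 <= X w) -> (forall w, A w -> l <= X w) -> fine (P A) <= expect P X / l.
Proof.
move=> bX mA l0 X0 lX; rewrite ler_pdivlMr// mulrC -expect_indic// -expectZ//.
apply: le_expect => // w; rewrite indicE.
by case: (boolP (w \in A)) => wA; rewrite ?mulr0// mulr1; apply: lX; exact: set_mem.
Qed.

Lemma expect_norm_le_sqr X (e : R) : bmfun X -> 0 < e ->
  expect P (fun w => `|X w|) <= e + expect P (fun w => X w ^+ 2) / e.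
Proof.
move=> bX e0; rewrite [_ / e]mulrC -expectZ// -{1}[e]expect_cst -expectD//.
apply: le_expect => // w; have [Xe|/ltW eX] := leP `|X w| e.
  by rewrite (le_trans Xe)// lerDl mulr_ge0 ?sqr_ge0// invr_ge0 ltW.
rewrite -[X w ^+ 2]real_normK ?num_real// (@le_trans _ _ (e^-1 * `|X w| ^+ 2))//; last first.
  by rewrite lerDr ltW.
by rewrite mulrC ler_pdivlMr// expr2 ler_wpM2l.
Qed.

Lemma expect_norm_cvg0 (X : nat -> T -> R) : (forall n, bmfun (X n)) ->
  expect P (fun w => X n w ^+ 2) @[n --> \oo] --> 0 ->
  expect P (fun w => `|X n w|) @[n --> \oo] --> 0.
Proof.
move=> bX X2; apply/cvgrPdist_le => e e0.
have e2 : 0 < e / 2 by rewrite divr_gt0.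
have [A _ X2A] := (cvgrPdist_le _ _).1 X2 _ (exprn_gt0 2 e2); exists A => // n /X2A /=.
rewrite !sub0r !normrN => /(le_trans (ler_norm _)) X2e.
rewrite ger0_norm ?expect_ge0// (le_trans (expect_norm_le_sqr (bX n) e2))//.
by rewrite [leRHS]splitr lerD2l ler_pdivrMr// -expr2.
Qed.

Lemma expect_cos_cvg0 (G G' X X' : nat -> T -> R) (C : R) :
  (forall n, bmfun (G n)) -> (forall n, bmfun (G' n)) ->
  (forall n, bmfun (X n)) -> (forall n, bmfun (X' n)) -> (forall n w, `|G' n w| <= C) ->
  expect P (fun w => `|G n w - G' n w|) @[n --> \oo] --> 0 ->
  expect P (fun w => `|X n w - X' n w|) @[n --> \oo] --> 0 ->
  expect P (fun w => G n w * cos (X n w)) - expect P (fun w => G' n w * cos (X' n w))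
    @[n --> \oo] --> 0.
Proof.
move=> bG bG' bX bX' G'C GG' XX'; apply/norm_cvg0P.
have upper : expect P (fun w => `|G n w - G' n w|) + C * expect P (fun w => `|X n w - X' n w|)
    @[n --> \oo] --> 0.
  by rewrite -[X in _ --> X]addr0 -[X in _ --> _ + X](mulr0 C); apply: cvgD => //; apply: cvgM => //; exact: cvg_cst.
apply: (squeeze_cvgr _ (@cvg_cst _ 0 _ \oo _) upper); apply: nearW => n.
rewrite normr_ge0 /= -expectZ// -expectD// -expectB//; apply: norm_expect_le => // w.
rewrite (_ : _ - _ = (G n w - G' n w) * cos (X n w) + G' n w * (cos (X n w) - cos (X' n w))); last by ring.
rewrite (le_trans (ler_normD _ _))// !normrM lerD//; first by rewrite ler_piMr ?cos_max.
by rewrite ler_pM// norm_cosB_le.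
Qed.

End expectation.

Section except_prob.
Context {R : realType} {d} {T : measurableType d} (P : probability T R).
Implicit Types (e : R) (Q : T -> Prop).

Definition except_prob e Q : Prop :=
  exists A : set T, [/\ measurable A, fine (P A) <= e & forall w, ~ A w -> Q w].

Lemma except_prob_and e1 e2 Q1 Q2 : except_prob e1 Q1 -> except_prob e2 Q2 ->
  except_prob (e1 + e2) (fun w => Q1 w /\ Q2 w).
Proof.
move=> [A [mA PA QA]] [B [mB PB QB]]; exists (A `|` B); split; first exact: measurableU.
  apply: le_trans (lerD PA PB); rewrite -fineD ?fin_num_measure//.
  apply: fine_le; rewrite ?fin_numD ?fin_num_measure//; first exact: measurableU.
  exact: measureU2.
by move=> w /not_orP[nA nB]; split; [exact: QA|exact: QB].
Qed.

Lemma except_probS e1 e2 Q1 Q2 : e1 <= e2 -> (forall w, Q1 w -> Q2 w) ->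
  except_prob e1 Q1 -> except_prob e2 Q2.
Proof.
move=> e12 Q12 [A [mA PA QA]]; exists A; split=> //; first exact: le_trans e12.
by move=> w /QA; exact: Q12.
Qed.

Lemma except_prob_forall (J : nat) e (Q : nat -> T -> Prop) : 0 <= e ->
  (forall j, (j < J)%N -> except_prob e (Q j)) ->
  except_prob (J%:R * e) (fun w => forall j, (j < J)%N -> Q j w).
Proof.
move=> e0; elim: J => [|J ih] exQ.
  by exists set0; split=> //; rewrite measure0 mul0r.
apply: except_probS (except_prob_and (ih (fun j jJ => exQ j (ltnW jJ))) (exQ J (ltnSn J))).
  by rewrite -natr1 mulrDl mul1r.
by move=> w [QJ QJJ] j; rewrite ltnS leq_eqVlt => /predU1P[->//|]; exact: QJ.
Qed.

Lemma except_prob_sqr (X : T -> R) (l e : R) : bmfun X -> 0 < l ->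
  expect P (fun w => X w ^+ 2) <= e * l ^+ 2 -> except_prob e (fun w => `|X w| <= l).
Proof.
move=> bX l0 X2le; exists (X @^-1` (~` `[- l, l]%classic)).
have mA : measurable (X @^-1` (~` `[- l, l]%classic)).
  by apply: measurable_preimageT; [case: bX|exact: measurableC].
have outE w : (X @^-1` (~` `[- l, l]%classic)) w <-> ~ (`|X w| <= l).
  by rewrite /= in_itv/= -ler_norml.
split=> // [|w /outE /contrapT//].
have l20 : 0 < l ^+ 2 by rewrite exprn_gt0.
apply: (@le_trans _ _ (expect P (fun w => X w ^+ 2) / l ^+ 2)); last by rewrite ler_pdivrMr.
apply: expect_markov => // w; first exact: sqr_ge0.
move=> /outE/negP; rewrite -ltNge -[X w ^+ 2]real_normK ?num_real// => lX.
by apply: lerXn2r; rewrite ?nnegrE//; exact: ltW.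
Qed.

End except_prob.

(** * Extension from indicators *)

Lemma near_natSinv_le {R : realType} (e : R) : 0 < e -> \forall n \near \oo, n.+1%:R^-1 <= e.
Proof. by move=> e0; apply: filterS (near_infty_natSinv_lt (PosNum e0)) => n /ltW. Qed.

Section floor_approximation.
Context {R : realType}.
Implicit Types x : R.

Definition floor_approx (n : nat) x : R := (floor (n.+1%:R * x))%:~R / n.+1%:R.

Lemma floor_approx_dist n x : `|floor_approx n x - x| <= n.+1%:R^-1.
Proof.
have n0 : (0 : R) < n.+1%:R by rewrite ltr0n.
have /andP[fl_le lt_fl] := floor_itv (n.+1%:R * x); rewrite intrD in lt_fl.
have -> : floor_approx n x - x = ((floor (n.+1%:R * x))%:~R - n.+1%:R * x) / n.+1%:R.
  by rewrite mulrBl [n.+1%:R * x / _]mulrAC mulfV ?mul1r// gt_eqF.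
rewrite normrM normfV (gtr0_norm n0) ler_piMl ?invr_ge0 ?(ltW n0)//.
by rewrite ler_norml; apply/andP; split; lra.
Qed.

Lemma measurable_floor_eq (z : int) : measurable [set x : R | floor x = z].
Proof.
rewrite (_ : [set x | _] = `[z%:~R, (z + 1)%:~R[%classic) //.
apply/seteqP; split => x /=; rewrite in_itv /=; first by move=> <-; exact: floor_itv.
by move=> zx; exact: floor_def.
Qed.

Lemma floor_approx_sum (n K : nat) x : `|x| <= K%:R -> let A := (K.+1 * n.+1)%N in
  floor_approx n x = \sum_(j < A.*2.+1) (j%:Z - A%:Z)%:~R / n.+1%:R *
    \1_[set y : R | floor (n.+1%:R * y) = j%:Z - A%:Z] x.
Proof.
move=> xK A; set z := floor (n.+1%:R * x).
have zA : (absz (z + A%:Z)%R < A.*2.+1)%N /\ 0 <= z + A%:Z.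
  have /andP[fl_le lt_fl] := floor_itv (n.+1%:R * x); rewrite -/z intrD in fl_le lt_fl.
  have /andP[Kx xK'] : - (K%:R * n.+1%:R) <= n.+1%:R * x <= K%:R * n.+1%:R.
    by rewrite -ler_norml normrM mulrC normr_nat ler_wpM2r.
  have : z <= A%:Z by rewrite -(ler_int R) -pmulrn natrM -natr1 mulrDl; have := ler0n R n.+1; lra.
  have : - A%:Z <= z.
    rewrite -(ler_int R) intrN -pmulrn natrM -natr1 mulrDl.
    have : (1 : R) <= n.+1%:R by rewrite ler1n.
    lra.
  lia.
rewrite (bigD1 (Ordinal zA.1))//= big1 ?addr0 => [|j jz].
  by rewrite gez0_abs ?zA.2// addrK indicE mem_set//= mulr1.
rewrite indicE memNset ?mulr0//= -/z => zj; move/eqP: jz; apply.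
by apply/val_inj => /=; lia.
Qed.

End floor_approximation.

Record bounded_functional {R : realType} {d} {T : measurableType d} (L : (T -> R) -> R) : Prop :=
  BoundedFunctional {
  bounded_functionalD : forall X Y, bmfun X -> bmfun Y -> L (fun w => X w + Y w) = L X + L Y;
  bounded_functionalZ : forall c X, bmfun X -> L (fun w => c * X w) = c * L X;
  bounded_functional_le : exists2 C : R, 0 <= C &
    forall X (M : R), bmfun X -> (forall w, `|X w| <= M) -> `|L X| <= C * M }.

Section bounded_functionals.
Context {R : realType} {d} {T : measurableType d}.
Implicit Types (L : (T -> R) -> R) (X : T -> R).

Lemma bounded_functional_sum L (J : Type) (s : seq J) (c : J -> R) (F : J -> T -> R) :
  bounded_functional L -> (forall j, bmfun (F j)) ->
  L (fun w => \sum_(j <- s) c j * F j w) = \sum_(j <- s) c j * L (F j).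
Proof.
move=> bL bF; elim: s => [|j s ih].
  under eq_fun do rewrite big_nil -[0](mul0r 0).
  by rewrite (bounded_functionalZ bL)// mul0r big_nil.
under eq_fun do rewrite big_cons.
by rewrite (bounded_functionalD bL)// (bounded_functionalZ bL)// ih big_cons.
Qed.

Lemma measurable_floor_level (n : nat) (z : int) X : measurable_fun setT X ->
  measurable [set w | floor (n.+1%:R * X w) = z].
Proof.
move=> mX; by apply: (measurable_preimageT _ (measurable_floor_eq z)); exact: measurable_funM.
Qed.

Lemma bmfun_floor_approx n X : bmfun X -> bmfun (fun w => floor_approx n (X w)).
Proof.
move=> [mX [M XM]].
have XK w : `|X w| <= (truncn M).+1%:R := le_trans (XM w) (ltW (truncnS_gt M)).
under eq_fun do rewrite (floor_approx_sum n (XK _)).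
apply: bmfun_sum => j _; apply: bmfunM; first exact: bmfun_cst.
exact/bmfun_indic/measurable_floor_level.
Qed.

Lemma bounded_functional_floor_cvg L X : bounded_functional L -> bmfun X ->
  L (fun w => floor_approx n (X w)) @[n --> \oo] --> L X.
Proof.
move=> bL bX; have [C C0 LC] := bounded_functional_le bL.
have bA n := bmfun_floor_approx n bX.
have C1 : 0 < C + 1 by rewrite ltr_wpDl.
apply/cvgrPdist_le => e e0; near=> n.
rewrite distrC -[- L X]mulN1r -(bounded_functionalZ bL)// -(bounded_functionalD bL)//.
apply: le_trans (LC _ n.+1%:R^-1 _ _) _ => //.
  by move=> w; rewrite mulN1r; exact: floor_approx_dist.
apply: (@le_trans _ _ ((C + 1) * n.+1%:R^-1)).
  by rewrite ler_wpM2r ?invr_ge0// lerDl.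
by rewrite mulrC -ler_pdivlMr//; near: n; apply: near_natSinv_le; exact: divr_gt0.
Unshelve. all: by end_near. Qed.

Lemma bounded_functional_ext L L' X : bounded_functional L -> bounded_functional L' ->
  (forall A, measurable A -> L (\1_A) = L' (\1_A)) -> bmfun X -> L X = L' X.
Proof.
move=> bL bL' LL' bX; have [mX [M XM]] := bX.
have XK w : `|X w| <= (truncn M).+1%:R := le_trans (XM w) (ltW (truncnS_gt M)).
have mA n z := measurable_floor_level n z mX.
apply: (cvg_unique _ (bounded_functional_floor_cvg bL bX)) => //.
suff LAE n : L (fun w => floor_approx n (X w)) = L' (fun w => floor_approx n (X w)).
  by rewrite /= (funext LAE); exact: bounded_functional_floor_cvg.
pose A := ((truncn M).+2 * n.+1)%N.
pose E (j : 'I_A.*2.+1) := [set w | floor (n.+1%:R * X w) = j%:Z - A%:Z].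
have sumE L0 : bounded_functional L0 -> L0 (fun w => floor_approx n (X w)) =
    \sum_(j < A.*2.+1) (j%:Z - A%:Z)%:~R / n.+1%:R * L0 (\1_(E j)).
  move=> bL0; under eq_fun do rewrite (floor_approx_sum n (XK _)).
  apply: (bounded_functional_sum _ (fun j => _) (F := fun j => \1_(E j)) bL0) => j.
  exact/bmfun_indic/mA.
by rewrite (sumE _ bL) (sumE _ bL'); apply: eq_bigr => j _; rewrite LL'//; exact: mA.
Qed.

Lemma expect_functional {d'} {T' : measurableType d'} (P : probability T' R) (D : T' -> T)
    (Y : T' -> R) : measurable_fun setT D -> bmfun Y ->
  bounded_functional (fun X => expect P (fun w => X (D w) * Y w)).
Proof.
move=> mD bY.
have bD X : bmfun X -> bmfun (fun w => X (D w)).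
  by move=> [mX [M XM]]; split; [exact: measurableT_comp mD|exists M].
split=> [X X' bX bX'|c X bX|].
- have bXD := bD _ bX; have bXD' := bD _ bX'.
  by rewrite -expectD//; apply: eq_expect => w; rewrite mulrDl.
- have bXD := bD _ bX.
  by rewrite -expectZ//; apply: eq_expect => w; rewrite mulrA.
have [_ [C YC]] := bY; exists `|C| => // X M bX XM; have bXD := bD _ bX.
apply: norm_expect_le_cst => // w; rewrite normrM mulrC ler_pM//.
exact: le_trans (YC w) (ler_norm C).
Qed.

End bounded_functionals.

Section measurability.
Context {R : realType} {d} {T : measurableType d}.

Lemma expect_product_law {d'} {T' : measurableType d'} (P : probability T' R) (Q : probability T R)
    (D : T' -> T) (Y : T' -> R) (c : R) X : measurable_fun setT D -> bmfun Y -> bmfun X ->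
  (forall A, measurable A -> expect P (fun w => \1_A (D w) * Y w) = c * fine (Q A)) ->
  expect P (fun w => X (D w) * Y w) = c * expect Q X.
Proof.
move=> mD bY bX law; rewrite -expectZ//.
apply: (bounded_functional_ext (L' := fun X => expect Q (fun x => c * X x)) (expect_functional P mD bY) _ _ bX).
  under eq_fun do under eq_expect do rewrite mulrC.
  by apply: expect_functional => //; exact: bmfun_cst.
by move=> A mA; rewrite law// expectZ// expect_indic.
Qed.

Lemma measurable_fun_countable (C : countType) (c : T -> C) (F : C -> T -> R) :
  (forall t, measurable [set w | c w = t]) -> (forall t, measurable_fun setT (F t)) ->
  measurable_fun setT (fun w => F (c w) w).
Proof.
move=> mc mF _ B mB; rewrite setTI.
rewrite (_ : _ @^-1` B = \bigcup_k
    (if unpickle k is Some t then [set w | c w = t] `&` F t @^-1` B else set0)).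
  apply: bigcup_measurable => k _; case: unpickle => // t; apply: measurableI => //.
  exact: measurable_preimageT.
apply/seteqP; split => [w Bw|w [k _]]; first by exists (pickle (c w)); rewrite ?pickleK.
by case: unpickle => // t [/= <-].
Qed.

Lemma measurable_seq_continuous (xi : nat -> T -> R) (g : (nat -> R) -> R) :
  (forall k, measurable_fun setT (xi k)) ->
  (forall (a_ : nat -> nat -> R) a, (forall k, a_ n k @[n --> \oo] --> a k) ->
     g (a_ n) @[n --> \oo] --> g a) ->
  measurable_fun setT (fun w => g (fun k => xi k w)).
Proof.
move=> mxi cg.
pose xi_ n w k := if (k < n)%N then floor_approx n (xi k w) else 0.
apply: (@measurable_fun_cvg _ _ _ _ (fun n w => g (xi_ n w))) => [n|w _]; last first.
  apply: cg => k; apply/cvgrPdist_le => e e0; near=> n.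
  rewrite /xi_ ifT; last by near: n; exact: nbhs_infty_gt.
  by rewrite distrC (le_trans (floor_approx_dist _ _))//; near: n; exact: near_natSinv_le.
pose c w : seq int := mkseq (fun k => floor (n.+1%:R * xi k w)) n.
pose G (s : seq int) := g (fun k => if (k < n)%N then (nth 0 s k)%:~R / n.+1%:R else 0).
rewrite (_ : (fun w => _) = (fun w => G (c w))); last first.
  apply/funext => w; rewrite /G /xi_; congr g; apply/funext => k.
  by case: ifPn => // kn; rewrite nth_mkseq.
apply: (@measurable_fun_countable _ c (fun s _ => G s)) => // t.
rewrite (_ : [set w | _] = if size t == n then
    \bigcap_(k in `I_n) [set w | floor (n.+1%:R * xi k w) = nth 0 t k] else set0).
  by case: ifP => // _; apply: fin_bigcap_measurable => // k _; exact: measurable_floor_level.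
apply/seteqP; split => w /=; first by move=> <-; rewrite size_mkseq eqxx => k /= kn; rewrite nth_mkseq.
case: eqP => // tn cw; apply: (@eq_from_nth _ 0); rewrite size_mkseq ?tn// => k kn.
by rewrite nth_mkseq//; exact: cw.
Unshelve. all: by end_near. Qed.

End measurability.

(** * Martingales with controlled steps *)

Lemma nat_ind_ge (m : nat) (Q : nat -> Prop) : Q m ->
  (forall k, (m <= k)%N -> Q k -> Q k.+1) -> forall k, (m <= k)%N -> Q k.
Proof.
move=> Qm QS k /subnK <-; elim: (k - m)%N => // i; rewrite addSn.
by apply: QS; exact: leq_addl.
Qed.

Section taylor.
Context {R : realType}.
Implicit Types x y s : R.

Lemma norm_le_pow_of_derive (f f' : R -> R) n : f 0 = 0 -> (forall x, is_derive x 1 f (f' x)) ->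
  (forall x, `|f' x| <= `|x| ^+ n) -> forall x, `|f x| <= `|x| ^+ n.+1.
Proof.
move=> f0 df f'le x.
have cf : continuous f by move=> y; apply: differentiable_continuous; exact/derivable1_diffP.
have slope a b : a < b -> exists2 z, a < z < b & f b - f a = f' z * (b - a).
  move=> ab; have [z] := MVT ab (fun x _ => df x) (continuous_subspaceT cf).
  by rewrite in_itv /= => zab fab; exists z.
have bound z : `|z| <= `|x| -> `|f' z * x| <= `|x| ^+ n.+1.
  move=> zx; rewrite normrM exprSr ler_wpM2r// (le_trans (f'le z))//.
  by apply: lerXn2r; rewrite ?nnegrE.
have [x0|x0|->] := ltgtP x 0; last by rewrite f0 normr0 exprn_ge0.
- have [z /andP[xz z0]] := slope _ _ x0; rewrite f0 !sub0r mulrN => /oppr_inj ->.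
  by apply: bound; rewrite !ltr0_norm//; lra.
- have [z /andP[z0 zx]] := slope _ _ x0; rewrite f0 !subr0 => ->.
  by apply: bound; rewrite !gtr0_norm//; lra.
Qed.

Lemma norm_sin_le x : `|sin x| <= `|x|.
Proof.
rewrite -[`|x|]expr1; apply: (@norm_le_pow_of_derive sin cos 0) => [|y]; first exact: sin0.
by rewrite expr0 cos_max.
Qed.

Lemma norm_cosB1_le x : `|cos x - 1| <= `|x| ^+ 2.
Proof.
apply: (@norm_le_pow_of_derive (fun x => cos x - 1) (fun x => - sin x) 1).
- by rewrite cos0 subrr.
- by move=> y; apply: is_derive_eq; rewrite oppr0 addr0.
- by move=> y; rewrite normrN expr1; exact: norm_sin_le.
Qed.

Lemma norm_sinB_le x : `|sin x - x| <= `|x| ^+ 3.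
Proof.
apply: (@norm_le_pow_of_derive (fun x => sin x - x) (fun x => cos x - 1) 2).
- by rewrite sin0 subrr.
- exact: norm_cosB1_le.
Qed.

Lemma norm_cosB1D_le x : `|cos x - 1 + x ^+ 2 / 2| <= `|x| ^+ 4.
Proof.
apply: (@norm_le_pow_of_derive (fun x => cos x - 1 + x ^+ 2 / 2) (fun x => - sin x + x) 3).
- by rewrite cos0 subrr expr0n mul0r addr0.
- by move=> y; apply: is_derive_eq; rewrite !scaler0 /GRing.scale /=; lra.
- by move=> y; rewrite addrC -normrN opprB; exact: norm_sinB_le.
Qed.

Definition cos_taylor2 y x : R := cos y - x * sin y - x ^+ 2 / 2 * cos y.

Lemma cosD_taylor2 y x : `|cos (y + x) - cos_taylor2 y x| <= `|x| ^+ 3 + `|x| ^+ 4.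
Proof.
rewrite cosD /cos_taylor2 (_ : _ - _ = - (sin y * (sin x - x)) + cos y * (cos x - 1 + x ^+ 2 / 2)); last by lra.
rewrite (le_trans (ler_normD _ _))// normrN !normrM lerD//.
  by rewrite (le_trans (ler_wpM2l _ (norm_sinB_le x)))// ler_piMl ?exprn_ge0 ?sin_max.
by rewrite (le_trans (ler_wpM2l _ (norm_cosB1D_le x)))// ler_piMl ?exprn_ge0 ?cos_max.
Qed.

End taylor.

Section normal_characteristic.
Context {R : realType}.
Implicit Types s t : R.

Definition normal_cf s : R := expR (- (s / 2)).

Lemma normal_cf0 : normal_cf 0 = 1.
Proof. by rewrite /normal_cf mul0r oppr0 expR0. Qed.

Lemma normal_cfD s t : normal_cf (s + t) = normal_cf s * normal_cf t.
Proof. by rewrite /normal_cf mulrDl opprD expRD. Qed.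

Lemma normal_cf_le1 s : 0 <= s -> `|normal_cf s| <= 1.
Proof. by move=> s0; apply: expRN_le1; rewrite divr_ge0. Qed.

Lemma normal_cf_taylor s : 0 <= s -> `|normal_cf s - (1 - s / 2)| <= s ^+ 2.
Proof.
move=> s0; rewrite /normal_cf; set x := s / 2.
have x0 : 0 <= x by rewrite divr_ge0.
have expRN_ge : 1 - x <= expR (- x) by exact: expR_ge1Dx.
have expR_ge : 1 + x <= expR x := expR_ge1Dx x.
have expRN_le : expR (- x) <= (1 + x)^-1 by rewrite expRN lef_pV2 ?posrE ?expR_gt0//; lra.
have inv_le : (1 + x)^-1 <= 1 - x + x ^+ 2.
  rewrite -[leLHS]div1r ler_pdivrMr; last lra.
  have x3 : 0 <= x ^+ 3 by exact: exprn_ge0.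
  nra.
rewrite ger0_norm ?subr_ge0//; have -> : s = 2 * x by rewrite /x; lra.
by have := sqr_ge0 x; rewrite exprMn; lra.
Qed.

Lemma normal_cf_lipschitz s t : 0 <= s -> 0 <= t -> `|normal_cf s - normal_cf t| <= `|s - t|.
Proof.
wlog st : s t / s <= t => [cf_le s0 t0|s0 t0].
  have [st|/ltW ts] := leP s t; first exact: cf_le.
  by rewrite distrC [leRHS]distrC; exact: cf_le.
have -> : normal_cf s - normal_cf t = normal_cf s * (1 - normal_cf (t - s)).
  by rewrite mulrBr mulr1 -normal_cfD [s + _]addrC subrK.
have ts0 : 0 <= t - s by rewrite subr_ge0.
rewrite normrM [leRHS]distrC (ger0_norm ts0) -[leRHS]mul1r; apply: ler_pM => //; first exact: normal_cf_le1.
have := normal_cf_le1 ts0; have := expR_ge1Dx (- ((t - s) / 2)); rewrite -/(normal_cf _).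
rewrite /normal_cf (ger0_norm (expR_ge0 _)) => lo up; rewrite ger0_norm ?subr_ge0//.
lra.
Qed.

Lemma continuous_normal_cf : continuous normal_cf.
Proof.
move=> s; apply: continuous_cvg; first exact: continuous_expR.
by apply: cvgN; apply: cvgM; [exact: cvg_id|exact: cvg_cst].
Qed.

Lemma bmfun_normal_cf {d} {T : measurableType d} (X : T -> R) : measurable_fun setT X ->
  (forall w, 0 <= X w) -> bmfun (fun w => normal_cf (X w)).
Proof.
move=> mX X0; apply: (@bmfun_expRN _ _ _ (fun w => X w / 2)) => [|w].
  exact: measurable_funM.
by rewrite divr_ge0.
Qed.

End normal_characteristic.

Local Notation past F n := (@bmfun _ _ (g_sigma_algebraType (F n))).

(* Conditional expectations given the past are tested against bounded functions of the past. *)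
Record controlled_martingale {R : realType} {d : measure_display} {Om : measurableType d}
    (P : probability Om R) (F : nat -> set (set Om)) (M v : nat -> Om -> R) (r : nat -> R) : Prop :=
  ControlledMartingale {
  past_measurable : forall n, F n `<=` measurable;
  past_nd : forall n m, (n <= m)%N -> F n `<=` F m;
  martingale_past : forall n, past F n (M n);
  variance_past : forall n, past F n (v n);
  variance01 : forall n w, 0 <= v n w <= 1;
  steps_ge0 : forall n, 0 <= r n;
  martingale_step_le : forall n w, `|M n.+1 w - M n w| <= r n;
  expect_past_step : forall n (G : Om -> R), past F n G -> expect P (fun w => G w * (M n.+1 w - M n w)) = 0;
  expect_past_step_sqr : forall n (G : Om -> R), past F n G ->
    expect P (fun w => G w * (M n.+1 w - M n w) ^+ 2) = r n ^+ 2 * expect P (fun w => G w * v n w) }.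

Section generated_sigma_algebra.
Context {R : realType} {d : measure_display} {Om : measurableType d}.
Implicit Types (G H : set (set Om)) (X : Om -> R).

Lemma bmfun_generated G X : G `<=` measurable -> @bmfun R _ (g_sigma_algebraType G) X -> bmfun X.
Proof.
move=> mG [mX XM]; split=> // _ B mB.
have := mX measurableT B mB; rewrite setTI; apply: smallest_sub => //.
exact: sigma_algebra_measurable.
Qed.

Lemma bmfun_generatedS G H X : G `<=` H ->
  @bmfun R _ (g_sigma_algebraType G) X -> @bmfun R _ (g_sigma_algebraType H) X.
Proof.
move=> GH [mX XM]; split=> // _ B mB.
have := mX measurableT B mB; rewrite setTI; apply: sub_smallest2r => //.
Qed.

End generated_sigma_algebra.

Section doob.
Context {R : realType} {d : measure_display} {Om : measurableType d}.
Context (P : probability Om R) (F : nat -> set (set Om)) (U : nat -> Om -> R).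
Hypothesis F_measurable : forall n, F n `<=` measurable.
Hypothesis F_nd : forall n m, (n <= m)%N -> F n `<=` F m.
Hypothesis U_past : forall n, past F n (U n).
Hypothesis U_ge0 : forall n w, 0 <= U n w.
Hypothesis U_submartingale : forall n (G : Om -> R), past F n G -> (forall w, 0 <= G w) ->
  expect P (fun w => G w * U n w) <= expect P (fun w => G w * U n.+1 w).

Definition exceeds (l : R) (K : nat) : set Om := [set w | exists2 k, (k <= K)%N & l <= U k w].

Lemma exceeds_past l K : past F K (\1_(exceeds l K) : Om -> R).
Proof.
apply: (@bmfun_indic _ _ (g_sigma_algebraType (F K))).
rewrite (_ : exceeds l K = \bigcup_(k in `I_K.+1) U k @^-1` `[l, +oo[%classic); last first.
  by apply/seteqP; split=> w [k kK] /=; rewrite ?in_itv/= ?andbT => lU; exists k => //=; rewrite in_itv/= andbT.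
apply: (@fin_bigcup_measurable _ (g_sigma_algebraType (F K))) => // k /= kK.
apply: (@measurable_preimageT _ _ (g_sigma_algebraType (F K))) => //.
by case: (bmfun_generatedS (F_nd (kK : (k <= K)%N)) (U_past k)).
Qed.

Lemma exceeds_measurable l K : measurable (exceeds l K).
Proof.
have [mA _] := bmfun_generated (@F_measurable K) (exceeds_past l K).
exact/(measurable_indicP R).
Qed.

Lemma doob_maximal (l : R) K : l * fine (P (exceeds l K)) <= expect P (U K).
Proof.
have bU n : bmfun (U n) := bmfun_generated (@F_measurable n) (U_past n).
have bA n := bmfun_indic (R := R) (exceeds_measurable l n).
suff maxA : l * fine (P (exceeds l K)) <= expect P (fun w => \1_(exceeds l K) w * U K w).
  by apply: le_trans maxA _; apply: le_expect => // w; have /andP[_ ?] := @indic_itv01 R _ _ (exceeds l K) w; exact: ler_piMl.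
rewrite -expect_indic; last exact: exceeds_measurable.
rewrite -expectZ//; elim: K => [|K ih].
  apply: le_expect => // w; rewrite mulrC indicE.
  by have [/set_mem[k]|] := boolP (w \in exceeds l 0); rewrite ?mul0r ?mul1r// leqn0 => /eqP ->.
pose D w : R := \1_(exceeds l K.+1) w - \1_(exceeds l K) w.
have bD : bmfun D by rewrite /D.
have splitE X : bmfun X -> expect P (fun w => \1_(exceeds l K.+1) w * X w) =
    expect P (fun w => \1_(exceeds l K) w * X w) + expect P (fun w => D w * X w).
  by move=> bX; rewrite -expectD//; apply: eq_expect => w; rewrite /D; ring.
have lE n : expect P (fun w => l * \1_(exceeds l n) w) = expect P (fun w => \1_(exceeds l n) w * l).
  by apply: eq_expect => w; rewrite mulrC.
rewrite lE !splitE// -lE lerD//.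
  by apply: le_trans ih _; apply: U_submartingale => [|w]; [exact: exceeds_past|have /andP[] := @indic_itv01 R _ _ (exceeds l K) w].
apply: le_expect => // w; rewrite /D !indicE.
have [wK|wK] := boolP (w \in exceeds l K).
  rewrite mem_set ?subrr ?mul0r//; move/set_mem: wK => [k kK lU].
  by exists k => //; exact: leqW.
rewrite subr0; have [/set_mem[k kK lU]|] := boolP (w \in exceeds l K.+1); last by rewrite !mul0r.
rewrite !mul1r; move: kK; rewrite leq_eqVlt => /predU1P[<-//|kK].
by move/negP: wK; case; apply/mem_set; exists k.
Qed.

End doob.

Section martingale_transform.
Context {R : realType} {d : measure_display} {Om : measurableType d}.
Context (P : probability Om R) (F : nat -> set (set Om)) (M v : nat -> Om -> R) (r : nat -> R).
Hypothesis martM : controlled_martingale P F M v r.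
Implicit Types (b : nat -> R) (G X : Om -> R).

Definition mtransform b m K w : R := \sum_(m <= k < K) b k * (M k.+1 w - M k w).

Definition qvar b m K : R := \sum_(m <= k < K) (b k * r k) ^+ 2.

Lemma past_bmfun n X : past F n X -> bmfun X.
Proof. exact: bmfun_generated (past_measurable martM (n := n)). Qed.

Lemma pastS n m X : (n <= m)%N -> past F n X -> past F m X.
Proof. by move=> /(past_nd martM); exact: bmfun_generatedS. Qed.

Lemma martingale_bmfun n : bmfun (M n).
Proof. exact: past_bmfun (martingale_past martM n). Qed.

Lemma variance_bmfun n : bmfun (v n).
Proof. exact: past_bmfun (variance_past martM n). Qed.

#[local] Hint Resolve martingale_bmfun variance_bmfun : bmfun.

Lemma mtransform_past b m K : past F K (mtransform b m K).
Proof.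
rewrite /mtransform; under eq_fun do rewrite big_nat.
apply: bmfun_sum => k /andP[_ kK]; apply: bmfunM; first exact: bmfun_cst.
by apply: bmfunD; [|apply: bmfunN]; apply: pastS (martingale_past martM _) => //; exact: ltnW.
Qed.

Lemma mtransform_bmfun b m K : bmfun (mtransform b m K).
Proof. exact: past_bmfun (mtransform_past b m K). Qed.

#[local] Hint Resolve mtransform_bmfun : bmfun.

Lemma mtransformS b m K w : (m <= K)%N ->
  mtransform b m K.+1 w = mtransform b m K w + b K * (M K.+1 w - M K w).
Proof. by move=> mK; rewrite /mtransform big_nat_recr. Qed.

Lemma mtransform_geq b m K w : (K <= m)%N -> mtransform b m K w = 0.
Proof. by move=> Km; rewrite /mtransform big_geq. Qed.

Lemma mtransform_cst (a : R) m K w : (m <= K)%N ->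
  mtransform (fun=> a) m K w = a * (M K w - M m w).
Proof. by move=> mK; rewrite /mtransform -mulr_sumr telescope_sumr. Qed.

Lemma qvarS b m K : (m <= K)%N -> qvar b m K.+1 = qvar b m K + (b K * r K) ^+ 2.
Proof. by move=> mK; rewrite /qvar big_nat_recr. Qed.

Lemma qvarnn b m : qvar b m m = 0.
Proof. by rewrite /qvar big_geq. Qed.

Lemma qvar_ge0 b m K : 0 <= qvar b m K.
Proof. by rewrite /qvar sumr_ge0// => k _; exact: sqr_ge0. Qed.

Lemma norm_mulr_step_le (a : R) k w : `|a * (M k.+1 w - M k w)| <= `|a| * r k.
Proof. by rewrite normrM ler_wpM2l// (martingale_step_le martM). Qed.

Lemma sqr_mulr_step_le (a : R) k w : (a * (M k.+1 w - M k w)) ^+ 2 <= (a * r k) ^+ 2.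
Proof.
rewrite -[leLHS]real_normK ?num_real// -[leRHS]real_normK ?num_real//.
apply: lerXn2r; rewrite ?nnegrE//; apply: le_trans (norm_mulr_step_le _ _ _) _.
by rewrite normrM (ger0_norm (steps_ge0 martM k)).
Qed.

Lemma expect_step_sqr_le k : expect P (fun w => (M k.+1 w - M k w) ^+ 2) <= r k ^+ 2.
Proof.
have := expect_past_step_sqr martM (n := k) (bmfun_cst 1).
under eq_expect do rewrite mul1r.
move=> ->; rewrite ler_piMr ?sqr_ge0//; apply: expect_le_cst => // w.
by rewrite mul1r; have /andP[] := variance01 martM k w.
Qed.

Lemma expect_mtransform_sqr_le b m K : (m <= K)%N ->
  expect P (fun w => mtransform b m K w ^+ 2) <= qvar b m K.
Proof.
move: K; apply: nat_ind_ge => [|K mK ih].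
  by under eq_expect do rewrite mtransform_geq// expr0n; rewrite expect_cst qvarnn.
have -> : expect P (fun w => mtransform b m K.+1 w ^+ 2) =
    expect P (fun w => mtransform b m K w ^+ 2) +
    (2 * b K) * expect P (fun w => mtransform b m K w * (M K.+1 w - M K w)) +
    b K ^+ 2 * expect P (fun w => (M K.+1 w - M K w) ^+ 2).
  rewrite -!expectZ// -!expectD//; apply: eq_expect => w.
  by rewrite mtransformS//; ring.
rewrite (expect_past_step martM (mtransform_past b m K)) mulr0 addr0 qvarS// exprMn.
by rewrite lerD// ler_wpM2l ?sqr_ge0 ?expect_step_sqr_le.
Qed.

Lemma pow4D_le (S y rho : R) : y ^+ 2 <= rho ->
  (S + y) ^+ 4 <= S ^+ 4 + 4 * (S ^+ 3 * y) + (8 * rho * S ^+ 2 + 3 * rho ^+ 2).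
Proof.
move=> y2; have S2 := sqr_ge0 S; have y20 := sqr_ge0 y.
(* AM-GM on the cubic term: [4 S y^3 <= 2 S^2 y^2 + 2 y^4] *)
have cubic : 4 * S * y ^+ 3 <= 2 * S ^+ 2 * y ^+ 2 + 2 * y ^+ 4.
  have : 0 <= 2 * y ^+ 2 * (S - y) ^+ 2 by rewrite mulr_ge0 ?sqr_ge0// mulr_ge0.
  nra.
have quadratic : S ^+ 2 * y ^+ 2 <= S ^+ 2 * rho by rewrite ler_wpM2l.
have quartic : y ^+ 4 <= rho ^+ 2.
  by rewrite (exprM y 2 2); apply: lerXn2r => //; rewrite nnegrE// (le_trans y20).
have -> : (S + y) ^+ 4 = S ^+ 4 + 4 * (S ^+ 3 * y) + 6 * (S ^+ 2 * y ^+ 2) + 4 * S * y ^+ 3 + y ^+ 4 by ring.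
lra.
Qed.

Lemma expect_mtransform_pow4_le b m K : (m <= K)%N ->
  expect P (fun w => mtransform b m K w ^+ 4) <= 11 * qvar b m K ^+ 2.
Proof.
move: K; apply: nat_ind_ge => [|K mK ih].
  under eq_expect do rewrite mtransform_geq// expr0n.
  by rewrite expect_cst qvarnn expr0n mulr0.
set S := mtransform b m K; set q := qvar b m K in ih *; set rho := (b K * r K) ^+ 2.
have rho0 : 0 <= rho := sqr_ge0 _; have q0 : 0 <= q := qvar_ge0 b m K.
have step : expect P (fun w => mtransform b m K.+1 w ^+ 4) <= expect P (fun w => S w ^+ 4) +
    (4 * b K) * expect P (fun w => S w ^+ 3 * (M K.+1 w - M K w)) +
    ((8 * rho) * expect P (fun w => S w ^+ 2) + 3 * rho ^+ 2).
  rewrite -[3 * _](expect_cst P) -!expectZ// -!expectD//; apply: le_expect => // w.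
  rewrite mtransformS// (le_trans (pow4D_le _ (sqr_mulr_step_le (b K) K w)))//.
  by rewrite -/rho -/(S w); lra.
have S3_past : past F K (fun w => S w ^+ 3) by apply: bmfunX; exact: mtransform_past.
rewrite (expect_past_step martM S3_past) mulr0 addr0 in step.
apply: le_trans step _; rewrite qvarS// -/q -/rho.
have : 8 * rho * expect P (fun w => S w ^+ 2) <= 8 * rho * q.
  by apply: ler_wpM2l; [exact: mulr_ge0|exact: expect_mtransform_sqr_le].
nra.
Qed.

Lemma mtransform_pow4_submartingale b m K G : past F K G -> (forall w, 0 <= G w) ->
  expect P (fun w => G w * mtransform b m K w ^+ 4) <=
  expect P (fun w => G w * mtransform b m K.+1 w ^+ 4).
Proof.
move=> pG G0; have bG := past_bmfun pG; apply: (@le_trans _ _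
  (expect P (fun w => G w * mtransform b m K w ^+ 4) + (4 * (m <= K)%:R * b K) *
   expect P (fun w => (G w * mtransform b m K w ^+ 3) * (M K.+1 w - M K w)))).
  rewrite (expect_past_step martM) ?mulr0 ?addr0//.
  by apply: bmfunM => //; apply: bmfunX; exact: mtransform_past.
rewrite -expectZ// -expectD//; apply: le_expect => // w.
have [mK|Km] := leqP m K; last first.
  by rewrite !mtransform_geq// ?(ltnW Km)//; lra.
rewrite mtransformS//= mulr1; set S := mtransform b m K w; set y := M K.+1 w - M K w.
have -> : (S + b K * y) ^+ 4 = S ^+ 4 + 4 * S ^+ 3 * (b K * y) +
    (b K * y) ^+ 2 * (2 * S ^+ 2 + (2 * S + b K * y) ^+ 2) by ring.
rewrite [leRHS]mulrDr -[leLHS]addr0 lerD//; first by lra.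
by rewrite mulr_ge0// mulr_ge0 ?sqr_ge0// addr_ge0 ?sqr_ge0// mulr_ge0 ?sqr_ge0.
Qed.

Lemma mtransform_maximal b m K (l e : R) : (m <= K)%N -> 0 < l ->
  11 * qvar b m K ^+ 2 <= e * l ^+ 4 ->
  except_prob P e (fun w => forall k, (k <= K)%N -> `|mtransform b m k w| < l).
Proof.
move=> mK l0 qle; pose U k w := mtransform b m k w ^+ 4.
have U_past k : past F k (U k) by apply: bmfunX; exact: mtransform_past.
have l40 : 0 < l ^+ 4 by rewrite exprn_gt0.
have U0 k w : 0 <= U k w by rewrite /U (exprM _ 2 2) sqr_ge0.
exists (exceeds U (l ^+ 4) K); split.
- exact: exceeds_measurable (past_measurable martM) (past_nd martM) U_past _ _.
- rewrite -(ler_pM2l l40) [leRHS]mulrC; apply: le_trans qle.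
  apply: le_trans (expect_mtransform_pow4_le b mK).
  exact: doob_maximal (past_measurable martM) (past_nd martM) U_past U0
    (mtransform_pow4_submartingale b m) _ _.
- move=> w nA k kK; rewrite ltNge; apply/negP => lk; apply: nA; exists k => //.
  rewrite -(ger0_norm (U0 k w)) normrX.
  by apply: lerXn2r; rewrite ?nnegrE// ltW.
Qed.

End martingale_transform.

(* Lindeberg's method: each increment [b k (M k.+1 - M k)] is replaced by a centred normal variable
   of conditional variance [u (b k r k) ^+ 2], where [u] is frozen at the initial time. *)
Section lindeberg.
Context {R : realType} {d : measure_display} {Om : measurableType d}.
Context (P : probability Om R) (F : nat -> set (set Om)) (M v : nat -> Om -> R) (r : nat -> R).
Hypothesis martM : controlled_martingale P F M v r.
Implicit Types (b : nat -> R) (G y u : Om -> R).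

Let bM := martingale_bmfun martM.
Let bv := variance_bmfun martM.
Let bT := mtransform_bmfun martM.
#[local] Hint Resolve bM bv bT : bmfun.

Lemma expect_cos_step_moments (a : R) k G y : past F k G -> past F k y ->
  expect P (fun w => G w * cos_taylor2 (y w) (a * (M k.+1 w - M k w))) =
  expect P (fun w => G w * ((1 - (a * r k) ^+ 2 * v k w / 2) * cos (y w))).
Proof.
move=> pG py; have bG := past_bmfun martM pG; have by_ := past_bmfun martM py.
pose x w := M k.+1 w - M k w; have bx : bmfun x by rewrite /x.
transitivity (expect P (fun w => G w * cos (y w)) - a * expect P (fun w => (G w * sin (y w)) * x w) -
    a ^+ 2 / 2 * expect P (fun w => (G w * cos (y w)) * x w ^+ 2)).
  by rewrite -!expectZ// -!expectB//; apply: eq_expect => w; rewrite /cos_taylor2 -/(x w); field.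
rewrite (expect_past_step martM) ?(expect_past_step_sqr martM)//.
rewrite mulr0 subr0 mulrA -expectZ// -expectB//; apply: eq_expect => w.
by field.
Qed.

Lemma expect_cos_step_taylor (a : R) k G y (C e : R) : bmfun G -> bmfun y ->
  (forall w, `|G w| <= C) -> `|a| * r k <= e -> e <= 1 ->
  `|expect P (fun w => G w * cos (y w + a * (M k.+1 w - M k w))) -
    expect P (fun w => G w * cos_taylor2 (y w) (a * (M k.+1 w - M k w)))| <= C * ((a * r k) ^+ 2 * (2 * e)).
Proof.
move=> bG by_ GC are e1; rewrite /cos_taylor2; apply: expect_dist_le => // w.
rewrite -mulrBr normrM; apply: ler_pM => //; apply: le_trans (cosD_taylor2 _ _) _.
set z := a * _; have z0 := normr_ge0 z.
have ze : `|z| <= e := le_trans (norm_mulr_step_le martM a k w) are.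
have z2 : `|z| ^+ 2 <= (a * r k) ^+ 2 by rewrite real_normK ?num_real//; exact: (sqr_mulr_step_le martM).
have z3 : `|z| ^+ 3 <= (a * r k) ^+ 2 * e by rewrite exprSr; apply: ler_pM => //; exact: sqr_ge0.
have z4 : `|z| ^+ 4 <= `|z| ^+ 3 by rewrite exprS ler_piMl ?exprn_ge0// (le_trans ze).
lra.
Qed.

Lemma expect_variance_replace (rho : R) k G y u (C e delta : R) :
  bmfun G -> bmfun y -> bmfun u -> (forall w, 0 <= u w <= 1) -> (forall w, `|G w| <= C) ->
  expect P (fun w => `|v k w - u w|) <= delta -> 0 <= rho <= e ->
  `|expect P (fun w => G w * ((1 - rho * v k w / 2) * cos (y w))) -
    expect P (fun w => G w * (normal_cf (u w * rho) * cos (y w)))| <= C * (rho * (delta + e)).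
Proof.
move=> bG by_ bu u01 GC vu /andP[rho0 rhoe].
have C0 : 0 <= C := le_trans (normr_ge0 _) (GC point).
have urho0 w : 0 <= u w * rho by have /andP[? _] := u01 w; exact: mulr_ge0.
have bcf : bmfun (fun w => normal_cf (u w * rho)).
  by apply: bmfun_normal_cf => //; apply: bmfun_measurable.
apply: (@le_trans _ _ (C * (rho * (expect P (fun w => `|v k w - u w|) + e)))); last first.
  by rewrite ler_wpM2l// ler_wpM2l// lerD2r.
rewrite -[in leRHS](expect_cst P e) -expectD// -!expectZ// -expectB//.
apply: norm_expect_le => // w; rewrite -mulrBr normrM; apply: ler_pM => //.
rewrite -mulrBl normrM -[leRHS]mulr1; apply: ler_pM => //; last exact: cos_max.
have -> : 1 - rho * v k w / 2 - normal_cf (u w * rho) =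
    (rho / 2) * (u w - v k w) - (normal_cf (u w * rho) - (1 - u w * rho / 2)) by field.
apply: le_trans (ler_normB _ _) _; rewrite [leRHS]mulrDr; apply: lerD.
  by rewrite normrM [`|u w - _|]distrC ger0_norm ?divr_ge0// ler_wpM2r//; lra.
apply: le_trans (normal_cf_taylor (urho0 w)) _; have /andP[u0 u1] := u01 w.
have u2 : u w ^+ 2 <= 1 by rewrite expr_le1.
rewrite exprMn -[leRHS]mul1r; apply: ler_pM; rewrite ?sqr_ge0//.
by rewrite expr2 ler_wpM2l.
Qed.

Lemma lindeberg_step (a : R) k G y u (C delta e : R) :
  past F k G -> past F k y -> past F k u ->
  (forall w, 0 <= u w <= 1) -> (forall w, `|G w| <= C) ->
  expect P (fun w => `|v k w - u w|) <= delta -> `|a| * r k <= e -> e <= 1 ->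
  `|expect P (fun w => G w * cos (y w + a * (M k.+1 w - M k w))) -
    expect P (fun w => G w * (normal_cf (u w * (a * r k) ^+ 2) * cos (y w)))|
  <= C * ((a * r k) ^+ 2 * (delta + 3 * e)).
Proof.
move=> pG py pu u01 GC vu are e1.
have bG := past_bmfun martM pG; have by_ := past_bmfun martM py; have bu := past_bmfun martM pu.
have ar0 : 0 <= `|a| * r k by rewrite mulr_ge0 ?(steps_ge0 martM).
have ar2e : 0 <= (a * r k) ^+ 2 <= e.
  rewrite sqr_ge0 -real_normK ?num_real//= normrM (ger0_norm (steps_ge0 martM k)).
  by rewrite expr2 (le_trans _ are)// ler_piMl// (le_trans are).
apply: le_trans (ler_distD (expect P (fun w => G w * cos_taylor2 (y w) (a * (M k.+1 w - M k w)))) _ _) _.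
have taylor := expect_cos_step_taylor bG by_ GC are e1.
have replace := expect_variance_replace bG by_ bu u01 GC vu ar2e.
rewrite -expect_cos_step_moments// in replace.
by apply: le_trans (lerD taylor replace) _; lra.
Qed.

Lemma lindeberg_bound b m K G y u (C delta e : R) : (m <= K)%N ->
  past F m G -> past F m y -> past F m u ->
  (forall w, 0 <= u w <= 1) -> (forall w, `|G w| <= C) ->
  (forall k, (m <= k < K)%N -> expect P (fun w => `|v k w - u w|) <= delta) ->
  (forall k, (m <= k < K)%N -> `|b k| * r k <= e) -> e <= 1 ->
  `|expect P (fun w => G w * cos (y w + mtransform M b m K w)) -
    expect P (fun w => G w * (normal_cf (u w * qvar r b m K) * cos (y w)))|
  <= C * (qvar r b m K * (delta + 3 * e)).
Proof.
move=> mK pG py pu u01 GC vu bre e1.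
pose cf k w := normal_cf (u w * qvar r b k K).
pose Psi k := expect P (fun w => G w * cf k w * cos (y w + mtransform M b m k w)).
have uq0 k w : 0 <= u w * qvar r b k K by have /andP[? _] := u01 w; rewrite mulr_ge0 ?qvar_ge0.
have pcf k : past F m (cf k).
  by apply: bmfun_normal_cf => //; apply: bmfun_measurable; apply: bmfunM => //; exact: bmfun_cst.
have Psi_step k : (m <= k)%N -> (k < K)%N ->
    `|Psi k.+1 - Psi k| <= C * ((b k * r k) ^+ 2 * (delta + 3 * e)).
  move=> mk kK; have mkK : (m <= k < K)%N by rewrite mk.
  have -> : Psi k.+1 = expect P (fun w => (G w * cf k.+1 w) *
      cos ((y w + mtransform M b m k w) + b k * (M k.+1 w - M k w))).
    by apply: eq_expect => w; rewrite mtransformS// addrA.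
  have -> : Psi k = expect P (fun w => (G w * cf k.+1 w) *
      (normal_cf (u w * (b k * r k) ^+ 2) * cos (y w + mtransform M b m k w))).
    apply: eq_expect => w; rewrite /cf {1}/qvar (big_ltn kK) mulrDr normal_cfD.
    by rewrite -/(qvar r b k.+1 K); ring.
  apply: lindeberg_step; rewrite ?bre ?vu//.
  - by apply: bmfunM; apply: (pastS martM mk).
  - by apply: bmfunD; [exact: (pastS martM mk)|exact: (mtransform_past martM)].
  - exact: (pastS martM mk).
  - by move=> w; rewrite normrM -[leRHS]mulr1; apply: ler_pM => //; exact: normal_cf_le1.
suff Psi_dist k : (m <= k)%N -> (k <= K)%N -> `|Psi k - Psi m| <= C * (qvar r b m k * (delta + 3 * e)).
  have := Psi_dist K mK (leqnn K); rewrite {1 2}/Psi /cf qvarnn.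
  under eq_expect do rewrite mulr0 normal_cf0 mulr1.
  under [X in `|_ - X|]eq_expect do rewrite mtransform_geq// addr0 -mulrA.
  by [].
move: k; apply: nat_ind_ge => [_|k mk ih kK]; first by rewrite subrr normr0 qvarnn mul0r mulr0.
rewrite -(subrK (Psi k) (Psi k.+1)) -addrA (le_trans (ler_normD _ _))//.
rewrite qvarS// mulrDl mulrDr [leRHS]addrC.
by apply: lerD; [exact: Psi_step|exact: ih (ltnW kK)].
Qed.

End lindeberg.

(** * Asymptotics of the step sizes *)

Section sequences_of_reals.
Context {R : realType}.
Implicit Types (u v : R^nat) (l : R).

Lemma near_eq_cvgn u v l : (\forall n \near \oo, u n = v n) -> v @ \oo --> l -> u @ \oo --> l.
Proof. by move=> uv; apply: cvg_trans; apply: near_eq_cvg; apply: filterS uv => n ->. Qed.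

Lemma cvgn_bounded u l : u @ \oo --> l -> exists2 C : R, 0 < C & forall n, u n <= C.
Proof.
move=> ul; have /cvg_seq_bounded/pinfty_ex_gt0[C C0 uC] : cvgn u by apply/cvg_ex; exists l.
by exists C => // n; apply: le_trans (ler_norm _) _; exact: uC.
Qed.

Definition tail u m : R := limn (series u) - series u m.

Section tail.
Variable u : R^nat.
Hypothesis cvg_u : cvgn (series u).

Lemma series_sub_cvg_tail m : series u L - series u m @[L --> \oo] --> tail u m.
Proof. by apply: cvgB => //; exact: cvg_cst. Qed.

Lemma tail_cvg0 : tail u m @[m --> \oo] --> 0.
Proof.
rewrite -[X in _ --> X](subrr (limn (series u))).
by apply: cvgB => //; exact: cvg_cst.
Qed.

Lemma sum_tail m L : (m <= L)%N -> \sum_(m <= k < L) u k = tail u m - tail u L.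
Proof. by move=> mL; rewrite -sub_series_geq// /tail; lra. Qed.

Hypothesis u_ge0 : forall n, 0 <= u n.

Lemma series_nd : nondecreasing_seq (series u).
Proof. by move=> m n mn; rewrite -subr_ge0 sub_series_geq// sumr_ge0. Qed.

Lemma tail_ge0 m : 0 <= tail u m.
Proof. by rewrite subr_ge0; exact: nondecreasing_cvgn_le series_nd cvg_u m. Qed.

Lemma tail_nincr m K : (m <= K)%N -> tail u K <= tail u m.
Proof. by move=> mK; rewrite lerD2l lerN2 series_nd. Qed.

End tail.

Section telescoping_comparison.
Variables (u v : R^nat) (C : R).
Hypothesis u_le : forall k, u k <= C * (v k - v k.+1).

Lemma sum_le_telescope m L : (m <= L)%N -> \sum_(m <= k < L) u k <= C * (v m - v L).
Proof.
move=> mL; apply: le_trans (ler_sum _ (fun k _ => u_le k)) _.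
rewrite -mulr_sumr -[v m - v L]opprB -(telescope_sumr v mL) -sumrN.
by under [in leRHS]eq_bigr do rewrite opprB.
Qed.

Hypotheses (C_ge0 : 0 <= C) (v_ge0 : forall k, 0 <= v k).

Lemma is_cvg_series_telescope : (forall k, 0 <= u k) -> cvgn (series u).
Proof.
move=> u0; apply: nondecreasing_is_cvgn; first exact: series_nd.
exists (C * v 0%N) => _ [n _ <-]; apply: le_trans (sum_le_telescope (leq0n n)) _.
by rewrite ler_wpM2l// lerBlDr lerDl.
Qed.

Lemma tail_le_telescope m : cvgn (series u) -> tail u m <= C * v m.
Proof.
move=> cvg_u; apply: (cvgr_to_le (@series_sub_cvg_tail u cvg_u m)); near=> L.
have mL : (m <= L)%N by near: L; exact: nbhs_infty_ge.
rewrite sub_series_geq// (le_trans (sum_le_telescope mL))//.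
by rewrite ler_wpM2l// lerBlDr lerDl.
Unshelve. all: by end_near. Qed.

End telescoping_comparison.

Lemma stolz_cesaro_tail u v l : cvgn (series u) -> (forall k, v k.+1 < v k) ->
  v @ \oo --> 0 -> u k / (v k - v k.+1) @[k --> \oo] --> l -> tail u k / v k @[k --> \oo] --> l.
Proof.
move=> cvg_u v_decr v0 uvl.
have v_nincr m n : (m <= n)%N -> v n <= v m.
  by move: n; apply: nat_ind_ge => // n _; apply: le_trans; exact: ltW.
have v_gt0 k : 0 < v k.
  apply: le_lt_trans (v_decr k); apply: (cvgr_to_le v0); near=> n.
  by apply: v_nincr; near: n; exact: nbhs_infty_ge.
have d0 k : 0 < v k - v k.+1 by rewrite subr_gt0.
apply/cvgrPdist_le => e e0; have [A _ uvA] := (cvgrPdist_le _ _).1 uvl _ e0.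
exists A => // m /= Am; have vm := v_gt0 m.
have close L : (m <= L)%N -> `|series u L - series u m - l * (v m - v L)| <= e * (v m - v L).
  move=> mL; rewrite sub_series_geq// -[v m - v L]opprB -(telescope_sumr v mL) -sumrN !mulr_sumr -sumrB.
  apply: le_trans (ler_norm_sum _ _ _) _; rewrite big_nat [leRHS]big_nat.
  apply: ler_sum => k /andP[mk _]; rewrite opprB.
  rewrite -{1}[u k](divfK (lt0r_neq0 (d0 k))) -mulrBl normrM (gtr0_norm (d0 k)) ler_pM2r// distrC.
  exact: uvA (leq_trans Am mk).
have vmL : v m - v L @[L --> \oo] --> v m.
  by rewrite -[X in _ --> X]subr0; apply: cvgB => //; exact: cvg_cst.
have gap : `|series u L - series u m - l * (v m - v L)| - e * (v m - v L) @[L --> \oo] -->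
    `|tail u m - l * v m| - e * v m.
  apply: cvgB; last by apply: cvgM => //; exact: cvg_cst.
  apply: cvg_norm; apply: cvgB; first exact: series_sub_cvg_tail.
  by apply: cvgM => //; exact: cvg_cst.
have -> : l - tail u m / v m = (l * v m - tail u m) / v m by field; rewrite gt_eqF.
rewrite normrM normfV (gtr0_norm vm) ler_pdivrMr// distrC -subr_le0.
apply: (cvgr_to_le gap); near=> L; rewrite subr_le0; apply: close.
by near: L; exact: nbhs_infty_ge.
Unshelve. all: by end_near. Qed.

Lemma contraction_cvg0 (a b x : R^nat) : (forall n, 0 <= a n) -> ~ cvgn (series a) ->
  (forall n, 0 <= b n) -> cvgn (series b) -> (forall n, 0 <= x n) ->
  (forall n, x n.+1 <= (1 - a n) * x n + b n) -> x @ \oo --> 0.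
Proof.
move=> a0 dvg_a b0 cvg_b x0 x_le.
have x_le_tail k L : (k <= L)%N -> x L <= x k + tail b k.
  move=> kL; suff : x L <= x k + \sum_(k <= i < L) b i.
    by rewrite sum_tail//; have := tail_ge0 cvg_b b0 L; lra.
  move: L kL; apply: nat_ind_ge => [|L kL ih]; first by rewrite big_geq// addr0.
  rewrite big_nat_recr//= addrA (le_trans (x_le L))// lerD2r (le_trans _ ih)//.
  by rewrite mulrBl mul1r gerBl mulr_ge0.
have sum_ax L : \sum_(0 <= k < L) a k * x k + x L <= x 0%N + \sum_(0 <= k < L) b k.
  elim: L => [|L ih]; first by rewrite !big_geq// addr0 add0r.
  by rewrite !big_nat_recr//=; have := x_le L; lra.
have infty_often e m : 0 < e -> exists2 k, (m <= k)%N & x k < e.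
  move=> e0; apply: contrapT => x_ge; apply: dvg_a.
  apply: nondecreasing_is_cvgn; first exact: series_nd.
  exists (series a m + e^-1 * (x 0%N + tail b 0)) => _ [L _ <-].
  have [Lm|/ltnW mL] := leqP L m.
    rewrite (le_trans (series_nd a0 Lm))// lerDl mulr_ge0 ?invr_ge0 ?(ltW e0)//.
    by rewrite addr_ge0// tail_ge0.
  rewrite -lerBlDl sub_series_geq// ler_pdivlMl// mulr_sumr.
  apply: (@le_trans _ _ (\sum_(m <= k < L) a k * x k)).
    rewrite big_nat [leRHS]big_nat; apply: ler_sum => k /andP[mk _].
    rewrite mulrC ler_wpM2l// leNgt; apply/negP => xe.
    by apply: x_ge; exists k.
  have := sum_ax L; rewrite (big_cat_nat _ (n := m))//= (sum_tail b (leq0n L)).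
  have : 0 <= \sum_(0 <= k < m) a k * x k by apply: sumr_ge0 => k _; exact: mulr_ge0.
  by have := tail_ge0 cvg_b b0 L; have := x0 L; lra.
apply/cvgrPdist_le => e e0; have e20 : 0 < e / 2 by rewrite divr_gt0.
have [A _ tailA] := (cvgrPdist_le _ _).1 (tail_cvg0 cvg_b) _ e20.
have [k Ak xk] := infty_often _ A e20.
exists k => // L /= kL; rewrite sub0r normrN ger0_norm//.
have := x_le_tail _ _ kL; have := tailA k Ak; rewrite /= sub0r normrN.
by have := ler_norm (tail b k); lra.
Qed.

End sequences_of_reals.

Section powR_facts.
Context {R : realType}.
Implicit Types x y t a p : R.

Lemma powR_slope x y a : 0 < x -> x < y ->
  exists2 z, x < z < y & y `^ a - x `^ a = a * z `^ (a - 1) * (y - x).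
Proof.
move=> x0 xy.
have d_powR (z : R) : 0 < z -> is_derive z 1 (fun x : R => x `^ a) (a * z `^ (a - 1)).
  by move=> z0; exact: is_derive1_powR.
have [z||z + yxE] := @MVT _ (fun x : R => x `^ a) (fun z => a * z `^ (a - 1)) x y xy.
- by rewrite in_itv/= => /andP[xz _]; apply: d_powR; exact: lt_trans xz.
- apply: derivable_within_continuous => z; rewrite in_itv/= => /andP[xz _].
  by have [] := d_powR z (lt_le_trans x0 xz).
- by rewrite in_itv/= => hz; exists z.
Qed.

Lemma le_powR_base x y p : 0 <= p -> 0 <= x -> x <= y -> x `^ p <= y `^ p.
Proof.
move=> p0 x0 xy; apply: (ge0_ler_powR p0) => //; rewrite nnegrE//.
exact: le_trans xy.
Qed.

Lemma le_powR_base_neg x y a : a <= 0 -> 0 < x -> x <= y -> y `^ a <= x `^ a.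
Proof.
move=> a0 x0 xy; have y0 := lt_le_trans x0 xy.
rewrite -[a]opprK 2!(powRN _ (- a)) lef_pV2 ?posrE ?powR_gt0//.
by apply: le_powR_base; rewrite ?oppr_ge0// ltW.
Qed.

Lemma powR_lipschitz p x0 x y : 0 < p <= 1 -> 0 < x0 -> x0 <= x -> x <= y ->
  `|y `^ p - x `^ p| <= p * x0 `^ (p - 1) * (y - x).
Proof.
move=> /andP[p0 p1] x00 x0x; rewrite le_eqVlt => /predU1P[->|xy].
  by rewrite !subrr normr0 mulr0.
have [z /andP[xz zy] ->] := powR_slope p (lt_le_trans x00 x0x) xy.
rewrite ger0_norm; last by rewrite !mulr_ge0 ?powR_ge0 ?subr_ge0 ?ltW.
rewrite ler_wpM2r ?subr_ge0 ?(ltW xy)// ler_pM2l//.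
by apply: le_powR_base_neg => //; [lra|exact: ltW (le_lt_trans x0x xz)].
Qed.

Lemma continuous_powR p x : 0 < x -> {for x, continuous (fun x : R => x `^ p)}.
Proof.
move=> x0; apply: differentiable_continuous; apply/derivable1_diffP.
by apply: derivable_powR; rewrite in_itv/= x0.
Qed.

Lemma cvg_powR_base (u : R^nat) x p : 0 < x -> u @ \oo --> x -> u n `^ p @[n --> \oo] --> x `^ p.
Proof.
move=> x0 ux; suff cont_p : {for x, continuous (fun x : R => x `^ p)} by exact: cvg_comp ux cont_p.
exact: continuous_powR.
Qed.

Lemma cvg_nat_powRN p : 0 < p -> (n%:R : R) `^ (- p) @[n --> \oo] --> 0.
Proof.
move=> p0; apply/cvgrPdist_le => e e0; near=> n.
have n0 : (0 : R) < n%:R by rewrite ltr0n; near: n; exact: nbhs_infty_gt.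
rewrite sub0r normrN ger0_norm ?powR_ge0// powRN.
rewrite -[leRHS]invrK lef_pV2 ?posrE ?powR_gt0 ?invr_gt0//.
have en : e^-1 `^ p^-1 <= n%:R by near: n; exact: nbhs_infty_ger.
have := le_powR_base (ltW p0) (powR_ge0 _ _) en.
by rewrite -powRrM mulVf ?gt_eqF// powRr1// invr_ge0 ltW.
Unshelve. all: by end_near. Qed.

Lemma powRD_gt0 x p a : 0 < x -> x `^ (p + a) = x `^ p * x `^ a.
Proof. by move=> x0; rewrite powRD// (gt_eqF x0) implybT. Qed.

Lemma powRK x p : 0 < x -> x `^ p * x `^ (- p) = 1.
Proof. by move=> x0; rewrite -powRD_gt0// subrr powRr0. Qed.

End powR_facts.

Section grid.
Context {R : realType}.
Implicit Types (m n : nat) (t : R).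

Definition grid_floor m t : R := (truncn (m%:R * t))%:R / m%:R.

Lemma grid_floor_ge0 m t : 0 <= grid_floor m t.
Proof. exact: divr_ge0. Qed.

Lemma grid_floor_le m t : 0 <= t -> grid_floor m t <= t.
Proof.
move=> t0; case: m => [|m]; first by rewrite /grid_floor invr0 mulr0.
by rewrite ler_pdivrMr ?ltr0n// mulrC truncn_le// mulr_ge0.
Qed.

Lemma lt_grid_floorD m t : (0 < m)%N -> t < grid_floor m t + m%:R^-1.
Proof.
move=> m0; have mR : (0 : R) < m%:R by rewrite ltr0n.
by rewrite -[m%:R^-1]mul1r -mulrDl natr1 ltr_pdivlMr// mulrC truncnS_gt.
Qed.

Lemma grid_floor_dist m t : (0 < m)%N -> 0 <= t -> `|grid_floor m t - t| <= m%:R^-1.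
Proof.
move=> m0 t0; rewrite distrC ger0_norm ?subr_ge0 ?grid_floor_le//.
by rewrite lerBlDl ltW// lt_grid_floorD.
Qed.

Lemma grid_floor_cvg t : 0 <= t -> grid_floor n t @[n --> \oo] --> t.
Proof.
move=> t0; apply/cvgrPdist_le => e e0; near=> n.
have n0 : (0 < n)%N by near: n; exact: nbhs_infty_gt.
rewrite distrC (le_trans (grid_floor_dist n0 t0))//.
rewrite -[leRHS]invrK lef_pV2 ?posrE ?ltr0n ?invr_gt0//.
by near: n; exact: nbhs_infty_ger.
Unshelve. all: by end_near. Qed.

Lemma near_le_truncn t (A : nat) : 0 < t -> \forall n \near \oo, (A <= truncn (n%:R * t))%N.
Proof.
move=> t0; near=> n; rewrite truncn_ge_nat ?mulr_ge0 ?(ltW t0)// -ler_pdivrMr//.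
by near: n; exact: nbhs_infty_ger.
Unshelve. all: by end_near. Qed.

Lemma cvg_natV : (n%:R^-1 : R) @[n --> \oo] --> (0 : R).
Proof.
have := @cvg_nat_powRN R 1 ltr01; apply: cvg_trans; apply: near_eq_cvg.
by apply: nearW => n; rewrite powR_inv1.
Qed.

Lemma cvg_ratioS : (n.+1%:R / n%:R : R) @[n --> \oo] --> (1 : R).
Proof.
apply: (@near_eq_cvgn _ _ (fun n => 1 + n%:R^-1)).
  near=> n; have n0 : (0 : R) < n%:R by rewrite ltr0n; near: n; exact: nbhs_infty_gt.
  by rewrite -natr1 mulrDl divff ?gt_eqF// mul1r.
by rewrite -[X in _ --> X]addr0; apply: cvgD cvg_natV; exact: cvg_cst.
Unshelve. all: by end_near. Qed.

Lemma cvg_truncnS_ratio t : 0 <= t -> ((truncn (n%:R * t)).+1%:R / n%:R : R) @[n --> \oo] --> t.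
Proof.
move=> t0; rewrite -[X in _ --> X]addr0; under eq_fun do rewrite -natr1 mulrDl mul1r.
by apply: cvgD cvg_natV; exact: grid_floor_cvg.
Qed.

End grid.

Record regular_steps {R : realType} (r : R^nat) (g c : R) : Prop := RegularSteps {
  steps01 : forall n, 0 <= r n < 1;
  exponent_range : 2^-1 < g <= 1;
  scale_gt0 : 0 < c;
  steps_cvg : n%:R `^ g * r n @[n --> \oo] --> c }.

Section step_sizes.
Context {R : realType} (r : R^nat) (g c : R).
Hypothesis reg : regular_steps r g c.
Let p := 2 * g - 1.

Lemma tail_exponent_range : 0 < 2 * g - 1 <= 1.
Proof. by have /andP[? ?] := exponent_range reg; apply/andP; split; lra. Qed.
Let p0 : 0 < p. Proof. by have /andP[] := tail_exponent_range. Qed.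
Let p1 : p <= 1. Proof. by have /andP[] := tail_exponent_range. Qed.

Let r0 k : 0 <= r k. Proof. by have /andP[] := steps01 reg k. Qed.
Let r2_0 k : 0 <= r k ^+ 2 := sqr_ge0 (r k).

Definition sqr_tail m : R := tail (fun k => r k ^+ 2) m.

Lemma stepsS_cvg : k.+1%:R `^ g * r k @[k --> \oo] --> c.
Proof.
have ratio := cvg_powR_base (p := g) ltr01 (@cvg_ratioS R).
rewrite powR1 in ratio; rewrite -[c]mul1r.
apply: near_eq_cvgn (cvgM ratio (steps_cvg reg)); near=> k.
have k0 : (0 : R) < k%:R by rewrite ltr0n; near: k; exact: nbhs_infty_gt.
by rewrite /= mulrA -powRM ?divr_ge0// divfK ?gt_eqF.
Unshelve. all: by end_near. Qed.

Lemma sqr_steps_cvg : k.+1%:R `^ (p + 1) * r k ^+ 2 @[k --> \oo] --> c ^+ 2.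
Proof.
rewrite expr2; apply: near_eq_cvgn (cvgM stepsS_cvg stepsS_cvg); apply: nearW => k.
have -> : p + 1 = g * 2%:R by rewrite /p; lra.
by rewrite powRrM powR_mulrn ?powR_ge0//=; ring.
Qed.

Lemma sqr_steps_bound : exists2 C : R, 0 < C & forall k, r k ^+ 2 <= C * k.+1%:R `^ (- p - 1).
Proof.
have [C C0 r2C] := cvgn_bounded sqr_steps_cvg; exists C => // k.
have k0 : (0 : R) < k.+1%:R by rewrite ltr0n.
by rewrite -opprD powRN ler_pdivlMr ?powR_gt0// mulrC.
Qed.

Lemma powR_decrement_bounds k :
  p * k.+2%:R `^ (- p - 1) <= k.+1%:R `^ (- p) - (k.+2%:R : R) `^ (- p) <= p * k.+1%:R `^ (- p - 1).
Proof.
have k1 : (0 : R) < k.+1%:R by rewrite ltr0n.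
have kk : (k.+1%:R : R) < k.+2%:R by rewrite ltr_nat.
have [z /andP[kz zk]] := powR_slope (- p) k1 kk.
rewrite (_ : k.+2%:R - k.+1%:R = 1); last by rewrite -natrB// subSnn.
rewrite mulr1 -[X in _ <= X <= _]opprB => ->; rewrite mulNr opprK.
have q0 : - p - 1 <= 0 by have := p0; lra.
by rewrite !ler_pM2l// !le_powR_base_neg ?(ltW kz) ?(ltW zk)// (lt_trans k1).
Qed.

Lemma powR_decrement_gt0 k : 0 < k.+1%:R `^ (- p) - (k.+2%:R : R) `^ (- p).
Proof.
have /andP[decr_ge _] := powR_decrement_bounds k; apply: lt_le_trans decr_ge.
by rewrite mulr_gt0// powR_gt0// ltr0n.
Qed.

Lemma powR_decrement_cvg :
  k.+1%:R `^ (p + 1) * (k.+1%:R `^ (- p) - (k.+2%:R : R) `^ (- p)) @[k --> \oo] --> p.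
Proof.
have ratioS : (k.+2%:R / k.+1%:R : R) @[k --> \oo] --> (1 : R).
  by have := @cvg_ratioS R; rewrite -cvg_shiftS.
have ratio : p * (k.+2%:R / k.+1%:R) `^ (- (p + 1)) @[k --> \oo] --> p.
  rewrite -[X in _ --> X]mulr1; apply: cvgM; first exact: cvg_cst.
  by have := cvg_powR_base (p := - (p + 1)) ltr01 ratioS; rewrite powR1.
apply: (squeeze_cvgr _ ratio (@cvg_cst _ p _ \oo _)); apply: nearW => k.
have k0 : (0 : R) < k.+1%:R by rewrite ltr0n.
have kp : 0 < k.+1%:R `^ (p + 1) :> R by rewrite powR_gt0.
have /andP[] := powR_decrement_bounds k; rewrite -(ler_pM2l kp) -[_ <= p * _](ler_pM2l kp) -opprD.
rewrite mulrCA [X in _ -> _ -> X]/= => lo up; apply/andP; split.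
  apply: le_trans lo; rewrite ler_pM2l// powRM ?invr_ge0// [leLHS]mulrC.
  by rewrite -[k.+1%:R^-1]powR_inv1// -powRrM mulN1r opprK.
by apply: le_trans up _; rewrite mulrCA powRK ?mulr1.
Qed.

Lemma sqr_steps_decrement_cvg :
  r k ^+ 2 / (k.+1%:R `^ (- p) - k.+2%:R `^ (- p)) @[k --> \oo] --> c ^+ 2 / p.
Proof.
apply: near_eq_cvgn (cvgM sqr_steps_cvg (cvgV _ powR_decrement_cvg)); last by rewrite gt_eqF.
apply: nearW => k; have d0 := powR_decrement_gt0 k.
have k0 : 0 < k.+1%:R `^ (p + 1) :> R by rewrite powR_gt0 ?ltr0n.
by rewrite /=; field; rewrite !gt_eqF.
Qed.

Lemma sqr_steps_le_decrement : exists2 C : R, 0 < C &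
  forall k, r k ^+ 2 <= C * (k.+1%:R `^ (- p) - k.+2%:R `^ (- p)).
Proof.
have [C C0 rC] := cvgn_bounded sqr_steps_decrement_cvg; exists C => // k.
by rewrite -ler_pdivrMr ?powR_decrement_gt0.
Qed.

Lemma is_cvg_series_sqr_steps : cvgn (series (fun k => r k ^+ 2)).
Proof.
have [C C0 rC] := sqr_steps_le_decrement.
by apply: is_cvg_series_telescope rC (ltW C0) _ r2_0 => k; exact: powR_ge0.
Qed.

Lemma sqr_tail_ge0 m : 0 <= sqr_tail m.
Proof. exact: tail_ge0 is_cvg_series_sqr_steps r2_0 m. Qed.

Lemma sqr_tail_nincr m K : (m <= K)%N -> sqr_tail K <= sqr_tail m.
Proof. exact: tail_nincr. Qed.

Lemma sqr_tail_cvg0 : sqr_tail m @[m --> \oo] --> 0.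
Proof. exact: tail_cvg0 is_cvg_series_sqr_steps. Qed.

Lemma sum_sqr_steps m L : (m <= L)%N -> \sum_(m <= k < L) r k ^+ 2 = sqr_tail m - sqr_tail L.
Proof. exact: sum_tail. Qed.

Lemma sqr_tail_bound : exists2 C : R, 0 < C & forall m, sqr_tail m <= C * m.+1%:R `^ (- p).
Proof.
have [C C0 rC] := sqr_steps_le_decrement; exists C => // m.
apply: (tail_le_telescope rC (ltW C0)) is_cvg_series_sqr_steps => k; exact: powR_ge0.
Qed.

Lemma sqr_tail_cvg : K.+1%:R `^ p * sqr_tail K @[K --> \oo] --> c ^+ 2 / p.
Proof.
have vp : (k.+1%:R : R) `^ (- p) @[k --> \oo] --> 0.
  by have := @cvg_nat_powRN R p p0; rewrite -cvg_shiftS.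
have decr k : (k.+2%:R : R) `^ (- p) < k.+1%:R `^ (- p) by rewrite -subr_gt0 powR_decrement_gt0.
apply: near_eq_cvgn (stolz_cesaro_tail is_cvg_series_sqr_steps decr vp sqr_steps_decrement_cvg).
by apply: nearW => k; rewrite powRN invrK mulrC.
Qed.

Lemma sqr_tail_truncn_cvg t : 0 < t ->
  n%:R `^ p * sqr_tail (truncn (n%:R * t)) @[n --> \oo] --> c ^+ 2 / p * t `^ (- p).
Proof.
move=> t0; have tail_cvg : (truncn (n%:R * t)).+1%:R `^ p * sqr_tail (truncn (n%:R * t))
    @[n --> \oo] --> c ^+ 2 / p.
  apply/cvgrPdist_le => e e0; have [A _ tailA] := (cvgrPdist_le _ _).1 sqr_tail_cvg _ e0.
  by apply: filterS (near_le_truncn A t0) => n /tailA.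
have ratio := cvg_powR_base (p := - p) t0 (cvg_truncnS_ratio (ltW t0)).
apply: near_eq_cvgn (cvgM tail_cvg ratio); near=> n.
have n0 : (0 : R) < n%:R by rewrite ltr0n; near: n; exact: nbhs_infty_gt.
have k0 : (0 : R) < (truncn (n%:R * t)).+1%:R by rewrite ltr0n.
rewrite /= powRM ?invr_ge0 ?ltW// -[n%:R^-1]powR_inv1 ?(ltW n0)// -powRrM mulN1r opprK powRN.
by field; rewrite gt_eqF// powR_gt0.
Unshelve. all: by end_near. Qed.

Lemma sqr_tail_square_cvg0 : n%:R `^ p * sqr_tail (n * n) @[n --> \oo] --> 0.
Proof.
have [C C0 tailC] := sqr_tail_bound.
have upper : C * n%:R `^ (- p) @[n --> \oo] --> 0.
  by rewrite -[X in _ --> X](mulr0 C); apply: cvgM; [exact: cvg_cst|exact: cvg_nat_powRN].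
apply: (squeeze_cvgr _ (@cvg_cst _ 0 _ \oo _) upper); near=> n.
have n0 : (0 : R) < n%:R by rewrite ltr0n; near: n; exact: nbhs_infty_gt.
have np := powR_gt0 p n0.
rewrite mulr_ge0 ?sqr_tail_ge0 ?powR_ge0//=; apply: le_trans (ler_wpM2l (ltW np) (tailC _)) _.
rewrite mulrCA ler_pM2l// !powRN ler_pdivrMr ?powR_gt0 ?ltr0n//.
rewrite mulrC ler_pdivlMr// -powRM ?(ltW n0)//.
by apply: le_powR_base; rewrite ?(ltW p0) ?mulr_ge0// -natrM ler_nat.
Unshelve. all: by end_near. Qed.

Lemma sum_weighted_sqr_steps_le : exists2 C : R, 0 < C & forall K,
  \sum_(0 <= k < K) (k.+1%:R `^ p * r k) ^+ 2 <= C * K%:R `^ p.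
Proof.
have [C C0 r2C] := sqr_steps_bound; exists (C / p); first by rewrite divr_gt0.
suff incr k : (k.+1%:R `^ p * r k) ^+ 2 <= C / p * (k.+1%:R `^ p - k%:R `^ p).
  move=> K; apply: (@le_trans _ _ (\sum_(0 <= k < K) C / p * (k.+1%:R `^ p - k%:R `^ p))).
    by apply: ler_sum => k _.
  by rewrite -mulr_sumr (telescope_sumr (fun k => k%:R `^ p))// powR0 ?gt_eqF// subr0.
have k0 : (0 : R) < k.+1%:R by rewrite ltr0n.
have slope : p * k.+1%:R `^ (p - 1) <= k.+1%:R `^ p - (k%:R : R) `^ p.
  case: k k0 => [|k] k0; first by rewrite powR0 ?gt_eqF// !powR1 subr0 mulr1.
  have kR : (0 : R) < k.+1%:R by rewrite ltr0n.
  have kk : (k.+1%:R : R) < k.+2%:R by rewrite ltr_nat.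
  have [z /andP[kz zk] ->] := powR_slope p kR kk.
  rewrite (_ : k.+2%:R - k.+1%:R = 1); last by rewrite -natrB// subSnn.
  rewrite mulr1 ler_pM2l//; apply: le_powR_base_neg (ltW zk); first by have := p1; lra.
  exact: lt_trans kz.
rewrite exprMn; apply: le_trans (ler_wpM2l (sqr_ge0 _) (r2C k)) _.
have -> : (k.+1%:R `^ p) ^+ 2 * (C * k.+1%:R `^ (- p - 1)) = C / p * (p * k.+1%:R `^ (p - 1)).
  rewrite (powRD_gt0 (- p) (-1) k0) (powRD_gt0 p (-1) k0); have := powRK p k0; set a := _ `^ p; set b := _ `^ (- p) => ab.
  have -> : a ^+ 2 * (C * (b * k.+1%:R `^ (- 1))) = C * ((a * b) * (a * k.+1%:R `^ (- 1))) by ring.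
  by rewrite ab; field; rewrite gt_eqF.
by rewrite ler_pM2l// divr_gt0.
Qed.

Lemma sqr_steps_truncn_le (t : R) : 0 < t -> exists2 C : R, 0 < C &
  forall n k, (0 < n)%N -> (truncn (n%:R * t) <= k)%N -> n%:R `^ p * r k ^+ 2 <= C / n%:R.
Proof.
move=> t0; have q0 : - p - 1 <= 0 by have := p0; lra.
have [C C0 r2C] := sqr_steps_bound; exists (C * t `^ (- p - 1)); first by rewrite mulr_gt0 ?powR_gt0.
move=> n k n0 nk; have nR : (0 : R) < n%:R by rewrite ltr0n.
have nt : n%:R * t <= k.+1%:R by apply: ltW (lt_le_trans (truncnS_gt _) _); rewrite ler_nat.
apply: le_trans (ler_wpM2l (powR_ge0 _ _) (r2C k)) _.
apply: (@le_trans _ _ (n%:R `^ p * (C * (n%:R * t) `^ (- p - 1)))).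
  by rewrite ler_pM2l ?powR_gt0// ler_pM2l// le_powR_base_neg// mulr_gt0.
rewrite powRM ?(ltW nR) ?(ltW t0)// (powRD_gt0 (- p) (-1) nR) powR_inv1 ?(ltW nR)//.
have := powRK p nR; set a := _ `^ p; set b := _ `^ (- p) => ab.
by rewrite -[leRHS](mul1r) -ab le_eqVlt; apply/orP; left; apply/eqP; ring.
Qed.

Lemma dvg_series_steps : ~ cvgn (series r).
Proof.
move=> cvg_r; have c0 := scale_gt0 reg; have c2 : 0 < c / 2 by rewrite divr_gt0.
have [A _ stepsA] := (cvgrPdist_le _ _).1 stepsS_cvg _ c2.
have harmonic_le k : (A <= k)%N -> c / 2 * harmonic k <= r k.
  move=> Ak; have := stepsA k Ak; rewrite /= ler_norml => /andP[_ ck].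
  have k0 : (0 : R) < k.+1%:R by rewrite ltr0n.
  rewrite ler_pdivrMr//; apply: (@le_trans _ _ (k.+1%:R `^ g * r k)); first by lra.
  by rewrite mulrC ler_wpM2l// ler1_powR ?ler1n//; have /andP[] := exponent_range reg.
apply: (@dvg_harmonic R); apply: nondecreasing_is_cvgn.
  by apply: series_nd => k; rewrite invr_ge0.
exists (series harmonic A + (c / 2)^-1 * tail r A) => _ [L _ <-].
have tail_r := tail_ge0 cvg_r r0.
have [LA|/ltnW AL] := leqP L A.
  rewrite (@le_trans _ _ (series harmonic A))//; first by apply: series_nd => // k; rewrite invr_ge0.
  by rewrite lerDl mulr_ge0// invr_ge0 ltW.
rewrite -lerBlDl sub_series_geq// ler_pdivlMl// mulr_sumr.
apply: (@le_trans _ _ (\sum_(A <= k < L) r k)); last first.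
  by rewrite sum_tail// lerBlDr lerDl.
by rewrite big_nat [leRHS]big_nat; apply: ler_sum => k /andP[Ak _]; exact: harmonic_le.
Qed.

End step_sizes.

(** * Reinforced martingales *)

Section bernoulli_variance.
Context {R : realType}.
Implicit Types (x y : R) (N : nat).

Definition bernoulli_var x : R := x * (1 - x).

Definition mean_var N x : R := bernoulli_var x / N%:R.

Lemma bernoulli_var01 x : 0 <= x <= 1 -> 0 <= bernoulli_var x <= 1.
Proof. by move=> /andP[x0 x1]; rewrite /bernoulli_var; apply/andP; split; nra. Qed.

Lemma bernoulli_var_lipschitz x y : 0 <= x <= 1 -> 0 <= y <= 1 ->
  `|bernoulli_var x - bernoulli_var y| <= `|x - y|.
Proof.
move=> /andP[x0 x1] /andP[y0 y1].
have -> : bernoulli_var x - bernoulli_var y = (x - y) * (1 - x - y) by rewrite /bernoulli_var; ring.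
by rewrite normrM ler_piMr// ler_norml; apply/andP; split; lra.
Qed.

Lemma continuous_bernoulli_var : continuous bernoulli_var.
Proof. by move=> x; apply: cvgM => //; apply: cvgB => //; exact: cvg_cst. Qed.

Lemma mean_var_ge0 N x : 0 <= x <= 1 -> 0 <= mean_var N x.
Proof. by move=> /bernoulli_var01/andP[? _]; rewrite divr_ge0. Qed.

Lemma mean_var_le1 N x : (0 < N)%N -> 0 <= x <= 1 -> mean_var N x <= 1.
Proof.
move=> N0 /bernoulli_var01/andP[_ x1]; rewrite ler_pdivrMr ?ltr0n// mul1r.
by rewrite (le_trans x1)// ler1n.
Qed.

Lemma mean_var_lipschitz N x y : (0 < N)%N -> 0 <= x <= 1 -> 0 <= y <= 1 ->
  `|mean_var N x - mean_var N y| <= `|x - y|.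
Proof.
move=> N0 x01 y01; rewrite -mulrBl normrM normfV (gtr0_norm (_ : 0 < N%:R)) ?ltr0n//.
rewrite ler_pdivrMr ?ltr0n// (le_trans (bernoulli_var_lipschitz x01 y01))//.
by rewrite ler_peMr// ler1n.
Qed.

Lemma continuous_mean_var N : continuous (mean_var N).
Proof. by move=> x; apply: cvgM; [exact: continuous_bernoulli_var|exact: cvg_cst]. Qed.

Lemma bmfun_bernoulli_var {d} {T : measurableType d} (X : T -> R) :
  bmfun X -> bmfun (fun w => bernoulli_var (X w)).
Proof. by move=> bX; rewrite /bernoulli_var. Qed.

Lemma bmfun_mean_var N {d} {T : measurableType d} (X : T -> R) :
  bmfun X -> bmfun (fun w => mean_var N (X w)).
Proof. by move=> bX; rewrite /mean_var /bernoulli_var. Qed.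

End bernoulli_variance.

#[local] Hint Resolve bmfun_bernoulli_var bmfun_mean_var : bmfun.

Definition amplitude {R : realType} (g : R) (n : nat) : R := n%:R `^ (g - 2^-1).

Section amplitude.
Context {R : realType} (r : R^nat) (g c : R).
Hypothesis reg : regular_steps r g c.

Lemma amplitude_ge0 n : 0 <= amplitude g n. Proof. exact: powR_ge0. Qed.

Lemma sqr_amplitude n : amplitude g n ^+ 2 = n%:R `^ (2 * g - 1).
Proof. by rewrite -powR_mulrn ?powR_ge0// -powRrM; congr (_ `^ _); lra. Qed.

Lemma amplitude_step_small (t e : R) : 0 < t -> 0 < e ->
  \forall n \near \oo, forall k, (truncn (n%:R * t) <= k)%N -> amplitude g n * r k <= e.
Proof.
move=> t0 e0; have [C C0 rC] := sqr_steps_truncn_le reg t0.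
near=> n => k nk; have n0 : (0 < n)%N by near: n; exact: nbhs_infty_gt.
have /andP[r0 _] := steps01 reg k.
rewrite -(@ler_pXn2r _ 2) ?nnegrE ?mulr_ge0 ?amplitude_ge0 ?(ltW e0)//.
rewrite exprMn sqr_amplitude (le_trans (rC _ _ n0 nk))// ler_pdivrMr ?ltr0n//.
rewrite mulrC -ler_pdivrMr ?exprn_gt0//.
by near: n; exact: nbhs_infty_ger.
Unshelve. all: by end_near. Qed.

End amplitude.

(* The empirical mean of a population of [N] interacting reinforced agents: a martingale in [[0, 1]]
   whose conditional variances are asymptotically those of the mean of [N] independent Bernoulli
   variables. *)
Record reinforced_martingale {R : realType} {d : measure_display} {Om : measurableType d}
    (P : probability Om R) (F : nat -> set (set Om)) (M v : nat -> Om -> R) (r : nat -> R)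
    (N : nat) (g c : R) (Minf : Om -> R) : Prop := ReinforcedMartingale {
  reinforced_controlled : controlled_martingale P F M v r;
  reinforced_regular : regular_steps r g c;
  population_gt0 : (0 < N)%N;
  martingale01 : forall n w, 0 <= M n w <= 1;
  limit01 : forall w, 0 <= Minf w <= 1;
  limit_measurable : measurable_fun setT Minf;
  martingale_cvg : {ae P, forall w, M n w @[n --> \oo] --> Minf w};
  variance_cvg : expect P (fun w => `|v n w - mean_var N (M n w)|) @[n --> \oo] --> 0 }.

Section normal_cf_integrand.
Context {R : realType} {d : measure_display} {Om : measurableType d} (P : probability Om R).
Implicit Types (u G phi : Om -> R) (q C : R).

Lemma bmfun_normal_cf_mul u q : bmfun u -> (forall w, 0 <= u w) -> 0 <= q ->
  bmfun (fun w => normal_cf (u w * q)).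
Proof. by move=> bu u0 q0; apply: bmfun_normal_cf => [|w]; [exact: bmfun_measurable|exact: mulr_ge0]. Qed.

Lemma expect_normal_cf_lipschitz G phi u q1 q2 C : bmfun G -> bmfun phi -> bmfun u ->
  (forall w, `|G w| <= C) -> (forall w, 0 <= u w <= 1) -> 0 <= q1 -> 0 <= q2 ->
  `|expect P (fun w => G w * (normal_cf (u w * q1) * cos (phi w))) -
    expect P (fun w => G w * (normal_cf (u w * q2) * cos (phi w)))| <= C * `|q1 - q2|.
Proof.
move=> bG bphi bu GC u01 q10 q20; have u0 w : 0 <= u w by have /andP[] := u01 w.
have bcf1 := bmfun_normal_cf_mul bu u0 q10; have bcf2 := bmfun_normal_cf_mul bu u0 q20.
apply: expect_dist_le => // w; rewrite -mulrBr normrM; apply: ler_pM => //.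
rewrite -mulrBl normrM -[leRHS]mulr1; apply: ler_pM; rewrite ?cos_max//.
rewrite (le_trans (normal_cf_lipschitz _ _)) ?mulr_ge0//.
by rewrite -mulrBr normrM ler_piMl// ger0_norm//; have /andP[] := u01 w.
Qed.

End normal_cf_integrand.

Section limit.
Context {R : realType} {d : measure_display} {Om : measurableType d}.
Context (P : probability Om R) (F : nat -> set (set Om)) (M v : nat -> Om -> R) (r : nat -> R).
Context (N : nat) (g c : R) (Minf : Om -> R).
Hypothesis reinfM : reinforced_martingale P F M v r N g c Minf.

Let martM := reinforced_controlled reinfM.
Let reg := reinforced_regular reinfM.
Let N_gt0 := population_gt0 reinfM.
Let bM := martingale_bmfun martM.
Let bv := variance_bmfun martM.
Let bT := mtransform_bmfun martM.

Lemma limit_bmfun : bmfun Minf.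
Proof. exact: bmfun_itv (limit_measurable reinfM) (limit01 reinfM). Qed.
#[local] Hint Resolve bM bv bT limit_bmfun : bmfun.

Lemma expect_sqr_increment_le m K : (m <= K)%N ->
  expect P (fun w => (M K w - M m w) ^+ 2) <= sqr_tail r m.
Proof.
move=> mK; have := expect_mtransform_sqr_le martM (fun=> 1) mK.
under eq_expect do rewrite (mtransform_cst _ _ _ mK) mul1r.
move=> /le_trans; apply; rewrite /qvar; under eq_bigr do rewrite mul1r.
by rewrite sum_sqr_steps// lerBlDr lerDl (sqr_tail_ge0 reg).
Qed.

Lemma expect_sqr_limit_le m : expect P (fun w => (Minf w - M m w) ^+ 2) <= sqr_tail r m.
Proof.
have incr_cvg : expect P (fun w => (M K w - M m w) ^+ 2) @[K --> \oo] -->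
    expect P (fun w => (Minf w - M m w) ^+ 2).
  apply: (@bounded_convergence _ _ _ _ _ _ 1).
  - by move=> K; apply: bmfun_measurable.
  - exact: bmfun_measurable.
  - move=> K w; have /andP[? ?] := martingale01 reinfM K w; have /andP[? ?] := martingale01 reinfM m w.
    by rewrite normrX expr_le1// ler_norml; apply/andP; split; lra.
  - apply: filterS (martingale_cvg reinfM) => w Mw.
    by rewrite !expr2; apply: cvgM; apply: cvgB => //; exact: cvg_cst.
apply: (cvgr_to_le incr_cvg); exists m => // K /= mK; exact: expect_sqr_increment_le.
Qed.

Lemma expect_limit_cvg (f : R -> R) C : continuous f -> (forall x, 0 <= x <= 1 -> `|f x| <= C) ->
  measurable_fun setT f -> expect P (fun w => f (M n w)) @[n --> \oo] --> expect P (fun w => f (Minf w)).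
Proof.
move=> f_cont fC mf; apply: (@bounded_convergence _ _ _ _ _ _ C).
- by move=> n; apply: measurableT_comp => //; exact: bmfun_measurable.
- by apply: measurableT_comp => //; exact: limit_measurable reinfM.
- by move=> n w; apply: fC; exact: martingale01 reinfM n w.
- by apply: filterS (martingale_cvg reinfM) => w; apply: continuous_cvg; exact: f_cont.
Qed.

Lemma expect_norm_limit_cvg0 : expect P (fun w => `|Minf w - M n w|) @[n --> \oo] --> 0.
Proof.
apply: expect_norm_cvg0 => [//|]; apply: (squeeze_cvgr _ (@cvg_cst _ 0 _ \oo _) (sqr_tail_cvg0 reg)).
by apply: nearW => n; rewrite expect_sqr_limit_le expect_ge0// => w; exact: sqr_ge0.
Qed.

(* Up to time [n * n] the martingale has essentially reached its limit. *)
Lemma expect_amplitude_limit_cvg0 :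
  expect P (fun w => `|amplitude g n * (Minf w - M (n * n)%N w)|) @[n --> \oo] --> 0.
Proof.
apply: expect_norm_cvg0 => [//|].
apply: (squeeze_cvgr _ (@cvg_cst _ 0 _ \oo _) (sqr_tail_square_cvg0 reg)).
apply: nearW => n; rewrite expect_ge0 => [/=|w]; last exact: sqr_ge0.
under eq_expect do rewrite exprMn.
by rewrite expectZ// sqr_amplitude ler_wpM2l ?powR_ge0// expect_sqr_limit_le.
Qed.

Lemma variance_near_frozen (e : R) : 0 < e -> \forall m \near \oo, forall k, (m <= k)%N ->
  expect P (fun w => `|v k w - mean_var N (M m w)|) <= e.
Proof.
move=> e0; have e3 : 0 < e / 3 by rewrite divr_gt0.
have [A _ vA] := (cvgrPdist_le _ _).1 (variance_cvg reinfM) _ e3.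
have [B _ tailB] := (cvgrPdist_le _ _).1 (sqr_tail_cvg0 reg) _ (exprn_gt0 2 e3).
exists (maxn A B) => // m /=; rewrite geq_max => /andP[Am Bm] k mk.
have := vA k (leq_trans Am mk); rewrite /= sub0r normrN ger0_norm ?expect_ge0// => v_mean.
have := tailB m Bm; rewrite /= sub0r normrN => /(le_trans (ler_norm _)) tail_m.
have incr := expect_norm_le_sqr P (bmfunD (bM k) (bmfunN (bM m))) e3.
have incr3 : expect P (fun w => (M k w - M m w) ^+ 2) / (e / 3) <= e / 3.
  by rewrite ler_pdivrMr// -expr2 (le_trans (expect_sqr_increment_le mk)).
apply: (@le_trans _ _ (expect P (fun w => `|v k w - mean_var N (M k w)| + `|M k w - M m w|))).
  apply: le_expect => // w; apply: le_trans (ler_distD (mean_var N (M k w)) _ _) _.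
  by rewrite lerD2l mean_var_lipschitz// (martingale01 reinfM).
by rewrite expectD//; lra.
Qed.

Lemma expect_cos_mtransform_dist b m K G phi (C q a : R) : (m <= K)%N -> past F m G -> past F m phi ->
  (forall w, `|G w| <= C) -> 0 <= q -> `|q - qvar r b m K| <= a -> 0 < a -> a <= 1 ->
  (forall k, (m <= k)%N -> expect P (fun w => `|v k w - mean_var N (M m w)|) <= a) ->
  (forall k, (m <= k)%N -> `|b k| * r k <= a) ->
  `|expect P (fun w => G w * cos (phi w + mtransform M b m K w)) -
    expect P (fun w => G w * (normal_cf (mean_var N (M m w) * q) * cos (phi w)))| <=
  C * ((q + 1) * 4 + 1) * a.
Proof.
move=> mK pG pphi GC q0; set Q := qvar r b m K => Qq a0 a1 v_frozen b_le.
have C0 : 0 <= C := le_trans (normr_ge0 _) (GC point).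
have Q0 : 0 <= Q := qvar_ge0 _ _ _ _.
have mv01 w : 0 <= mean_var N (M m w) <= 1.
  by rewrite mean_var_ge0 ?mean_var_le1//; exact: martingale01 reinfM _ w.
have bG := past_bmfun martM pG; have bphi := past_bmfun martM pphi.
apply: (le_trans (ler_distD (expect P (fun w => G w * (normal_cf (mean_var N (M m w) * Q) * cos (phi w)))) _ _)).
have replace := expect_normal_cf_lipschitz P bG bphi (bmfun_mean_var N (bM _)) GC mv01 Q0 q0.
rewrite [`|Q - q|]distrC in replace; have {}replace := le_trans replace (ler_wpM2l C0 Qq).
apply: le_trans (lerD (lindeberg_bound (delta := a) (e := a) martM mK pG pphi _ mv01 GC _ _ a1) replace) _.
- by apply: bmfunM; [apply: bmfunM; [|apply: bmfunD; [exact: bmfun_cst|apply: bmfunN]]|exact: bmfun_cst]; exact: (martingale_past martM).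
- by move=> k /andP[mk _]; exact: v_frozen.
- by move=> k /andP[mk _]; exact: b_le.
have Q1 : Q <= q + 1 by move: Qq; rewrite ler_norml => /andP[]; lra.
have : Q * (a + 3 * a) <= (q + 1) * (4 * a) by rewrite (_ : a + 3 * a = 4 * a); [rewrite ler_wpM2r// mulr_ge0// ltW|ring].
rewrite -/Q; nra.
Qed.

Lemma expect_cos_mtransform_cvg (b : nat -> nat -> R) (m K : nat -> nat) (G phi : nat -> Om -> R) (C q : R) :
  m @ \oo --> \oo -> (\forall n \near \oo, (m n <= K n)%N) ->
  (forall n, past F (m n) (G n)) -> (forall n, past F (m n) (phi n)) -> (forall n w, `|G n w| <= C) ->
  qvar r (b n) (m n) (K n) @[n --> \oo] --> q ->
  (forall e, 0 < e -> \forall n \near \oo, forall k, (m n <= k)%N -> `|b n k| * r k <= e) ->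
  expect P (fun w => G n w * cos (phi n w + mtransform M (b n) (m n) (K n) w)) -
  expect P (fun w => G n w * (normal_cf (mean_var N (M (m n) w) * q) * cos (phi n w))) @[n --> \oo] --> 0.
Proof.
move=> m_infty mK pG pphi GC q_cvg b_small.
have C0 : 0 <= C := le_trans (normr_ge0 _) (GC 0%N point).
have q0 : 0 <= q by apply: (cvgr_to_ge q_cvg); apply: nearW => n; exact: qvar_ge0.
apply/cvgrPdist_le => e e0; set D := C * ((q + 1) * 4 + 1).
have D1 : 0 < D + 1 by rewrite ltr_wpDl// mulr_ge0//; lra.
pose a := minr 1 (e / (D + 1)).
have a0 : 0 < a by rewrite lt_min ltr01 divr_gt0.
have a1 : a <= 1 by rewrite ge_min lexx.
have ae : (D + 1) * a <= e by rewrite mulrC -ler_pdivlMr// ge_min lexx orbT.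
have v_near : \forall n \near \oo, forall k, (m n <= k)%N ->
    expect P (fun w => `|v k w - mean_var N (M (m n) w)|) <= a.
  exact: m_infty _ (variance_near_frozen a0).
have b_near := b_small a a0.
have q_near : \forall n \near \oo, `|q - qvar r (b n) (m n) (K n)| <= a.
  exact: (cvgrPdist_le _ _).1 q_cvg _ a0.
near=> n; rewrite sub0r normrN; apply: (@le_trans _ _ (D * a)); last by lra.
have mKn : (m n <= K n)%N by near: n.
have Qq : `|q - qvar r (b n) (m n) (K n)| <= a by near: n.
apply: (expect_cos_mtransform_dist mKn (pG n) (pphi n) (GC n) q0 Qq a0 a1) => k; move: k; near: n.
- exact: v_near.
- exact: b_near.
Unshelve. all: by end_near. Qed.

End limit.

Section positivity.
Context {R : realType} {d : measure_display} {Om : measurableType d}.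
Context (P : probability Om R) (F : nat -> set (set Om)) (M v : nat -> Om -> R) (r : nat -> R).
Context (N : nat) (g c : R) (Minf : Om -> R).
Hypothesis reinfM : reinforced_martingale P F M v r N g c Minf.
Hypothesis variance_le : forall n w, v n w <= bernoulli_var (M n w).
Hypothesis initial_gt0 : 0 < expect P (fun w => bernoulli_var (M 0 w)).

Let martM := reinforced_controlled reinfM.
Let reg := reinforced_regular reinfM.
Let bM := martingale_bmfun martM.
Let bv := variance_bmfun martM.
#[local] Hint Resolve bM bv : bmfun.

Let expected_var n := expect P (fun w => bernoulli_var (M n w)).

Lemma expect_bernoulli_varS n :
  expected_var n.+1 = expected_var n - r n ^+ 2 * expect P (v n).
Proof.
have pD : past F n (fun w => 1 - 2 * M n w).
  by apply: bmfunD; [exact: bmfun_cst|apply/bmfunN/bmfunM; [exact: bmfun_cst|exact: (martingale_past martM)]].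
have bD := past_bmfun martM pD.
transitivity (expect P (fun w => bernoulli_var (M n w) + (1 - 2 * M n w) * (M n.+1 w - M n w) -
    1 * (M n.+1 w - M n w) ^+ 2)).
  by apply: eq_expect => w; rewrite /bernoulli_var; ring.
rewrite expectB ?expectD// (expect_past_step martM pD) addr0.
rewrite (expect_past_step_sqr martM (bmfun_cst _)).
by congr (_ - _ * _); apply: eq_expect => w; rewrite mul1r.
Qed.

Lemma expect_bernoulli_varS_ge n : (1 - r n ^+ 2) * expected_var n <= expected_var n.+1.
Proof.
rewrite expect_bernoulli_varS mulrBl mul1r lerD2l lerN2 ler_wpM2l ?sqr_ge0//.
by apply: le_expect => // w; exact: variance_le.
Qed.

Lemma expect_bernoulli_var_gt0 n : 0 < expected_var n.
Proof.
elim: n => [//|n ih]; apply: lt_le_trans (expect_bernoulli_varS_ge n).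
by have /andP[? ?] := steps01 reg n; rewrite mulr_gt0// subr_gt0 expr_lt1.
Qed.

Lemma expect_bernoulli_var_ge m n : (m <= n)%N ->
  expected_var m * (1 - (sqr_tail r m - sqr_tail r n)) <= expected_var n.
Proof.
have nincr k L : (k <= L)%N -> expected_var L <= expected_var k.
  move: L; apply: nat_ind_ge => // L _; apply: le_trans; rewrite expect_bernoulli_varS gerBl.
  by rewrite mulr_ge0 ?sqr_ge0// expect_ge0// => w; have /andP[] := variance01 martM L w.
move: n; apply: nat_ind_ge => [|n mn ih]; first by rewrite subrr subr0 mulr1.
apply: le_trans (expect_bernoulli_varS_ge n).
have := sum_sqr_steps r (leqnSn n); rewrite big_nat1 => rE.
have := ler_wpM2l (sqr_ge0 (r n)) (nincr m n mn); rewrite mulrBl mul1r rE in ih *.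
nra.
Qed.

Lemma expect_bernoulli_var_limit_gt0 : 0 < expect P (fun w => bernoulli_var (Minf w)).
Proof.
have half : 0 < (2^-1 : R) by rewrite invr_gt0.
have [m _ tail_half] := (cvgrPdist_le _ _).1 (sqr_tail_cvg0 reg) _ half.
have tail_m : sqr_tail r m <= 2^-1.
  by have := tail_half m (leqnn m); rewrite /= sub0r normrN; exact: le_trans (ler_norm _).
apply: (@lt_le_trans _ _ (expected_var m / 2)); first by rewrite divr_gt0 ?expect_bernoulli_var_gt0.
have var_cvg : expected_var n @[n --> \oo] --> expect P (fun w => bernoulli_var (Minf w)).
  apply: (expect_limit_cvg (C := 1) reinfM) => [|x /bernoulli_var01/andP[? ?]|].
  - exact: continuous_bernoulli_var.
  - by rewrite ger0_norm.
  - exact: continuous_measurable_fun continuous_bernoulli_var.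
apply: (cvgr_to_ge var_cvg); exists m => // n /= mn; apply: le_trans (expect_bernoulli_var_ge mn).
have := sqr_tail_ge0 reg n; have := expect_bernoulli_var_gt0 m; nra.
Qed.

End positivity.

(** * The limit has no atoms in the open unit interval *)

Lemma sum_cosB {R : realType} (x : R) L :
  \sum_(j < L) \sum_(k < L) cos (j%:R * x - k%:R * x) =
  (\sum_(j < L) cos (j%:R * x)) ^+ 2 + (\sum_(j < L) sin (j%:R * x)) ^+ 2.
Proof.
rewrite !expr2 !big_distrlr /= -big_split; apply: eq_bigr => j _ /=.
by rewrite -big_split; apply: eq_bigr => k _ /=; rewrite cosB.
Qed.

(* The Fejer kernel [\sum_(j, k < L) cos ((j - k) x)] is nonnegative and equals [L ^+ 2] at [0]. *)
Lemma fejer_atom_le {R : realType} {d} {T : measurableType d} (P : probability T R)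
    (G X : T -> R) (A : set T) (a : R) L : bmfun G -> bmfun X -> measurable A ->
  (forall w, 0 <= G w) -> (forall w, A w -> X w = 0 /\ G w = a) ->
  L%:R ^+ 2 * (a * fine (P A)) <=
  \sum_(j < L) \sum_(k < L) expect P (fun w => G w * cos (j%:R * X w - k%:R * X w)).
Proof.
move=> bG bX mA G0 GA; pose kernel x : R := \sum_(j < L) \sum_(k < L) cos (j%:R * x - k%:R * x).
have -> : \sum_(j < L) \sum_(k < L) expect P (fun w => G w * cos (j%:R * X w - k%:R * X w)) =
    expect P (fun w => G w * kernel (X w)).
  under eq_bigr do rewrite -expect_sum//.
  rewrite -expect_sum//; apply: eq_expect => w; rewrite mulr_sumr; apply: eq_bigr => j _.
  by rewrite mulr_sumr.
rewrite -expect_indic// -!expectZ//; apply: le_expect => // [|w]; first by rewrite /kernel.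
rewrite indicE; have [/set_mem/GA[-> ->]|_] := boolP (w \in A); last first.
  by rewrite !mulr0 mulr_ge0// /kernel sum_cosB addr_ge0// sqr_ge0.
rewrite mulr1 mulrC /kernel; under eq_bigr do under eq_bigr do rewrite !mulr0 subrr cos0.
by rewrite !sumr_const card_ord -mulrnA expr2 natrM.
Qed.

Lemma mulr_normal_cf_le {R : realType} (x q : R) : 0 <= x -> 0 < q -> x * normal_cf (x * q) <= 2 / q.
Proof.
move=> x0 q0; rewrite /normal_cf expRN ler_pdivrMr ?expR_gt0// mulrAC ler_pdivlMr//.
by have := expR_ge1Dx (x * q / 2); lra.
Qed.

Lemma sqr_natB_ge1 {R : realDomainType} (j k : nat) : j != k -> 1 <= (j%:R - k%:R : R) ^+ 2.
Proof.
wlog jk : j k / (j < k)%N => [ge1 neq_jk|_].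
  have := neq_jk; rewrite neq_ltn => /orP[/ge1|/ge1 ge1_kj]; first exact.
  by rewrite -sqrrN opprB ge1_kj// eq_sym.
by rewrite -sqrrN opprB -natrB ?(ltnW jk)// expr_ge1// ler1n subn_gt0.
Qed.

Section no_atoms.
Context {R : realType} {d : measure_display} {Om : measurableType d}.
Context (P : probability Om R) (F : nat -> set (set Om)) (M v : nat -> Om -> R) (r : nat -> R).
Context (N : nat) (g c : R) (Minf : Om -> R).
Hypothesis reinfM : reinforced_martingale P F M v r N g c Minf.
Let p := 2 * g - 1.

Let martM := reinforced_controlled reinfM.
Let reg := reinforced_regular reinfM.
Let bM := martingale_bmfun martM.
Let bMinf := limit_bmfun reinfM.
#[local] Hint Resolve bM bMinf : bmfun.

Let p0 : 0 < p. Proof. by have /andP[] := tail_exponent_range reg. Qed.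

Lemma qvar_cst_amplitude_cvg (theta : R) :
  qvar r (fun=> theta * amplitude g n) n (n * n) @[n --> \oo] --> theta ^+ 2 * (c ^+ 2 / p).
Proof.
have tail_n := sqr_tail_truncn_cvg reg ltr01; rewrite powR1 mulr1 in tail_n.
rewrite -[c ^+ 2 / p]subr0; apply: near_eq_cvgn (cvgM (@cvg_cst _ (theta ^+ 2) _ \oo _)
  (cvgB tail_n (sqr_tail_square_cvg0 reg))).
near=> n; have n0 : (n <= n * n)%N by rewrite leq_pmull//; near: n; exact: nbhs_infty_gt.
rewrite /qvar !fctE /= mulr1 natrK; under eq_bigr do rewrite exprMn.
by rewrite -mulr_sumr sum_sqr_steps// exprMn sqr_amplitude; ring.
Unshelve. all: by end_near. Qed.

Lemma expect_frozen_cos_le (theta : R) (phi : Om -> R) m : theta != 0 -> bmfun phi ->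
  `|expect P (fun w => bernoulli_var (M m w) *
      (normal_cf (mean_var N (M m w) * (theta ^+ 2 * (c ^+ 2 / p))) * cos (phi w)))|
  <= 2 * N%:R * p / (theta * c) ^+ 2.
Proof.
move=> theta0 bphi; have := scale_gt0 reg; have := population_gt0 reinfM; rewrite -(ltr0n R) => N0 c0.
have q0 : 0 < theta ^+ 2 * (c ^+ 2 / p).
  by rewrite mulr_gt0 ?divr_gt0 ?(exprn_gt0 2 c0)// exprn_even_gt0.
have mv0 w : 0 <= mean_var N (M m w) by apply: mean_var_ge0; exact: martingale01 reinfM m w.
have bcf := bmfun_normal_cf_mul (bmfun_mean_var N (bM m)) mv0 (ltW q0).
apply: norm_expect_le_cst => // w.
have /bernoulli_var01/andP[bv0 _] := martingale01 reinfM m w.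
rewrite normrM (ger0_norm bv0) normrM mulrA -[leRHS]mulr1.
apply: ler_pM; [exact: mulr_ge0|by []| |exact: cos_max].
rewrite ger0_norm; last exact: expR_ge0.
have := mulr_normal_cf_le bv0 (divr_gt0 q0 N0); rewrite -[mean_var N _ * _]mulrAC -mulrA.
move=> /le_trans; apply; rewrite le_eqVlt; apply/orP; left; apply/eqP.
by move: (p) p0 => s s0; field; rewrite theta0 !gt_eqF.
Qed.

Lemma expect_cos_clt_cvg0 (theta z : R) : theta != 0 ->
  expect P (fun w => bernoulli_var (M n w) * cos (theta * amplitude g n * (M (n * n)%N w - z))) -
  expect P (fun w => bernoulli_var (M n w) * (normal_cf (mean_var N (M n w) * (theta ^+ 2 * (c ^+ 2 / p))) *
    cos (theta * amplitude g n * (M n w - z)))) @[n --> \oo] --> 0.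
Proof.
move=> theta0; pose s n := theta * amplitude g n.
have le_n_sqr : \forall n \near \oo, (n <= n * n)%N.
  by near=> n; rewrite leq_pmull//; near: n; exact: nbhs_infty_gt.
have step_small a : 0 < a -> \forall n \near \oo, forall k, (n <= k)%N -> `|s n| * r k <= a.
  move=> a0; have theta_gt0 : 0 < `|theta| by rewrite normr_gt0.
  have := amplitude_step_small reg ltr01 (divr_gt0 a0 theta_gt0); apply: filterS => n small k nk.
  rewrite normrM (ger0_norm (amplitude_ge0 _ _)) -mulrA mulrC -ler_pdivlMr//.
  by apply: small; rewrite mulr1 natrK.
have pM n : past F n (M n) := martingale_past martM n.
apply: near_eq_cvgn (expect_cos_mtransform_cvg reinfM (b := fun n _ => s n) (m := id) (C := 1)
  (G := fun n w => bernoulli_var (M n w)) (phi := fun n w => s n * (M n w - z)) (@cvg_id _ _)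
  le_n_sqr _ _ _ (@qvar_cst_amplitude_cvg theta) step_small).
- near=> n; congr (_ - _); apply: eq_expect => w; rewrite mtransform_cst; last by near: n.
  by congr (_ * cos _); rewrite /s; ring.
- by move=> n; exact: bmfun_bernoulli_var.
- by move=> n; apply: bmfunM; [exact: bmfun_cst|apply: bmfunD => //; exact: bmfun_cst].
- by move=> n w; have /bernoulli_var01/andP[? ?] := martingale01 reinfM n w; rewrite ger0_norm.
Unshelve. all: by end_near. Qed.

Lemma expect_cos_limit_cvg0 (theta z : R) :
  expect P (fun w => bernoulli_var (Minf w) * cos (theta * amplitude g n * (Minf w - z))) -
  expect P (fun w => bernoulli_var (M n w) * cos (theta * amplitude g n * (M (n * n)%N w - z)))
    @[n --> \oo] --> 0.
Proof.
apply: (@expect_cos_cvg0 _ _ _ _ _ _ _ _ 1) => // [n w||].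
- by have /bernoulli_var01/andP[? ?] := martingale01 reinfM n w; rewrite ger0_norm.
- apply: (squeeze_cvgr _ (@cvg_cst _ 0 _ \oo _) (expect_norm_limit_cvg0 reinfM)); apply: nearW => n.
  rewrite expect_ge0//=; apply: le_expect => // w; apply: bernoulli_var_lipschitz.
    exact: limit01 reinfM w.
  exact: martingale01 reinfM n w.
- rewrite -[X in _ --> X](mulr0 `|theta|).
  apply: near_eq_cvgn (cvgM (@cvg_cst _ _ _ \oo _) (expect_amplitude_limit_cvg0 reinfM)).
  apply: nearW => n; rewrite /= -expectZ//.
  by apply: eq_expect => w; rewrite -normrM; congr `|_|; ring.
Qed.

(* Seen from time [n], the fluctuations of the limit have conditional variance of order
   [mean_var N (M n) / amplitude g n ^+ 2]. *)
Lemma expect_cos_limit_near_le (theta z e : R) : theta != 0 -> 0 < e ->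
  \forall n \near \oo, `|expect P (fun w => bernoulli_var (Minf w) *
      cos (theta * amplitude g n * (Minf w - z)))| <= 2 * N%:R * p / (theta * c) ^+ 2 + e.
Proof.
move=> theta0 e0.
have [A _ distA] := (cvgrPdist_le _ _).1
  (cvgD (expect_cos_limit_cvg0 theta z) (expect_cos_clt_cvg0 z theta0)) _ e0.
exists A => // n /distA; rewrite addr0 sub0r normrN !fctE addrA subrK => dist.
set X := expect P _; rewrite -(subrK (expect P (fun w => bernoulli_var (M n w) *
  (normal_cf (mean_var N (M n w) * (theta ^+ 2 * (c ^+ 2 / p))) *
   cos (theta * amplitude g n * (M n w - z))))) X) addrC.
by rewrite (le_trans (ler_normD _ _))// lerD// expect_frozen_cos_le.
Qed.

Lemma expect_cos_limit_near_small (z e : R) : 0 < e -> exists2 theta0, 0 < theta0 &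
  forall theta, theta0 ^+ 2 <= theta ^+ 2 -> \forall n \near \oo,
    `|expect P (fun w => bernoulli_var (Minf w) * cos (theta * amplitude g n * (Minf w - z)))| <= e.
Proof.
move=> e0; have e2 : 0 < e / 2 by rewrite divr_gt0.
have c0 := scale_gt0 reg; pose D := 2 * N%:R * p / c ^+ 2 / (e / 2).
have D0 : 0 <= D by rewrite divr_ge0 ?(ltW e2)// divr_ge0 ?sqr_ge0// mulr_ge0 ?mulr_ge0 ?(ltW p0).
exists (Num.sqrt (D + 1)) => [|theta]; first by rewrite sqrtr_gt0 ltr_wpDl.
rewrite sqr_sqrtr ?addr_ge0// => theta_ge; have theta2 : 0 < theta ^+ 2 by apply: lt_le_trans theta_ge; rewrite ltr_wpDl.
have theta0 : theta != 0 by apply: contraTneq theta2 => ->; rewrite expr0n ltxx.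
apply: filterS (expect_cos_limit_near_le z theta0 e2) => n /le_trans; apply.
rewrite [leRHS]splitr lerD2r exprMn invfM mulrCA mulrC ler_pdivrMr// -ler_pdivrMl//.
by rewrite [leLHS]mulrC; apply: le_trans theta_ge; rewrite lerDl.
Qed.

Lemma limit_preimage1_measurable (z : R) : measurable (Minf @^-1` [set z]).
Proof. by apply: measurable_preimageT => //; exact: limit_measurable reinfM. Qed.

Lemma atom_mass_le (z : R) (l : nat) : (0 < l)%N ->
  bernoulli_var z * fine (P (Minf @^-1` [set z])) <= 2 * l%:R^-1.
Proof.
move=> l_gt0; have lR : (0 : R) < l%:R by rewrite ltr0n.
have l0 : 0 < l%:R^-1 :> R by rewrite invr_gt0.
have [theta theta_gt0 theta_small] := expect_cos_limit_near_small z l0.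
pose X n w := theta * amplitude g n * (Minf w - z).
pose term n (j k : 'I_l) := expect P (fun w => bernoulli_var (Minf w) * cos (j%:R * X n w - k%:R * X n w)).
have term_le (j k : 'I_l) : \forall n \near \oo, term n j k <= (j == k)%:R + l%:R^-1.
  rewrite /term; have [->|jk] := eqVneq j k.
    apply: nearW => n; apply: expect_le_cst => [|w]; first by rewrite /X.
    have /bernoulli_var01/andP[bv0 bv1] := limit01 reinfM w.
    by rewrite subrr cos0 mulr1 (le_trans bv1)// lerDl ltW.
  have theta_jk : theta ^+ 2 <= ((j%:R - k%:R) * theta) ^+ 2.
    by rewrite exprMn ler_peMl ?sqr_ge0//; exact: sqr_natB_ge1.
  apply: filterS (theta_small _ theta_jk) => n; rewrite add0r; apply: le_trans.
  apply: le_trans (ler_norm _); rewrite le_eqVlt; apply/orP; left; apply/eqP.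
  by apply: eq_expect => w; congr (_ * cos _); rewrite /X; ring.
have [n n_le] := filter_ex (filter_forall _ (fun j => filter_forall _ (fun k => term_le j k))).
have bX : bmfun (X n) by rewrite /X.
have bv0 w : 0 <= bernoulli_var (Minf w) by have /bernoulli_var01/andP[] := limit01 reinfM w.
have XA w : (Minf @^-1` [set z]) w -> X n w = 0 /\ bernoulli_var (Minf w) = bernoulli_var z.
  by rewrite /= => AE; rewrite /X AE subrr mulr0.
have := fejer_atom_le P l (bmfun_bernoulli_var bMinf) bX (limit_preimage1_measurable z) bv0 XA.
have sum_le : \sum_(j < l) \sum_(k < l) term n j k <= 2 * l%:R.
  apply: (@le_trans _ _ (\sum_(j < l) 2)).
    apply: ler_sum => j _; apply: le_trans (ler_sum _ (fun k _ => n_le j k)) _.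
    rewrite big_split/= sumr_const card_ord -[_^-1 *+ l]mulr_natr mulVf ?gt_eqF//.
    by rewrite (bigD1 j)//= eqxx big1 ?addr0// => k; rewrite eq_sym => /negbTE ->.
  by rewrite sumr_const card_ord -[2 *+ l]mulr_natr.
move=> /le_trans/(_ sum_le); rewrite expr2 -mulrA mulrC -ler_pdivlMr// mulfK ?gt_eqF//.
by rewrite mulrC -ler_pdivlMr.
Qed.

Lemma no_atom (z : R) : 0 < z < 1 -> P (Minf @^-1` [set z]) = 0%E.
Proof.
move=> /andP[z0 z1]; have bz0 : 0 < bernoulli_var z by rewrite mulr_gt0// subr_gt0.
have mass_le0 : fine (P (Minf @^-1` [set z])) <= 0.
  rewrite -(pmulr_rle0 _ bz0); apply/ler_addgt0Pr => e e0; rewrite add0r.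
  have [L _ /(_ L (leqnn L)) Le] := near_natSinv_le (divr_gt0 e0 (ltr0n _ 2)).
  by apply: le_trans (atom_mass_le z (ltn0Sn L)) _; rewrite mulrC -ler_pdivlMr.
have /eqP mass0 : fine (P (Minf @^-1` [set z])) == 0 by rewrite eq_le mass_le0 fine_ge0.
by rewrite -[LHS]fineK ?mass0// fin_num_measure//; exact: limit_preimage1_measurable.
Qed.

End no_atoms.

(** * Finite-dimensional marginals of the fluctuations *)

Lemma near_forall_lt (q : nat) (Q : nat -> nat -> Prop) :
  (forall i, (i < q)%N -> \forall n \near \oo, Q i n) -> \forall n \near \oo, forall i, (i < q)%N -> Q i n.
Proof.
move=> nearQ; apply: filterS (filter_forall _ (fun i : 'I_q => nearQ i (ltn_ord i))) => n Qn i iq.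
exact: Qn (Ordinal iq).
Qed.

Lemma sum_geq {R : pzSemiRingType} (f : nat -> R) m k0 K : (m <= k0)%N -> (k0 <= K)%N ->
  \sum_(m <= k < K) (k0 <= k)%N%:R * f k = \sum_(k0 <= k < K) f k.
Proof.
move=> mk kK; rewrite (big_cat_nat _ (n := k0))//= big_nat big1 ?add0r => [|k /andP[_ kk]]; last first.
  by rewrite leqNgt kk mul0r.
by rewrite big_nat [RHS]big_nat; apply: eq_bigr => k /andP[-> _]; rewrite mul1r.
Qed.

Section truncn_grid.
Context {R : realType}.
Implicit Types t : R.

Lemma cvg_truncn_infty t : 0 < t -> truncn (n%:R * t) @[n --> \oo] --> \oo.
Proof. by move=> t0; apply/cvgnyPge => A; exact: near_le_truncn. Qed.

Lemma near_truncn_le_sqr t : 0 <= t -> \forall n \near \oo, (truncn (n%:R * t) <= n * n)%N.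
Proof.
move=> t0; near=> n; rewrite -(ler_nat R) natrM (@le_trans _ _ (n%:R * t))//.
  by rewrite truncn_le// mulr_ge0.
by rewrite ler_wpM2l//; near: n; exact: nbhs_infty_ger.
Unshelve. all: by end_near. Qed.

Lemma truncn_mul_max n t1 t2 : truncn (n%:R * maxr t1 t2) = maxn (truncn (n%:R * t1)) (truncn (n%:R * t2)).
Proof.
case: (leP t1 t2) => t12; apply/esym; first by apply/maxn_idPr; rewrite le_truncn// ler_wpM2l.
by apply/maxn_idPl; rewrite le_truncn// ler_wpM2l// ltW.
Qed.

End truncn_grid.

Section fluctuations.
Context {R : realType} {d : measure_display} {Om : measurableType d}.
Context (P : probability Om R) (F : nat -> set (set Om)) (M v : nat -> Om -> R) (r : nat -> R).
Context (N : nat) (g c : R) (Minf : Om -> R).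
Hypothesis reinfM : reinforced_martingale P F M v r N g c Minf.
Let p := 2 * g - 1.

Let p0 : 0 < p. Proof. by have /andP[] := tail_exponent_range (reinforced_regular reinfM). Qed.
Let martM := reinforced_controlled reinfM.
Let reg := reinforced_regular reinfM.
Let bM := martingale_bmfun martM.
Let bMinf := limit_bmfun reinfM.
Let bT := mtransform_bmfun martM.
#[local] Hint Resolve bM bMinf bT : bmfun.

Definition fluctuation (n : nat) (t : R) (w : Om) : R :=
  t `^ p * amplitude g n * (M (truncn (n%:R * t)) w - Minf w).

Lemma fluctuation_bmfun n t : bmfun (fluctuation n t).
Proof. by rewrite /fluctuation. Qed.
#[local] Hint Resolve fluctuation_bmfun : bmfun.

Lemma expect_sqr_fluctuation_le n t : expect P (fun w => fluctuation n t w ^+ 2) <=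
  (t `^ p) ^+ 2 * (n%:R `^ p * sqr_tail r (truncn (n%:R * t))).
Proof.
rewrite mulrA -sqr_amplitude -exprMn; set a := t `^ p * _.
have -> : expect P (fun w => fluctuation n t w ^+ 2) =
    a ^+ 2 * expect P (fun w => (Minf w - M (truncn (n%:R * t)) w) ^+ 2).
  by rewrite -expectZ//; apply: eq_expect => w; rewrite /fluctuation -/a; ring.
by rewrite ler_wpM2l ?sqr_ge0// (expect_sqr_limit_le reinfM).
Qed.

Section weights.
Context (q : nat) (t theta : nat -> R).
Hypothesis t_gt0 : forall i, (i < q)%N -> 0 < t i.

Let u i := theta i * t i `^ p.
Let time n i := truncn (n%:R * t i).

(* Up to the replacement of the limit by the value at time [n * n], [\sum_i theta i * fluctuation n (t i)]
   is minus the transform of the martingale by these weights. *)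
Definition fluctuation_weight n k : R := amplitude g n * \sum_(i < q) u i * (time n i <= k)%N%:R.

Definition fluctuation_form : R :=
  c ^+ 2 / p * \sum_(i < q) \sum_(j < q) theta i * theta j * (minr (t i) (t j)) `^ p.

Lemma mtransform_fluctuation_weight n m K w : (forall i, (i < q)%N -> (m <= time n i <= K)%N) ->
  mtransform M (fluctuation_weight n) m K w = amplitude g n * \sum_(i < q) u i * (M K w - M (time n i) w).
Proof.
move=> window; rewrite /mtransform /fluctuation_weight.
under eq_bigr => k _ do rewrite -mulrA mulr_suml.
rewrite -mulr_sumr exchange_big /=; congr (_ * _); apply: eq_bigr => i _.
have /andP[mi iK] := window i (ltn_ord i).
under eq_bigr => k _ do rewrite -mulrA.
by rewrite -mulr_sumr (sum_geq (fun k => M k.+1 w - M k w))// telescope_sumr.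
Qed.

Lemma qvar_fluctuation_weight n m K : (forall i, (i < q)%N -> (m <= time n i <= K)%N) ->
  qvar r (fluctuation_weight n) m K = \sum_(i < q) \sum_(j < q) u i * u j *
    (n%:R `^ p * sqr_tail r (maxn (time n i) (time n j)) - n%:R `^ p * sqr_tail r K).
Proof.
move=> window; rewrite /qvar.
transitivity (\sum_(m <= k < K) \sum_(i < q) \sum_(j < q) u i * u j *
    (n%:R `^ p * ((maxn (time n i) (time n j) <= k)%N%:R * r k ^+ 2))).
  apply: eq_bigr => k _; rewrite !exprMn sqr_amplitude [X in _ * X * _]expr2 big_distrlr/= mulr_sumr mulr_suml.
  apply: eq_bigr => i _; rewrite mulr_sumr mulr_suml; apply: eq_bigr => j _.
  by rewrite geq_max -mulnb natrM; ring.
rewrite exchange_big /=; apply: eq_bigr => i _; rewrite exchange_big /=; apply: eq_bigr => j _.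
have /andP[mi iK] := window i (ltn_ord i); have /andP[_ jK] := window j (ltn_ord j).
rewrite -!mulr_sumr -mulrBr (sum_geq (fun k => r k ^+ 2)) ?sum_sqr_steps ?leq_max ?geq_max ?mi ?iK//.
Qed.

Lemma qvar_fluctuation_weight_cvg (m : nat -> nat) :
  (\forall n \near \oo, forall i, (i < q)%N -> (m n <= time n i <= n * n)%N) ->
  qvar r (fluctuation_weight n) (m n) (n * n) @[n --> \oo] --> fluctuation_form.
Proof.
move=> window.
have -> : fluctuation_form =
    \sum_(i < q) \sum_(j < q) u i * u j * (c ^+ 2 / p * (maxr (t i) (t j)) `^ (- p) - 0).
  rewrite /fluctuation_form mulr_sumr; apply: eq_bigr => i _; rewrite mulr_sumr; apply: eq_bigr => j _.
  have ti := powR_gt0 p (t_gt0 (ltn_ord i)); have tj := powR_gt0 p (t_gt0 (ltn_ord j)).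
  rewrite subr0 /u; move: (p) p0 ti tj => s s0 ti tj.
  by case: (leP (t i) (t j)) => _; rewrite powRN; field; rewrite !gt_eqF.
apply: (@near_eq_cvgn _ _ (fun n => \sum_(i < q) \sum_(j < q) u i * u j *
    (n%:R `^ p * sqr_tail r (maxn (time n i) (time n j)) - n%:R `^ p * sqr_tail r (n * n)))).
  by near=> n; apply: qvar_fluctuation_weight; near: n.
apply: cvg_big => [|i _]; first exact: add_continuous.
apply: cvg_big => [|j _]; first exact: add_continuous.
apply: cvgM; first exact: cvg_cst.
apply: cvgB; last exact: (sqr_tail_square_cvg0 reg).
have t_max : 0 < maxr (t i) (t j) by rewrite lt_max t_gt0.
by under eq_fun do rewrite -truncn_mul_max; exact: (sqr_tail_truncn_cvg reg).
Unshelve. all: by end_near. Qed.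

Let weight_bound := \sum_(i < q) `|u i|.

Lemma norm_fluctuation_weight_le n k : `|fluctuation_weight n k| <= amplitude g n * weight_bound.
Proof.
rewrite normrM (ger0_norm (amplitude_ge0 g n)) ler_wpM2l ?amplitude_ge0//.
apply: le_trans (ler_norm_sum _ _ _) _; apply: ler_sum => i _.
by rewrite normrM normr_nat ler_piMr// lern1 leq_b1.
Qed.

Lemma fluctuation_weight_small (t0 e : R) : 0 < t0 -> 0 < e ->
  \forall n \near \oo, forall k, (truncn (n%:R * t0) <= k)%N -> `|fluctuation_weight n k| * r k <= e.
Proof.
move=> t00 e0; have wb0 : 0 < weight_bound + 1 by rewrite ltr_wpDl// sumr_ge0.
have := amplitude_step_small reg t00 (divr_gt0 e0 wb0); apply: filterS => n small k nk.
have /andP[r0 _] := steps01 reg k; have ar0 : 0 <= amplitude g n * r k by rewrite mulr_ge0 ?amplitude_ge0.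
apply: le_trans (ler_wpM2r r0 (norm_fluctuation_weight_le n k)) _.
have := small k nk; rewrite ler_pdivlMr//; apply: le_trans.
by rewrite [leLHS]mulrAC ler_wpM2l// lerDl.
Qed.

Lemma expect_cos_fluctuation_weight_cvg0 (m : nat -> nat) (phi : R) :
  (\forall n \near \oo, forall i, (i < q)%N -> (m n <= time n i <= n * n)%N) ->
  expect P (fun w => 1 * cos (phi + \sum_(i < q) theta i * fluctuation n (t i) w)) -
  expect P (fun w => 1 * cos (phi - mtransform M (fluctuation_weight n) (m n) (n * n) w)) @[n --> \oo] --> 0.
Proof.
move=> window; apply: (@expect_cos_cvg0 _ _ _ _ _ _ _ _ 1) => // [n w||].
- by rewrite normr1.
- by under eq_fun do under eq_expect do rewrite subrr normr0; under eq_fun do rewrite expect_cst; exact: cvg_cst.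
have upper : weight_bound * expect P (fun w => `|amplitude g n * (Minf w - M (n * n)%N w)|) @[n --> \oo] --> 0.
  by rewrite -[X in _ --> X](mulr0 weight_bound); apply: cvgM; [exact: cvg_cst|exact: expect_amplitude_limit_cvg0 reinfM].
apply: (squeeze_cvgr _ (@cvg_cst _ 0 _ \oo _) upper); near=> n.
rewrite expect_ge0//= -expectZ//; apply: le_expect => // w.
rewrite mtransform_fluctuation_weight; last by near: n.
rewrite (_ : _ - _ = - (\sum_(i < q) u i * (amplitude g n * (Minf w - M (n * n)%N w)))).
  by rewrite normrN -mulr_suml normrM ler_wpM2r// ler_norm_sum.
rewrite opprB addrC subrKA mulr_sumr -sumrN -big_split.
by apply: eq_bigr => i _; rewrite /fluctuation /u -/(time n i) /=; ring.
Unshelve. all: by end_near. Qed.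

Lemma pos_lower_bound : exists2 t0 : R, 0 < t0 & forall i, (i < q)%N -> t0 <= t i.
Proof.
exists (\big[minr/1]_(i < q) t i) => [|i iq].
  by apply: lt_bigmin => // i _; exact: t_gt0.
exact: (bigmin_le _ (Ordinal iq) (fun i => t i)).
Qed.

Lemma expect_cos_fluctuation_cvg (phi : R) :
  expect P (fun w => cos (phi + \sum_(i < q) theta i * fluctuation n (t i) w)) @[n --> \oo] -->
  expect P (fun w => normal_cf (mean_var N (Minf w) * fluctuation_form) * cos phi).
Proof.
have [t0 t00 t0_le] := pos_lower_bound; pose m n := truncn (n%:R * t0).
have window : \forall n \near \oo, forall i, (i < q)%N -> (m n <= time n i <= n * n)%N.
  apply: near_forall_lt => i iq; apply: filterS (near_truncn_le_sqr (ltW (t_gt0 iq))) => n ->.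
  by rewrite andbT le_truncn// ler_wpM2l// t0_le.
have q_cvg := qvar_fluctuation_weight_cvg window.
have q0 : 0 <= fluctuation_form by apply: (cvgr_to_ge q_cvg); apply: nearW => n; exact: qvar_ge0.
have mean_var0 x : 0 <= x <= 1 -> 0 <= mean_var N x * fluctuation_form.
  by move=> x01; rewrite mulr_ge0// mean_var_ge0.
have cf_cont : continuous (fun x => normal_cf (mean_var N x * fluctuation_form) * cos phi).
  move=> x; apply: cvgM; last exact: cvg_cst.
  apply: continuous_cvg; first exact: continuous_normal_cf.
  by apply: cvgM; [exact: continuous_mean_var|exact: cvg_cst].
have cf_le1 x : 0 <= x <= 1 -> `|normal_cf (mean_var N x * fluctuation_form) * cos phi| <= 1.
  by move=> /mean_var0/normal_cf_le1 cf1; rewrite normrM mulr_ile1 ?cos_max.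
have cf_cvg := cvg_comp _ _ (cvg_truncn_infty t00)
  (expect_limit_cvg reinfM cf_cont cf_le1 (continuous_measurable_fun cf_cont)).
have clt := expect_cos_mtransform_cvg reinfM (C := 1) (cvg_truncn_infty t00) (near_truncn_le_sqr (ltW t00))
  (fun n => bmfun_cst 1) (fun n => bmfun_cst (- phi)) _ q_cvg (fun e => fluctuation_weight_small t00).
have norm1 (n : nat) (w : Om) : `|1 : R| <= 1 by rewrite normr1.
rewrite -[X in _ --> X]add0r -[X in _ --> _ + X]add0r.
apply: near_eq_cvgn (cvgD (expect_cos_fluctuation_weight_cvg0 phi window) (cvgD (clt norm1) cf_cvg)).
apply: nearW => n; rewrite !fctE /=.
have cosE : expect P (fun w => 1 * cos (phi - mtransform M (fluctuation_weight n) (m n) (n * n) w)) =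
    expect P (fun w => 1 * cos (- phi + mtransform M (fluctuation_weight n) (m n) (n * n) w)).
  by apply: eq_expect => w; rewrite -cosN opprB addrC.
have expect_mul1 X : expect P (fun w => 1 * X w) = expect P X by apply: eq_expect => w; rewrite mul1r.
by rewrite cosE cosN !expect_mul1 addrA subrKA subrK.
Qed.

End weights.
End fluctuations.

(** * Gaussian integrals *)

Section improper_integral.
Context {R : realType}.
Local Notation mu := (@lebesgue_measure R).

Lemma integrable_EFinZ (k : R) (f : R -> R) : mu.-integrable setT (EFin \o f) ->
  mu.-integrable setT (EFin \o (fun x => k * f x)).
Proof. exact: (integrableZl measurableT k). Qed.

Lemma Rintegral_symmetric_cvg (f : R -> R) : mu.-integrable setT (EFin \o f) ->
  \int[mu]_(x in `[- n.+1%:R, n.+1%:R]) f x @[n --> \oo] --> \int[mu]_x f x.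
Proof.
move=> int_f; pose I n : set R := `[- n.+1%:R, n.+1%:R]%classic.
have mf : measurable_fun setT (EFin \o f) by case/integrableP: int_f.
have mfI n : measurable_fun setT (EFin \o (f \_ (I n))).
  apply/measurable_EFinP; apply/(measurable_restrictT _ _).1; first exact: measurable_itv.
  by apply: measurable_funTS; exact/measurable_EFinP.
have fI_cvg : {ae mu, forall x, setT x -> (EFin \o (f \_ (I n))) x @[n --> \oo] --> (EFin \o f) x}.
  apply: aeW => /= x _; apply: cvg_EFin; first exact: nearW.
  apply: (near_eq_cvgn _ (@cvg_cst _ (f x) _ \oo _)); near=> n.
  rewrite /= /patch ifT// inE /I /= in_itv/= -ler_norml (@le_trans _ _ n%:R) ?ler_nat//.
  by near: n; exact: nbhs_infty_ger.
have fI_le : {ae mu, forall x n, setT x -> (`|(EFin \o (f \_ (I n))) x| <= (abse \o (EFin \o f)) x)%E}.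
  by apply: aeW => /= x n _; rewrite lee_fin /patch; case: ifP => // _; rewrite normr0.
have [_ _] := @dominated_convergence _ _ _ mu setT measurableT _ _ _ mfI mf fI_cvg (integrable_abse int_f) fI_le.
rewrite -[X in _ --> X]fineK; last exact: integrable_fin_num.
move=> /fine_cvg; apply: near_eq_cvgn; apply: nearW => n.
by rewrite /= /Rintegral integral_mkcond; congr fine; apply: eq_integral => x _; rewrite restrict_EFin.
Unshelve. all: by end_near. Qed.

Lemma Rintegral_derive_eq0 (F f : R -> R) : (forall x : R, is_derive x 1 F (f x)) -> continuous f ->
  mu.-integrable setT (EFin \o f) -> F n.+1%:R - F (- n.+1%:R) @[n --> \oo] --> 0 -> \int[mu]_x f x = 0.
Proof.
move=> dF cf int_f F_cvg0; apply: (cvg_unique _ (Rintegral_symmetric_cvg int_f)).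
  exact: norm_hausdorff.
have cF : continuous F.
  by move=> x; apply: differentiable_continuous; apply/derivable1_diffP; case: (dF x).
apply: near_eq_cvgn F_cvg0; apply: nearW => n.
have nn : - n.+1%:R < n.+1%:R :> R by have := ltr0Sn R n; lra.
rewrite /Rintegral (continuous_FTC2 nn (F := F))//.
- exact: continuous_subspaceT.
- split; first by move=> x _; case: (dF x).
  + by apply: cvg_at_right_filter; exact: cF.
  + by apply: cvg_at_left_filter; exact: cF.
- by move=> x _; rewrite derive1E; case: (dF x).
Qed.

End improper_integral.

Section normal_integrals.
Context {R : realType} (s : R).
Hypothesis s_gt0 : 0 < s.
Local Notation mu := (@lebesgue_measure R).
Local Notation pdf := (normal_pdf 0 s).
Implicit Types (x theta phi K : R) (G : R -> R).

Let s0 : s != 0. Proof. by rewrite gt_eqF. Qed.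

Lemma normal_pdf0E x : pdf x = normal_peak s * expR (- x ^+ 2 / (s ^+ 2 *+ 2)).
Proof. by rewrite normal_pdfE// /normal_fun subr0. Qed.

Lemma is_derive_normal_pdf x : is_derive x 1 pdf (- (x / s ^+ 2) * pdf x).
Proof.
have -> : pdf = (fun x => normal_peak s *: expR (x ^+ 2 * - (s ^+ 2 *+ 2)^-1)).
  by apply/funext => y; rewrite normal_pdf0E mulNr mulrN.
apply: is_derive_eq; rewrite /GRing.scale/= -[s ^+ 2 *+ 2]mulr_natl.
by field; exact: s0.
Qed.

Lemma norm_mul_expRN_le x (y : R) : 0 <= y -> x ^+ 2 = 4 * s ^+ 2 * y ->
  `|x| * expR (- (2 * y)) <= (1 + 4 * s ^+ 2) * expR (- (y / 2)).
Proof.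
move=> y0 xE; have s2 : 0 < s ^+ 2 by rewrite exprn_gt0.
have x_le : `|x| <= (1 + 4 * s ^+ 2) * expR y.
  have x1 : `|x| <= 1 + x ^+ 2 by rewrite -[x ^+ 2](real_normK (num_real _)); have := normr_ge0 x; nra.
  apply: le_trans x1 _; rewrite xE (@le_trans _ _ ((1 + 4 * s ^+ 2) * (1 + y)))//; first by nra.
  by rewrite ler_wpM2l ?expR_ge1Dx//; lra.
apply: le_trans (ler_wpM2r (expR_ge0 _) x_le) _; rewrite -mulrA -expRD ler_wpM2l//; first by lra.
by rewrite ler_expR; lra.
Qed.

Lemma norm_mul_normal_pdf_le : exists2 C : R, 0 <= C &
  forall x, `|x| * pdf x <= C * normal_pdf 0 (2 * s) x.
Proof.
have s20 : 2 * s != 0 by rewrite mulf_neq0.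
have peak := normal_peak_gt0 s0; have peak2 := normal_peak_gt0 s20.
have D0 : 0 <= 1 + 4 * s ^+ 2 by have := sqr_ge0 s; lra.
exists ((1 + 4 * s ^+ 2) * normal_peak s / normal_peak (2 * s)) => [|x].
  by rewrite divr_ge0 ?mulr_ge0// ltW.
rewrite normal_pdf0E normal_pdfE// /normal_fun subr0 [leRHS]mulrA divfK ?gt_eqF//.
rewrite -[leRHS]mulrA [leRHS]mulrCA [leLHS]mulrCA ler_pM2l//.
pose y := (x / (2 * s)) ^+ 2; have y0 : 0 <= y := sqr_ge0 _.
have xE : x ^+ 2 = 4 * s ^+ 2 * y by rewrite /y; field.
have -> : - x ^+ 2 / (s ^+ 2 *+ 2) = - (2 * y) by rewrite xE -[s ^+ 2 *+ 2]mulr_natl; field.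
have -> : - x ^+ 2 / ((2 * s) ^+ 2 *+ 2) = - (y / 2) by rewrite xE -[_ *+ 2]mulr_natl; field.
exact: norm_mul_expRN_le.
Qed.

Lemma integrable_mul_normal_pdf G K : measurable_fun setT G -> (forall x, `|G x| <= K * (1 + `|x|)) ->
  mu.-integrable setT (EFin \o (fun x => G x * pdf x)).
Proof.
move=> mG G_le; have K0 : 0 <= K.
  by rewrite -(pmulr_lge0 _ (ltr01 : 0 < 1 :> R)); have := le_trans (normr_ge0 _) (G_le 0); rewrite normr0 addr0.
have [C C0 pdf_le] := norm_mul_normal_pdf_le.
have int_pdf : mu.-integrable setT (EFin \o (fun x => K * pdf x + K * C * normal_pdf 0 (2 * s) x)).
  exact: (integrableD measurableT (integrable_EFinZ K (integrable_normal_pdf 0 s))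
    (integrable_EFinZ (K * C) (integrable_normal_pdf 0 (2 * s)))).
apply: le_integrable int_pdf => // [|x _ /=].
  by apply/measurable_EFinP; apply: measurable_funM => //; exact: measurable_normal_pdf.
have pdf0 := normal_pdf_ge0 0 s x; have pdf20 := normal_pdf_ge0 0 (2 * s) x.
rewrite lee_fin normrM (ger0_norm pdf0) (le_trans _ (ler_norm _))//.
rewrite (le_trans (ler_wpM2r pdf0 (G_le x)))// -!mulrA -mulrDr ler_wpM2l// mulrDl mul1r lerD2l.
exact: pdf_le.
Qed.

Lemma integrable_bounded_normal_pdf G : bmfun G -> mu.-integrable setT (EFin \o (fun x => G x * pdf x)).
Proof.
move=> [mG [K GK]]; apply: (@integrable_mul_normal_pdf _ K) => // x; rewrite (le_trans (GK x))//.
by rewrite ler_peMr ?lerDl// (le_trans (normr_ge0 _) (GK 0)).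
Qed.

Lemma bounded_functional_normal_pdf : @bounded_functional R _ (measurableTypeR R) (fun G => \int[mu]_x (G x * pdf x)).
Proof.
split=> [X Y bX bY|k X bX|].
- rewrite -RintegralD//; try exact: integrable_bounded_normal_pdf.
  by apply: eq_Rintegral => x _; rewrite mulrDl.
- rewrite -RintegralZl//; last exact: integrable_bounded_normal_pdf.
  by apply: eq_Rintegral => x _; rewrite mulrA.
exists 1 => // X K bX XK; have int_X := integrable_bounded_normal_pdf bX.
apply: le_trans (le_normr_Rintegral _ int_X) _ => //.
have -> : 1 * K = \int[mu]_x (K * pdf x).
  by rewrite RintegralZl ?integrable_normal_pdf// /Rintegral integral_normal_pdf mulr1 mul1r.
apply: le_Rintegral => // [||x _].
- exact: (integrable_abse int_X).
- exact: integrable_bounded_normal_pdf (bmfun_cst K).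
- by rewrite normrM (ger0_norm (normal_pdf_ge0 _ _ _)) ler_wpM2r ?normal_pdf_ge0.
Qed.

Lemma fine_normal_prob (A : set R) : measurable A ->
  fine (normal_prob 0 s A) = \int[mu]_x (\1_A x * pdf x).
Proof.
move=> mA; rewrite /normal_prob /Rintegral [in LHS]integral_mkcond; congr fine.
by apply: eq_integral => x _; rewrite /patch indicE; case: ifP => _; rewrite ?mul1r ?mul0r.
Qed.

Lemma expect_normal_prob G : bmfun G -> expect (normal_prob 0 s) G = \int[mu]_x (G x * pdf x).
Proof.
have expect1 : (fun X => expect (normal_prob 0 s) X) = fun X => expect (normal_prob 0 s) (fun x => X x * 1).
  by apply/funext => X; apply: eq_expect => x; rewrite mulr1.
move=> bG; apply: (bounded_functional_ext (L := fun X => expect (normal_prob 0 s) X)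
  (L' := fun X => \int[mu]_x (X x * pdf x)) _ _ _ bG) => [||A mA].
- by rewrite expect1; apply: expect_functional; [exact: measurable_id|exact: bmfun_cst].
- exact: bounded_functional_normal_pdf.
by rewrite expect_indic// fine_normal_prob.
Qed.

Let trig_bmfun theta phi : bmfun (fun x => cos (theta * x + phi)) /\ bmfun (fun x => sin (theta * x + phi)).
Proof.
have m_affine : measurable_fun setT (fun x => theta * x + phi).
  by apply: measurable_funD => //; exact: measurable_funM.
by split; [exact: bmfun_cos|exact: bmfun_sin].
Qed.

Let integrable_cos theta phi : mu.-integrable setT (EFin \o (fun x => cos (theta * x + phi) * pdf x)).
Proof. by apply: integrable_bounded_normal_pdf; have [] := trig_bmfun theta phi. Qed.

Let integrable_mul_sin theta phi :
  mu.-integrable setT (EFin \o (fun x => x * sin (theta * x + phi) * pdf x)).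
Proof.
have [_ [m_sin _]] := trig_bmfun theta phi.
apply: (@integrable_mul_normal_pdf _ 1) => [|x]; first exact: measurable_funM.
by rewrite mul1r normrM (@le_trans _ _ `|x|) ?lerDr// ler_piMr// sin_max.
Qed.

Lemma normal_pdf_cvg0 : pdf n.+1%:R @[n --> \oo] --> 0.
Proof.
have [C C0 pdf_le] := norm_mul_normal_pdf_le.
have upper : C * normal_peak (2 * s) * harmonic n @[n --> \oo] --> 0.
  by rewrite -[X in _ --> X](mulr0 (C * normal_peak (2 * s))); apply: cvgM; [exact: cvg_cst|exact: cvg_harmonic].
apply: (squeeze_cvgr _ (@cvg_cst _ 0 _ \oo _) upper); apply: nearW => n.
rewrite normal_pdf_ge0/= ler_pdivlMr ?ltr0n// mulrC; have := pdf_le n.+1%:R; rewrite normr_nat => /le_trans; apply.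
by rewrite ler_wpM2l// normal_pdf_ub// mulf_neq0.
Qed.

Lemma normal_pdfN x : pdf (- x) = pdf x.
Proof. by rewrite !normal_pdf0E sqrrN. Qed.

(* The derivative of [sin (theta x + phi) * pdf x] integrates to [0]. *)
Lemma normal_integration_by_parts theta phi :
  \int[mu]_x (x * sin (theta * x + phi) * pdf x) =
  s ^+ 2 * theta * \int[mu]_x (cos (theta * x + phi) * pdf x).
Proof.
pose F x := sin (theta * x + phi) * pdf x.
pose f x := theta * (cos (theta * x + phi) * pdf x) - (s ^+ 2)^-1 * (x * sin (theta * x + phi) * pdf x).
have dF x : is_derive x 1 F (f x).
  have d_sin : is_derive x 1 (fun x : R => sin (theta *: x + phi)) (theta * cos (theta * x + phi)).
    by apply: is_derive_eq; rewrite scaler1 addr0 /GRing.scale/=; ring.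
  apply: (is_derive_eq (is_deriveM d_sin (is_derive_normal_pdf x))).
  by rewrite /f /GRing.scale/=; ring.
have c_affine : continuous (fun x : R => theta * x + phi).
  by move=> x; apply: cvgD; [apply: cvgM; [exact: cvg_cst|exact: cvg_id]|exact: cvg_cst].
have c_cos x : cos (theta * y + phi) @[y --> x] --> cos (theta * x + phi).
  by apply: continuous_cvg; [exact: continuous_cos|exact: c_affine].
have c_sin x : sin (theta * y + phi) @[y --> x] --> sin (theta * x + phi).
  by apply: continuous_cvg; [exact: continuous_sin|exact: c_affine].
have c_pdf : continuous pdf by exact: continuous_normal_pdf.
have cf : continuous f.
  move=> x; apply: cvgB; apply: cvgM; first exact: cvg_cst.
  - by apply: cvgM; [exact: c_cos|exact: c_pdf].
  - exact: cvg_cst.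
  - by apply: cvgM; [apply: cvgM; [exact: cvg_id|exact: c_sin]|exact: c_pdf].
have int_cos := integrable_cos theta phi; have int_sin := integrable_mul_sin theta phi.
have int_f : mu.-integrable setT (EFin \o f).
  exact: (integrableB measurableT (integrable_EFinZ theta int_cos) (integrable_EFinZ (s ^+ 2)^-1 int_sin)).
have F_cvg0 : F n.+1%:R - F (- n.+1%:R) @[n --> \oo] --> 0.
  apply/norm_cvg0P; have upper : pdf n.+1%:R + pdf n.+1%:R @[n --> \oo] --> 0.
    by rewrite -[X in _ --> X]addr0; apply: cvgD; exact: normal_pdf_cvg0.
  apply: (squeeze_cvgr _ (@cvg_cst _ 0 _ \oo _) upper); apply: nearW => n.
  rewrite normr_ge0/= (le_trans (ler_normB _ _))// /F normal_pdfN !normrM !(ger0_norm (normal_pdf_ge0 _ _ _)).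
  by apply: lerD; rewrite ler_piMl ?normal_pdf_ge0 ?sin_max.
have := Rintegral_derive_eq0 dF cf int_f F_cvg0.
rewrite RintegralB ?RintegralZl//; try exact: integrable_EFinZ.
move=> /eqP; rewrite subr_eq0 => /eqP eqI.
by rewrite -mulrA eqI mulrA divff ?mul1r// gt_eqF// exprn_gt0.
Qed.

Let integral_cos theta phi := \int[mu]_x (cos (theta * x + phi) * pdf x).

Lemma is_derive_integral_cos phi theta :
  is_derive theta 1 (integral_cos ^~ phi) (- (s ^+ 2 * theta) * integral_cos theta phi).
Proof.
pose h (theta x : R) := cos (theta * x + phi) * pdf x.
have dh (t x : R) : is_derive t 1 (h ^~ x) (- (x * sin (t * x + phi)) * pdf x).
  have -> : h ^~ x = (fun t => pdf x *: cos (x *: t + phi)).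
    by apply/funext => u; rewrite /h /GRing.scale/= mulrC [u * x]mulrC.
  by apply: is_derive_eq; rewrite scaler1 addr0 /GRing.scale/= [x * t]mulrC; ring.
have dhE t x : partial1of2 h t x = - (x * sin (t * x + phi)) * pdf x.
  by rewrite partial1of2E; case: (dh t x).
pose J : set R := [set` `]theta - 1, theta + 1[%R].
have J_theta : J theta by rewrite /J /= in_itv/=; apply/andP; split; lra.
have int_h t : J t -> mu.-integrable setT (EFin \o h t) by move=> _; exact: integrable_cos.
have derivable_h t x : J t -> setT x -> derivable (h ^~ x) t 1 by move=> _ _; case: (dh t x).
have bound0 x : 0 <= `|x| * pdf x by rewrite mulr_ge0// normal_pdf_ge0.
have int_bound : mu.-integrable setT (EFin \o (fun x => `|x| * pdf x)).
  by apply: (@integrable_mul_normal_pdf _ 1) => // x; rewrite mul1r normr_id lerDr.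
have dh_le t x : J t -> setT x -> `|partial1of2 h t x| <= `|x| * pdf x.
  move=> _ _; rewrite dhE normrM (ger0_norm (normal_pdf_ge0 _ _ _)) ler_wpM2r ?normal_pdf_ge0//.
  by rewrite normrN normrM ler_piMr// sin_max.
split; first exact: (derivable_under_integral measurableT J_theta int_h derivable_h bound0 int_bound dh_le).
rewrite -derive1E (differentiation_under_integral measurableT J_theta int_h derivable_h bound0 int_bound dh_le).
transitivity (-1 * \int[mu]_x (x * sin (theta * x + phi) * pdf x)).
  rewrite -(RintegralZl _ measurableT (integrable_mul_sin theta phi)).
  by apply: eq_Rintegral => x _; rewrite dhE; ring.
by rewrite normal_integration_by_parts /integral_cos; ring.
Qed.

Lemma expect_normal_cos theta phi :
  expect (normal_prob 0 s) (fun x => cos (theta * x + phi)) = normal_cf (theta ^+ 2 * s ^+ 2) * cos phi.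
Proof.
rewrite expect_normal_prob; last by have [] := trig_bmfun theta phi.
pose k t := integral_cos t phi * expR (t ^+ 2 * (s ^+ 2 / 2)).
have dk (t : R) : is_derive t 1 k 0.
  have d_exp : is_derive t 1 (fun t : R => expR (t ^+ 2 * (s ^+ 2 / 2))) (t * s ^+ 2 * expR (t ^+ 2 * (s ^+ 2 / 2))).
    by apply: is_derive_eq; rewrite /GRing.scale/=; lra.
  by apply: (is_derive_eq (is_deriveM (is_derive_integral_cos phi t) d_exp)); rewrite /GRing.scale/=; ring.
have k0 : k 0 = cos phi.
  rewrite /k expr0n mul0r expR0 mulr1 /integral_cos; under eq_Rintegral do rewrite mul0r add0r.
  by rewrite RintegralZl ?integrable_normal_pdf// /Rintegral integral_normal_pdf mulr1.
have <- : k theta = cos phi by rewrite -k0; exact: is_derive_0_is_cst.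
rewrite -/(integral_cos theta phi) /k mulrCA -expRD -[LHS]mulr1.
by congr (_ * _); rewrite -[LHS]expR0; congr expR; lra.
Qed.

End normal_integrals.

(** * Wiener process at random times *)

Section halfline_continuity.
Context {R : realType}.
Implicit Types (y z : R -> R) (t s e : R).

Definition halfline_continuous y : Prop := {within `[0, +oo[%classic, continuous y}.

Lemma halfline_continuousP y : halfline_continuous y <->
  forall t e, 0 <= t -> 0 < e ->
    exists2 delta : R, 0 < delta & forall s, 0 <= s -> `|s - t| < delta -> `|y s - y t| <= e.
Proof.
have halflineE s : (`[0, +oo[%classic : set R) s = (0 <= s) by rewrite /= in_itv/= andbT.
split=> [/subspace_continuousP cy t e t0 e0|cy].
  have yt : y @ within `[0, +oo[%classic (nbhs t) --> y t by apply: cy; rewrite halflineE.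
  have := (cvgrPdist_le _ _).1 yt e e0.
  rewrite near_withinE => -[delta delta0 near_t]; exists delta => // s s0 st.
  by rewrite distrC; apply: near_t; [rewrite /= distrC|rewrite halflineE].
apply/subspace_continuousP => t; rewrite halflineE => t0; apply/cvgrPdist_le => e e0.
have [delta delta0 near_t] := cy t e t0 e0; rewrite near_withinE; exists delta => // s /= st.
by rewrite in_itv/= andbT => s0; rewrite distrC; apply: near_t; rewrite 1?distrC.
Qed.

Lemma halfline_continuous_cvg y (v_ : R^nat) (v : R) : halfline_continuous y ->
  (forall n, 0 <= v_ n) -> 0 <= v -> v_ @ \oo --> v -> y (v_ n) @[n --> \oo] --> y v.
Proof.
move=> /halfline_continuousP cy v_0 v0 v_cvg; apply/cvgrPdist_le => e e0.
have [delta delta0 near_v] := cy v e v0 e0.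
have := (cvgrPdist_lt _ _).1 v_cvg _ delta0; case=> A _ vA; exists A => // n /vA /=.
by rewrite distrC => vn; rewrite distrC; apply: near_v.
Qed.

Lemma halfline_continuous_comp y z : (forall t, 0 <= t -> 0 <= z t) ->
  halfline_continuous y -> halfline_continuous z -> halfline_continuous (y \o z).
Proof.
move=> z0 /halfline_continuousP cy /halfline_continuousP cz; apply/halfline_continuousP => t e t0 e0.
have [d1 d10 near_z] := cy (z t) e (z0 _ t0) e0.
have d20 : 0 < d1 / 2 by rewrite divr_gt0.
have [d2 d2p near_t] := cz t (d1 / 2) t0 d20.
exists d2 => // s s0 st /=; apply: near_z; first exact: z0.
by apply: le_lt_trans (near_t s s0 st) _; rewrite ltr_pdivrMr// ltr_pMr// ltrDl.
Qed.

Lemma halfline_continuous_cst (k : R) : halfline_continuous (fun=> k).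
Proof. by apply: continuous_subspaceT => t; exact: cvg_cst. Qed.

Lemma halfline_continuousZ (k : R) y : halfline_continuous y -> halfline_continuous (fun t => k * y t).
Proof. by move=> cy t; apply: cvgM; [exact: cvg_cst|exact: cy]. Qed.

Lemma halfline_continuous_powR (p : R) : 0 < p -> halfline_continuous (fun t => t `^ p).
Proof.
move=> p0; apply/halfline_continuousP => t e t0 e0; have [->|tpos] := eqVneq t 0.
  exists (e `^ p^-1) => [|s s0]; first by rewrite powR_gt0.
  rewrite subr0 powR0 ?gt_eqF// subr0 !ger0_norm ?powR_ge0// => se.
  have -> : e = (e `^ p^-1) `^ p by rewrite -powRrM mulVf ?gt_eqF// powRr1// ltW.
  by apply: le_powR_base; rewrite ?(ltW p0)// ltW.
have t1 : 0 < t by rewrite lt0r tpos.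
have [delta delta0 near_t] := (cvgrPdist_le _ _).1 (continuous_powR (p := p) t1) _ e0.
by exists delta => // s s0 st; rewrite distrC; apply: near_t; rewrite /= distrC.
Qed.

End halfline_continuity.

Section random_parameter.
Context {R : realType} {d} {T : measurableType d}.
Implicit Types (tau : T -> R).

Lemma measurable_truncn_eq (n k : nat) tau : measurable_fun setT tau -> (forall w, 0 <= tau w) ->
  measurable [set w | truncn (n%:R * tau w) = k].
Proof.
move=> mtau tau0; rewrite (_ : [set w | _] = (fun w => n%:R * tau w) @^-1` `[k%:R, k.+1%:R[%classic).
  by apply: measurable_preimageT => //; exact: measurable_funM.
apply/seteqP; split=> w /=; rewrite in_itv/=; last exact: truncn_def.
by move=> <-; apply: truncn_itv; rewrite mulr_ge0.
Qed.

Lemma measurable_grid_parameter (Phi : R -> T -> R) tau n : (forall t, measurable_fun setT (Phi t)) ->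
  measurable_fun setT tau -> (forall w, 0 <= tau w) ->
  measurable_fun setT (fun w => Phi (grid_floor n (tau w)) w).
Proof.
move=> mPhi mtau tau0.
apply: (@measurable_fun_countable _ _ _ _ (fun w => truncn (n%:R * tau w)) (fun k => Phi (k%:R / n%:R))) => //.
by move=> k; exact: measurable_truncn_eq.
Qed.

Lemma measurable_random_parameter (Phi : R -> T -> R) tau : (forall t, measurable_fun setT (Phi t)) ->
  (forall w, halfline_continuous (Phi ^~ w)) -> measurable_fun setT tau -> (forall w, 0 <= tau w) ->
  measurable_fun setT (fun w => Phi (tau w) w).
Proof.
move=> mPhi cPhi mtau tau0.
apply: (@measurable_fun_cvg _ _ _ _ (fun n w => Phi (grid_floor n (tau w)) w)) => [n|w _].
  exact: measurable_grid_parameter.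
apply: (halfline_continuous_cvg (cPhi w)) => // [n|]; [exact: grid_floor_ge0|exact: grid_floor_cvg].
Qed.

End random_parameter.

Section independent_parameter.
Context {R : realType} {d d' : measure_display} {Om : measurableType d} {Om' : measurableType d'}.
Context (P : probability Om R) (P' : probability Om' R) (Z : Om -> R) (Z' : Om' -> R).
Context (Phi : R -> Om' -> R) (C : R).
Hypothesis measurable_Z : measurable_fun setT Z.
Hypothesis measurable_Z' : measurable_fun setT Z'.
Hypothesis measurable_Phi : forall t, measurable_fun setT (Phi t).
Hypothesis Phi_le : forall t w, `|Phi t w| <= C.
Hypothesis Phi_continuous : forall w, halfline_continuous (Phi ^~ w).
Hypothesis Phi_indep : forall (A : set R) t, measurable A -> 0 <= t ->
  expect P' (fun w => \1_(Z' @^-1` A) w * Phi t w) = fine (P (Z @^-1` A)) * expect P' (Phi t).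

Let bPhi t : bmfun (Phi t). Proof. by split=> //; exists C. Qed.
#[local] Hint Resolve bPhi : bmfun.

Let mean t := expect P' (Phi t).

Lemma mean_cvg (t_ : R^nat) (t : R) : (forall n, 0 <= t_ n) -> 0 <= t -> t_ @ \oo --> t ->
  mean (t_ n) @[n --> \oo] --> mean t.
Proof.
move=> t_0 t0 t_cvg; apply: (@bounded_convergence _ _ _ _ _ _ C) => //.
by apply: aeW => w; apply: (halfline_continuous_cvg (@Phi_continuous w)).
Qed.

Section bounded_parameter.
Variables (u : R -> R) (K : nat).
Hypothesis measurable_u : measurable_fun setT u.
Hypothesis u_range : forall z, 0 <= u z <= K%:R.

Let u0 z : 0 <= u z. Proof. by have /andP[] := u_range z. Qed.

Let level n j : set R := [set z | truncn (n%:R * u z) = j].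

Lemma sum_level n (f : nat -> R) z :
  f (truncn (n%:R * u z)) = \sum_(j < (K * n).+1) \1_(level n j) z * f j.
Proof.
have j_lt : (truncn (n%:R * u z) < (K * n).+1)%N.
  rewrite ltnS -(ler_nat R) natrM (@le_trans _ _ (n%:R * u z)) ?truncn_le ?mulr_ge0//.
  by rewrite mulrC ler_wpM2r//; have /andP[] := u_range z.
rewrite (bigD1 (Ordinal j_lt))//= indicE mem_set// mul1r big1 ?addr0// => j /eqP jn.
by rewrite indicE memNset ?mul0r//= => zj; apply: jn; exact: val_inj.
Qed.

Lemma expect_grid_parameter n : expect P' (fun w => Phi (grid_floor n (u (Z' w))) w) =
  expect P (fun w => mean (grid_floor n (u (Z w)))).
Proof.
have m_level j : measurable (level n j) by exact: measurable_truncn_eq.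
have m_Z j : measurable (Z @^-1` level n j) by exact: measurable_preimageT.
have m_Z' j : measurable (Z' @^-1` level n j) by exact: measurable_preimageT.
transitivity (\sum_(j < (K * n).+1) expect P' (fun w => \1_(Z' @^-1` level n j) w * Phi (j%:R / n%:R) w)).
  rewrite -expect_sum//; apply: eq_expect => w.
  by rewrite -(sum_level n (fun j => Phi (j%:R / n%:R) w)).
transitivity (\sum_(j < (K * n).+1) expect P (fun w => mean (j%:R / n%:R) * \1_(Z @^-1` level n j) w)).
  by apply: eq_bigr => j _; rewrite Phi_indep ?divr_ge0// expectZ// expect_indic// mulrC.
rewrite -expect_sum//; apply: eq_expect => w.
under eq_bigr do rewrite mulrC.
by rewrite -(sum_level n (fun j => mean (j%:R / n%:R))).
Qed.

Lemma expect_independent_parameter :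
  expect P' (fun w => Phi (u (Z' w)) w) = expect P (fun w => mean (u (Z w))).
Proof.
have m_uZ : measurable_fun setT (u \o Z) by exact: measurableT_comp.
have m_uZ' : measurable_fun setT (u \o Z') by exact: measurableT_comp.
have m_grid n : measurable_fun setT (fun w => mean (grid_floor n (u (Z w)))).
  by apply: (@measurable_grid_parameter _ _ _ (fun t _ => mean t) (u \o Z)) => // w; exact: u0.
have grid_cvg z : grid_floor n (u z) @[n --> \oo] --> u z by exact: grid_floor_cvg.
have mean_grid_cvg w : mean (grid_floor n (u (Z w))) @[n --> \oo] --> mean (u (Z w)).
  by apply: mean_cvg => // n; exact: grid_floor_ge0.
apply: (cvg_unique _ (_ : expect P' (fun w => Phi (grid_floor n (u (Z' w))) w) @[n --> \oo] --> _)).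
- exact: norm_hausdorff.
- apply: (@bounded_convergence _ _ _ _ _ _ C) => // [n||].
  + by apply: (@measurable_grid_parameter _ _ _ Phi (u \o Z')) => // w; exact: u0.
  + by apply: (@measurable_random_parameter _ _ _ Phi (u \o Z')) => // w; exact: u0.
  + by apply: aeW => w; apply: (halfline_continuous_cvg (@Phi_continuous w)) => // n; exact: grid_floor_ge0.
- apply: near_eq_cvgn; first by apply: nearW => n; exact: expect_grid_parameter.
  apply: (@bounded_convergence _ _ _ _ _ _ C) => //.
  + by apply: (@measurable_fun_cvg _ _ _ _ (fun n w => mean (grid_floor n (u (Z w))))) => // w _.
  + by move=> n w; apply: norm_expect_le_cst.
  + by apply: aeW.
Qed.

End bounded_parameter.
End independent_parameter.

Record wiener_with_copy {R : realType} {d d' : measure_display} {Om : measurableType d}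
    {Om' : measurableType d'} (P : probability Om R) (P' : probability Om' R) (W : R -> Om' -> R)
    (Z' : Om' -> R) (Z : Om -> R) : Prop := WienerWithCopy {
  copied_measurable : measurable_fun setT Z;
  copy_measurable : measurable_fun setT Z';
  wiener_measurable : forall t, measurable_fun setT (W t);
  wiener0 : forall w, W 0 w = 0;
  wiener_continuous : forall w, halfline_continuous (W ^~ w);
  wiener_law : forall (m : nat) (ts : nat -> R) (A : set R) (B : nat -> set R),
    ts 0%N = 0 -> (forall j, (j < m)%N -> ts j < ts j.+1) ->
    measurable A -> (forall j, measurable (B j)) ->
    P' (Z' @^-1` A `&` [set w | forall j, (1 <= j <= m)%N -> B j (W (ts j) w - W (ts j.-1) w)]) =
    (P (Z @^-1` A) * \prod_(1 <= j < m.+1) normal_prob 0 (Num.sqrt (ts j - ts j.-1)) (B j))%E }.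

Lemma sum_leq_telescope {R : pzRingType} (x : nat -> R) (n q : nat) : (n <= q)%N ->
  \sum_(1 <= l < q.+1) (l <= n)%N%:R * (x l - x l.-1) = x n - x 0%N.
Proof.
move=> nq; rewrite -(telescope_sumr x (leq0n n)) big_add1/=.
rewrite (big_nat_widen 0 n q) ?leqW// [RHS]big_mkcond; apply: eq_bigr => l _ /=.
by case: ltnP => _; rewrite ?mul1r ?mul0r.
Qed.

Section wiener.
Context {R : realType} {d d' : measure_display} {Om : measurableType d} {Om' : measurableType d'}.
Context (P : probability Om R) (P' : probability Om' R) (W : R -> Om' -> R) (Z' : Om' -> R) (Z : Om -> R).
Hypothesis wienerW : wiener_with_copy P P' W Z' Z.

Let mZ := copied_measurable wienerW.
Let mZ' := copy_measurable wienerW.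
Let mW := wiener_measurable wienerW.

Section increments.
Variables (m : nat) (ts : nat -> R) (A : set R).
Hypothesis ts0 : ts 0%N = 0.
Hypothesis ts_incr : forall j, (j < m)%N -> ts j < ts j.+1.
Hypothesis mA : measurable A.
Implicit Types (B : nat -> set R) (beta : nat -> R) (k : nat) (phi : R).

Let incr j w := W (ts j) w - W (ts j.-1) w.
Let law j := normal_prob 0 (Num.sqrt (ts j - ts j.-1)).
Let cylinder k B : set Om' := Z' @^-1` A `&` [set w | forall j, (k < j <= m)%N -> B j (incr j w)].

Lemma measurable_increment j : measurable_fun setT (incr j).
Proof. exact: measurable_funB. Qed.

Lemma measurable_cylinder k B : (forall j, measurable (B j)) -> measurable (cylinder k B).
Proof.
move=> mB; apply: measurableI; first exact: measurable_preimageT.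
rewrite (_ : [set w | _] = \bigcap_j (if (k < j <= m)%N then incr j @^-1` B j else setT)).
  apply: bigcapT_measurable => j; case: ifP => // _.
  by apply: measurable_preimageT => //; exact: measurable_increment.
apply/seteqP; split=> w /= Bw j; first by move=> _; case: ifP => // ?; exact: Bw.
by move=> kj; have := Bw j I; rewrite kj.
Qed.

Lemma cylinder_indicS k B (B0 : set R) w : (k < m)%N ->
  \1_(cylinder k (fun j => if j == k.+1 then B0 else B j)) w = \1_(cylinder k.+1 B) w * \1_B0 (incr k.+1 w) :> R.
Proof.
move=> km; rewrite -[\1_B0 _]/(\1_(incr k.+1 @^-1` B0) w) -[RHS]/((\1_(cylinder k.+1 B) \* \1_(incr k.+1 @^-1` B0)) w) -indicI.
congr (\1_ _ w); apply/seteqP; split=> w' /= [] => [ZA inB|[ZA inB] inB0]; last first.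
  split=> // j /andP[kj jm]; case: eqVneq => [->//|jk].
  by apply: inB; rewrite jm andbT ltn_neqAle eq_sym jk.
split; last by have := inB k.+1; rewrite eqxx; apply; rewrite ltnSn.
by split=> // j /andP[kj jm]; have := inB j; rewrite gtn_eqF//; apply; rewrite jm andbT ltnW.
Qed.

Definition partial_variance beta k : R := \sum_(1 <= j < k.+1) beta j ^+ 2 * (ts j - ts j.-1).

Let combination beta k w := \sum_(1 <= j < k.+1) beta j * incr j w.

Lemma expect_cylinder B : (forall j, measurable (B j)) ->
  expect P' (\1_(cylinder 0 B)) = fine (P (Z @^-1` A)) * \prod_(1 <= j < m.+1) fine (law j (B j)).
Proof.
move=> mB; rewrite expect_indic; last exact: measurable_cylinder.
have lawE j : law j (B j) = (fine (law j (B j)))%:E.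
  by rewrite fineK//; exact: (@fin_num_measure _ _ _ (law j) _ (mB j)).
rewrite (wiener_law wienerW ts0 ts_incr mA mB) (eq_bigr _ (fun j _ => lawE j)).
by rewrite prodEFin fineM ?fin_num_measure//; exact: measurable_preimageT.
Qed.

Let cos_factorization beta k := forall phi B, (forall j, measurable (B j)) ->
  expect P' (fun w => \1_(cylinder k B) w * cos (phi + combination beta k w)) =
  fine (P (Z @^-1` A)) * \prod_(k.+1 <= j < m.+1) fine (law j (B j)) *
    (normal_cf (partial_variance beta k) * cos phi).

Lemma cos_factorization0 beta : cos_factorization beta 0.
Proof.
move=> phi B mB; have -> : partial_variance beta 0 = 0 by rewrite /partial_variance big_geq.
rewrite normal_cf0 mul1r -expect_cylinder//.
under eq_expect do rewrite /combination big_geq// addr0 mulrC.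
by rewrite expectZ; [rewrite mulrC|apply: bmfun_indic; exact: measurable_cylinder].
Qed.

Let past_cos beta k B psi w : R := \1_(cylinder k.+1 B) w * cos (psi + combination beta k w).

Lemma past_cos_bmfun beta k B psi : (forall j, measurable (B j)) -> bmfun (past_cos beta k B psi).
Proof.
move=> mB; apply: bmfunM; first by apply: bmfun_indic; exact: measurable_cylinder.
apply: bmfun_cos; apply: measurable_funD => //; apply: measurable_sum => j.
by apply: measurable_funM => //; exact: measurable_increment.
Qed.

Lemma expect_next_increment beta k B psi (G : measurableTypeR R -> R) : (k < m)%N -> (forall j, measurable (B j)) ->
  cos_factorization beta k -> bmfun G ->
  expect P' (fun w => G (incr k.+1 w) * past_cos beta k B psi w) =
  fine (P (Z @^-1` A)) * \prod_(k.+2 <= j < m.+1) fine (law j (B j)) *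
    (normal_cf (partial_variance beta k) * cos psi) * expect (law k.+1) G.
Proof.
move=> km mB ih bG; apply: (expect_product_law (Q := law k.+1) _ (past_cos_bmfun beta k psi mB) bG) => [|B0 mB0].
  exact: measurable_increment.
pose B' j := if j == k.+1 then B0 else B j.
have mB' j : measurable (B' j) by rewrite /B'; case: ifP => _; [exact: mB0|exact: mB].
under eq_expect do rewrite /past_cos mulrA [\1_B0 _ * _]mulrC -cylinder_indicS//.
rewrite (ih psi B' mB') big_ltn// {1}/B' eqxx.
have -> : \prod_(k.+2 <= j < m.+1) fine (law j (B' j)) = \prod_(k.+2 <= j < m.+1) fine (law j (B j)).
  by apply: eq_big_nat => j /andP[kj _]; rewrite /B' gtn_eqF.
by ring.
Qed.

Lemma cos_factorizationS beta k : (k < m)%N -> cos_factorization beta k -> cos_factorization beta k.+1.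
Proof.
move=> km ih phi B mB; have bX psi := past_cos_bmfun beta k psi mB.
have b_cos t : @bmfun R _ (measurableTypeR R) (fun x => cos (beta k.+1 * x + t)).
  by apply: bmfun_cos; apply: measurable_funD => //; exact: measurable_funM.
have b_incr t : bmfun (fun w => cos (beta k.+1 * incr k.+1 w + t)).
  apply: bmfun_cos; apply: measurable_funD => //; apply: measurable_funM => //.
  exact: measurable_increment.
have dt : 0 < ts k.+1 - ts k by rewrite subr_gt0 ts_incr.
transitivity (expect P' (fun w => cos (beta k.+1 * incr k.+1 w + 0) * past_cos beta k B phi w -
    cos (beta k.+1 * incr k.+1 w - pi / 2) * past_cos beta k B (phi - pi / 2) w)).
  apply: eq_expect => w; rewrite /past_cos [combination beta k.+1 w]big_nat_recr//= addrA cosD addr0.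
  by rewrite -/(combination beta k w) [phi - _ + _]addrAC !cosBpihalf; ring.
have next_cos psi t : expect P' (fun w => cos (beta k.+1 * incr k.+1 w + t) * past_cos beta k B psi w) =
    fine (P (Z @^-1` A)) * \prod_(k.+2 <= j < m.+1) fine (law j (B j)) *
    (normal_cf (partial_variance beta k) * cos psi) *
    (normal_cf (beta k.+1 ^+ 2 * (ts k.+1 - ts k)) * cos t).
  apply: etrans (expect_next_increment psi km mB ih (b_cos t)) _; congr (_ * _).
  by rewrite expect_normal_cos ?sqrtr_gt0// sqr_sqrtr// ltW.
rewrite (expectB P' (bmfunM (b_incr 0) (bX phi)) (bmfunM (b_incr (- (pi / 2))) (bX (phi - pi / 2)))).
rewrite (next_cos phi 0) (next_cos (phi - pi / 2) (- (pi / 2))) cosN cos_pihalf cos0.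
have -> : partial_variance beta k.+1 = partial_variance beta k + beta k.+1 ^+ 2 * (ts k.+1 - ts k).
  by rewrite /partial_variance big_nat_recr.
by rewrite normal_cfD; ring.
Qed.

Lemma expect_cos_increments beta phi :
  expect P' (fun w => \1_(Z' @^-1` A) w * cos (phi + \sum_(1 <= j < m.+1) beta j * incr j w)) =
  fine (P (Z @^-1` A)) * (normal_cf (partial_variance beta m) * cos phi).
Proof.
have factor k : (k <= m)%N -> cos_factorization beta k.
  by elim: k => [_|k ih km]; [exact: cos_factorization0|exact: cos_factorizationS (ih (ltnW km))].
have := factor m (leqnn m) phi (fun=> setT) (fun=> measurableT).
rewrite [\prod_(_ <= _ < _) _]big_geq// mulr1 => <-; apply: eq_expect => w; congr (\1_ _ w * _).
by apply/seteqP; split=> w' //= [].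
Qed.

End increments.

Lemma copy_law A : measurable A -> expect P' (\1_(Z' @^-1` A)) = fine (P (Z @^-1` A)).
Proof.
move=> mA; have := @expect_cos_increments 0 (fun=> 0) A erefl _ mA (fun=> 0) 0.
rewrite /partial_variance !big_geq// normal_cf0 cos0 !mulr1 => <- //.
by apply: eq_expect => w; rewrite big_geq// addr0 cos0 mulr1.
Qed.

Section marginals.
Variables (q : nat) (s theta : nat -> R).
Hypothesis s0 : s 0%N = 0.
Hypothesis s_incr : forall j, (j < q)%N -> s j < s j.+1.

Definition wiener_form : R := \sum_(i < q) \sum_(j < q) theta i * theta j * s (minn i j).+1.

Let beta l := \sum_(i < q) theta i * (l <= i.+1)%N%:R.

Lemma sum_increments (x : nat -> R) : x 0%N = 0 ->
  \sum_(1 <= l < q.+1) beta l * (x l - x l.-1) = \sum_(i < q) theta i * x i.+1.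
Proof.
move=> x0; under eq_bigr do rewrite mulr_suml.
rewrite exchange_big/=; apply: eq_bigr => i _.
by under eq_bigr do rewrite -mulrA; rewrite -mulr_sumr sum_leq_telescope ?ltn_ord// x0 subr0.
Qed.

Lemma partial_variance_scaled (u : R) : partial_variance (fun j => u * s j) beta q = u * wiener_form.
Proof.
rewrite /wiener_form mulr_sumr.
transitivity (\sum_(1 <= l < q.+1) \sum_(i < q) \sum_(j < q) u * (theta i * theta j) *
    ((l <= (minn i j).+1)%N%:R * (s l - s l.-1))).
  apply: eq_bigr => l _; rewrite expr2 {1 2}/beta big_distrlr/= mulr_suml; apply: eq_bigr => i _.
  rewrite mulr_suml; apply: eq_bigr => j _.
  by rewrite -minnSS leq_min -mulnb natrM; ring.
rewrite exchange_big/=; apply: eq_bigr => i _; rewrite exchange_big/= mulr_sumr; apply: eq_bigr => j _.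
rewrite -mulr_sumr sum_leq_telescope ?s0 ?subr0 ?mulrA//.
by rewrite (leq_trans _ (ltn_ord i))// ltnS geq_minl.
Qed.

Lemma expect_cos_wiener (u : R) (A : set R) (phi : R) : 0 <= u -> measurable A ->
  expect P' (fun w => \1_(Z' @^-1` A) w * cos (phi + \sum_(i < q) theta i * W (u * s i.+1) w)) =
  fine (P (Z @^-1` A)) * (normal_cf (u * wiener_form) * cos phi).
Proof.
rewrite le_eqVlt => /predU1P[<-|u0] mA.
  rewrite mul0r normal_cf0 mul1r -copy_law// mulrC -expectZ; last first.
    by apply: bmfun_indic; exact: measurable_preimageT.
  apply: eq_expect => w; rewrite mulrC big1 ?addr0// => i _.
  by rewrite mul0r (wiener0 wienerW) mulr0.
have us0 : u * s 0%N = 0 by rewrite s0 mulr0.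
have us_incr j : (j < q)%N -> u * s j < u * s j.+1 by move=> jq; rewrite ltr_pM2l// s_incr.
rewrite -partial_variance_scaled -(expect_cos_increments us0 us_incr mA beta phi).
apply: eq_expect => w; rewrite (@sum_increments (fun l => W (u * s l) w))//.
by rewrite us0 (wiener0 wienerW).
Qed.

Hypothesis s_ge0 : forall j, 0 <= s j.

Lemma expect_cos_wiener_copy (u : R -> R) (K : nat) (phi : R) :
  measurable_fun setT u -> (forall z, 0 <= u z <= K%:R) ->
  expect P' (fun w => cos (phi + \sum_(i < q) theta i * W (u (Z' w) * s i.+1) w)) =
  expect P (fun w => normal_cf (u (Z w) * wiener_form) * cos phi).
Proof.
move=> mu_ u_range; pose Phi x w := cos (phi + \sum_(i < q) theta i * W (x * s i.+1) w).
have u0 z : 0 <= u z by have /andP[] := u_range z.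
have m_Phi x : measurable_fun setT (Phi x).
  apply: bmfun_measurable; apply: bmfun_cos; apply: measurable_funD => //.
  by apply: measurable_sum => i; exact: measurable_funM.
have meanE x : 0 <= x -> expect P' (Phi x) = normal_cf (x * wiener_form) * cos phi.
  move=> x0; have := expect_cos_wiener phi x0 measurableT.
  under eq_expect do rewrite preimage_setT indicT mul1r.
  by rewrite preimage_setT probability_setT mul1r.
rewrite (expect_independent_parameter (P := P) (C := 1) mZ mZ' m_Phi _ _ _ mu_ u_range).
- by apply: eq_expect => w; rewrite meanE.
- by move=> x w; exact: cos_max.
- move=> w x; apply: (@continuous_cvg _ _ _ _ _ _ (@cos R)); first exact: continuous_cos.
  apply: cvgD; first exact: cvg_cst.
  apply: cvg_big => [|i _]; first exact: add_continuous.
  apply: cvgM; first exact: cvg_cst.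
  apply: (@halfline_continuous_comp _ (W ^~ w) (fun x => x * s i.+1)) => [y y0||].
  + exact: mulr_ge0.
  + exact: wiener_continuous wienerW w.
  + by apply: continuous_subspaceT => y; apply: cvgM; [exact: cvg_id|exact: cvg_cst].
- by move=> A t mA t0; rewrite expect_cos_wiener// meanE.
Qed.

End marginals.
End wiener.

(** * From characteristic functions to Lipschitz functions *)

Section bernstein.
Context {R : realType}.

(* The expectation of [f (k + S)] for a binomial variable [S] of parameters [n] and [v]. *)
Fixpoint binomial_mean (n : nat) (f : nat -> R) (v : R) (k : nat) : R :=
  if n is n'.+1 then v * binomial_mean n' f v k.+1 + (1 - v) * binomial_mean n' f v k else f k.

Lemma binomial_mean_dist (n : nat) (f : nat -> R) (v c A B a : R) k : 0 <= v <= 1 ->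
  (forall j, `|f j - c| <= A + B * (j%:R - a) ^+ 2) ->
  `|binomial_mean n f v k - c| <= A + B * ((k%:R + n%:R * v - a) ^+ 2 + n%:R * (v * (1 - v))).
Proof.
move=> /andP[v0 v1] f_le; elim: n k => [|n ih] k /=; first by rewrite !mul0r !addr0.
have v1' : 0 <= 1 - v by lra.
have -> : v * binomial_mean n f v k.+1 + (1 - v) * binomial_mean n f v k - c =
  v * (binomial_mean n f v k.+1 - c) + (1 - v) * (binomial_mean n f v k - c) by ring.
rewrite (le_trans (ler_normD _ _))// !normrM (ger0_norm v0) (ger0_norm v1').
apply: le_trans (lerD (ler_wpM2l v0 (ih k.+1)) (ler_wpM2l v1' (ih k))) _.
by rewrite -[k.+1%:R]natr1 -[n.+1%:R]natr1; lra.
Qed.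

Lemma norm_le_delta_sqr (delta z : R) : 0 < delta -> `|z| <= delta + z ^+ 2 / delta.
Proof.
move=> delta0; have [zd|/ltW zd] := leP `|z| delta.
  by rewrite (le_trans zd)// lerDl divr_ge0 ?sqr_ge0// ltW.
rewrite -[z ^+ 2](real_normK (num_real _)) (@le_trans _ _ (`|z| ^+ 2 / delta))//; last by rewrite lerDr ltW.
by rewrite ler_pdivlMr// expr2 ler_wpM2l.
Qed.

Lemma bernstein_dist (phi : R -> R) (Lam delta v : R) n : 0 <= Lam -> 0 < delta -> 0 <= v <= 1 ->
  (forall x y, `|phi x - phi y| <= Lam * `|x - y|) -> n.+1%:R^-1 <= delta ^+ 2 ->
  `|binomial_mean n.+1 (fun l => phi (l%:R / n.+1%:R)) v 0 - phi v| <= 2 * Lam * delta.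
Proof.
move=> Lam0 delta0 v01 phi_lip n_delta; have n0 : (0 : R) < n.+1%:R by rewrite ltr0n.
have phi_le l : `|phi (l%:R / n.+1%:R) - phi v| <=
    Lam * delta + Lam / delta / n.+1%:R ^+ 2 * (l%:R - n.+1%:R * v) ^+ 2.
  apply: le_trans (phi_lip _ _) _; apply: le_trans (ler_wpM2l Lam0 (norm_le_delta_sqr _ delta0)) _.
  rewrite mulrDr lerD2l le_eqVlt; apply/orP; left; apply/eqP.
  by move: (n.+1%:R : R) n0 => m m0; field; rewrite !gt_eqF.
apply: le_trans (binomial_mean_dist _ _ v01 phi_le) _.
rewrite add0r subrr expr0n add0r [leRHS](_ : _ = Lam * delta + Lam * delta) ?lerD2l; last by ring.
have -> : Lam / delta / n.+1%:R ^+ 2 * (n.+1%:R * (v * (1 - v))) = Lam * (v * (1 - v) * n.+1%:R^-1 / delta).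
  by move: (n.+1%:R : R) n0 => m m0; field; rewrite !gt_eqF.
rewrite ler_wpM2l// ler_pdivrMr// -expr2 (le_trans _ n_delta)// ler_piMl ?invr_ge0//.
by have /andP[? ?] := v01; nra.
Qed.

End bernstein.

Section lipschitz_test_functions.
Context {R : realType} {d d' : measure_display} {Om : measurableType d} {Om' : measurableType d'}.
Context (P : probability Om R) (P' : probability Om' R) (q : nat).
Context (x : nat -> nat -> Om -> R) (y : nat -> Om' -> R).
Hypothesis bx : forall n i, bmfun (x n i).
Hypothesis my : forall i, measurable_fun setT (y i).
Hypothesis cos_cvg : forall (theta : nat -> R) (phi : R),
  expect P (fun w => cos (phi + \sum_(i < q) theta i * x n i w)) @[n --> \oo] -->
  expect P' (fun w => cos (phi + \sum_(i < q) theta i * y i w)).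
Implicit Types (F G h : (nat -> R) -> R) (a b : nat -> R) (C L K c e : R).

Let mx n i : measurable_fun setT (x n i). Proof. exact: bmfun_measurable. Qed.

Definition seq_continuous F : Prop := forall (a_ : nat -> nat -> R) a,
  (forall k, a_ n k @[n --> \oo] --> a k) -> F (a_ n) @[n --> \oo] --> F a.

Definition test_function F : Prop := [/\ exists C, forall a, `|F a| <= C, seq_continuous F &
  expect P (fun w => F (fun i => x n i w)) @[n --> \oo] --> expect P' (fun w => F (fun i => y i w))].

Lemma bmfun_seq_continuous {d0} {T : measurableType d0} F (xi : nat -> T -> R) :
  (exists C, forall a, `|F a| <= C) -> seq_continuous F -> (forall i, measurable_fun setT (xi i)) ->
  bmfun (fun w => F (fun i => xi i w)).
Proof. by move=> [C FC] cF mxi; split; [exact: measurable_seq_continuous|exists C]. Qed.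

Lemma test_function_bmfun F n : test_function F -> bmfun (fun w => F (fun i => x n i w)).
Proof. by move=> [FC cF _]; exact: bmfun_seq_continuous. Qed.

Lemma test_function_limit_bmfun F : test_function F -> bmfun (fun w => F (fun i => y i w)).
Proof. by move=> [FC cF _]; exact: bmfun_seq_continuous. Qed.

#[local] Hint Resolve test_function_bmfun test_function_limit_bmfun : bmfun.

Lemma eq_test_function F G : (forall a, F a = G a) -> test_function F -> test_function G.
Proof. by move=> FG; have -> : F = G by exact/funext. Qed.

Lemma test_functionD F G : test_function F -> test_function G -> test_function (fun a => F a + G a).
Proof.
move=> tF tG; have [[C FC] cF F_cvg] := tF; have [[C' GC] cG G_cvg] := tG; split.
- by exists (C + C') => a; apply: le_trans (ler_normD _ _) _; exact: lerD.
- by move=> a_ a a_cvg; apply: cvgD; [exact: cF|exact: cG].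
- rewrite expectD//; apply: near_eq_cvgn (cvgD F_cvg G_cvg).
  by apply: nearW => n; rewrite expectD.
Qed.

Lemma test_functionZ c F : test_function F -> test_function (fun a => c * F a).
Proof.
move=> tF; have [[C FC] cF F_cvg] := tF; split.
- by exists (`|c| * C) => a; rewrite normrM ler_wpM2l.
- by move=> a_ a a_cvg; apply: cvgM; [exact: cvg_cst|exact: cF].
- rewrite expectZ//; apply: near_eq_cvgn (cvgM (@cvg_cst _ c _ \oo _) F_cvg).
  by apply: nearW => n; rewrite expectZ.
Qed.

Lemma dist_le_three e (s1 t1 s2 t2 : R) : `|s1 - t1| <= e / 3 -> `|t1 - t2| <= e / 3 ->
  `|s2 - t2| <= e / 3 -> `|s1 - s2| <= e.
Proof.
move=> st1 t12 st2; rewrite (_ : s1 - s2 = (s1 - t1) + (t1 - t2) - (s2 - t2)); last by ring.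
by have := ler_normB (s1 - t1 + (t1 - t2)) (s2 - t2); have := ler_normD (s1 - t1) (t1 - t2); lra.
Qed.

Lemma seq_continuous_unif F :
  (forall e, 0 < e -> exists2 G, seq_continuous G & forall a, `|F a - G a| <= e) -> seq_continuous F.
Proof.
move=> approx a_ a a_cvg; apply/cvgrPdist_le => e e0; have e3 : 0 < e / 3 by rewrite divr_gt0.
have [G cG FG] := approx _ e3.
have [A _ GA] := (cvgrPdist_le _ _).1 (cG _ _ a_cvg) _ e3; exists A => // n /GA Gn.
exact: dist_le_three (FG a) Gn (FG (a_ n)).
Qed.

Lemma test_function_unif F :
  (forall e, 0 < e -> exists2 G, test_function G & forall a, `|F a - G a| <= e) -> test_function F.
Proof.
move=> approx; have F_bounded : exists C, forall a, `|F a| <= C.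
  have [G [[C GC] _ _] FG] := approx 1 ltr01; exists (1 + C) => a.
  by rewrite -[F a](subrK (G a)) (le_trans (ler_normD _ _))// lerD.
have cF : seq_continuous F.
  by apply: seq_continuous_unif => e /approx[G [_ cG _] FG]; exists G.
split=> //; apply/cvgrPdist_le => e e0; have e3 : 0 < e / 3 by rewrite divr_gt0.
have [G tG FG] := approx _ e3; have [_ _ G_cvg] := tG.
have bFy := bmfun_seq_continuous F_bounded cF my.
have [A _ GA] := (cvgrPdist_le _ _).1 G_cvg _ e3; exists A => // n /GA Gn.
have bFx := bmfun_seq_continuous F_bounded cF (mx n).
by apply: dist_le_three Gn _; apply: expect_dist_le.
Qed.

Definition cosine (t : R * R * (nat -> R)) a : R := t.1.1 * cos (t.1.2 + \sum_(i < q) t.2 i * a i).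

Definition trigonometric F : Prop := exists ts : seq (R * R * (nat -> R)), forall a, F a = \sum_(t <- ts) cosine t a.

Lemma test_function_cosine t : test_function (cosine t).
Proof.
case: t => [[c phi] theta]; apply: (@test_functionZ c (fun a => cos (phi + \sum_(i < q) theta i * a i))); split.
- by exists 1 => a; exact: cos_max.
- move=> a_ a a_cvg; apply: continuous_cvg; first exact: continuous_cos.
  apply: cvgD; first exact: cvg_cst.
  apply: cvg_big => [|i _]; first exact: add_continuous.
  by apply: cvgM; [exact: cvg_cst|exact: a_cvg].
- exact: cos_cvg.
Qed.

Lemma trigonometric_test_function F : trigonometric F -> test_function F.
Proof.
move=> [ts Fts]; apply: (eq_test_function (fun a => esym (Fts a))) => {Fts}.
elim: ts => [|t ts ih].
  apply: eq_test_function (test_functionZ 0 (test_function_cosine (0, 0, fun=> 0))) => a.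
  by rewrite big_nil mul0r.
by apply: eq_test_function (test_functionD (test_function_cosine t) ih) => a; rewrite big_cons.
Qed.

Lemma trigonometricD F G : trigonometric F -> trigonometric G -> trigonometric (fun a => F a + G a).
Proof. by move=> [ts Fts] [us Gus]; exists (ts ++ us) => a; rewrite big_cat Fts Gus. Qed.

Lemma trigonometricZ c F : trigonometric F -> trigonometric (fun a => c * F a).
Proof.
move=> [ts Fts]; exists [seq (c * t.1.1, t.1.2, t.2) | t <- ts] => a.
by rewrite Fts big_map mulr_sumr; apply: eq_bigr => t _; rewrite /cosine /= mulrA.
Qed.

Lemma trigonometric1 : trigonometric (fun=> 1).
Proof.
exists [:: (1, 0, fun=> 0)] => a; rewrite big_seq1 /cosine /= big1 ?addr0 ?cos0 ?mulr1// => i _.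
by rewrite mul0r.
Qed.

Lemma sum_shift_frequency (i0 : 'I_q) (kap s : R) (theta a : nat -> R) :
  \sum_(i < q) (theta i + s * (kap * (i == i0 :> nat)%:R)) * a i = \sum_(i < q) theta i * a i + s * (kap * a i0).
Proof.
rewrite [in RHS](_ : s * (kap * a i0) = \sum_(i < q) s * (kap * (i == i0 :> nat)%:R) * a i); last first.
  rewrite (bigD1 i0)//= eqxx big1 ?addr0 ?mulr1 ?mulrA// => i /negbTE i_neq.
  by rewrite -[(i == i0 :> nat)]/(i == i0) i_neq !mulr0 mul0r.
by rewrite -big_split/=; apply: eq_bigr => i _; ring.
Qed.

(* [2 cos A sin B = cos (A + B - pi / 2) - cos (A - B - pi / 2)] *)
Lemma trigonometric_mul_sin (kap : R) (i0 : 'I_q) F : trigonometric F -> trigonometric (fun a => F a * sin (kap * a i0)).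
Proof.
move=> [ts Fts]; pose shift (s : R) (t : R * R * (nat -> R)) : R * R * (nat -> R) :=
  (s * t.1.1 / 2, t.1.2 - pi / 2, fun i => t.2 i + s * (kap * (i == i0 :> nat)%:R)).
exists ([seq shift 1 t | t <- ts] ++ [seq shift (-1) t | t <- ts]) => a.
rewrite Fts big_cat/= !big_map -big_split/= mulr_suml; apply: eq_bigr => -[[c phi] theta] _.
rewrite /cosine /shift /= !sum_shift_frequency; set A := \sum_(i < q) _; set B := kap * a i0.
have -> : phi - pi / 2 + (A + 1 * B) = (phi + A + B) - pi / 2 by ring.
have -> : phi - pi / 2 + (A + -1 * B) = (phi + A - B) - pi / 2 by ring.
by rewrite !cosBpihalf sinB sinD; field.
Qed.

Lemma test_function_binomial_mean (i0 : 'I_q) (kap : R) (f : (nat -> R) -> nat -> R) :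
  (forall l g, trigonometric g -> test_function (fun a => f a l * g a)) ->
  forall n k g, trigonometric g ->
  test_function (fun a => binomial_mean n (f a) ((1 + sin (kap * a i0)) / 2) k * g a).
Proof.
move=> tf; elim=> [|n ih] k g tg /=; first exact: tf.
have up : trigonometric (fun a => (1 + sin (kap * a i0)) / 2 * g a).
  have [ts tsE] := trigonometricZ 2^-1 (trigonometricD tg (trigonometric_mul_sin kap i0 tg)).
  by exists ts => a; rewrite -tsE; ring.
have down : trigonometric (fun a => (1 - (1 + sin (kap * a i0)) / 2) * g a).
  have [ts tsE] := trigonometricD tg (trigonometricZ (-1) up).
  by exists ts => a; rewrite -tsE; ring.
by apply: eq_test_function (test_functionD (ih k.+1 _ up) (ih k _ down)) => a; ring.
Qed.

Record bounded_lipschitz C L h : Prop := BoundedLipschitz {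
  bounded_lipschitz_ge0 : 0 <= L;
  bounded_lipschitz_norm : forall a, `|h a| <= C;
  bounded_lipschitz_dist : forall a b (delta : R), 0 <= delta ->
    (forall i, (i < q)%N -> `|a i - b i| <= delta) -> `|h a - h b| <= L * delta }.

(* A bounded substitute for the identity: [K sin (z / K)] tends to [z] as [K] tends to infinity. *)
Definition sine_clip K (j : nat) a (i : nat) : R := if (i < j)%N then K * sin (K^-1 * a i) else 0.

Definition set_coordinate a (j : nat) (v : R) (i : nat) : R := if i == j then v else a i.

Lemma bounded_lipschitz_set_coordinate C L h j v :
  bounded_lipschitz C L h -> bounded_lipschitz C L (fun a => h (set_coordinate a j v)).
Proof.
move=> [L0 hC hL]; split=> // a b delta delta0 ab; apply: hL => // i iq.
by rewrite /set_coordinate; case: eqP => _; [rewrite subrr normr0|exact: ab].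
Qed.

Lemma lipschitz_set_coordinate C L h a j (u v : R) : bounded_lipschitz C L h ->
  `|h (set_coordinate a j u) - h (set_coordinate a j v)| <= L * `|u - v|.
Proof.
move=> [L0 hC hL]; apply: hL => // i _; rewrite /set_coordinate.
by case: eqP => // _; rewrite subrr normr0.
Qed.

Lemma sine_clipS K j a : 0 < K ->
  sine_clip K j.+1 a = set_coordinate (sine_clip K j a) j (K * (2 * ((1 + sin (K^-1 * a j)) / 2) - 1)).
Proof.
move=> K0; apply/funext => i; rewrite /sine_clip /set_coordinate ltnS leq_eqVlt.
by case: eqP => [->|_]//=; congr (K * _); field.
Qed.

Lemma test_function_sine_clip K : 0 < K -> forall j, (j <= q)%N -> forall C L h, bounded_lipschitz C L h ->
  forall g, trigonometric g -> test_function (fun a => h (sine_clip K j a) * g a).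
Proof.
move=> K0; elim=> [|j ih] jq C L h lip_h g tg; have tg' := trigonometric_test_function tg.
  apply: eq_test_function (test_functionZ (h (fun=> 0)) tg') => a.
  by congr (h _ * _); exact/funext.
have [[D gD] _ _] := tg'; have D0 : 0 <= D := le_trans (normr_ge0 _) (gD (fun=> 0)).
pose i0 := Ordinal jq; have L0 := bounded_lipschitz_ge0 lip_h.
pose value a (v : R) := h (set_coordinate (sine_clip K j a) j (K * (2 * v - 1))).
pose Lam := 2 * L * K; have Lam0 : 0 <= Lam by rewrite !mulr_ge0// ltW.
have value_lip a u v : `|value a u - value a v| <= Lam * `|u - v|.
  apply: le_trans (lipschitz_set_coordinate _ _ _ _ lip_h) _.
  rewrite (_ : _ - _ = 2 * K * (u - v)); last by ring.
  by rewrite normrM (ger0_norm (_ : 0 <= 2 * K)) ?mulr_ge0 ?(ltW K0)// /Lam; lra.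
apply: test_function_unif => e e0; pose delta := e / (2 * Lam * D + 1).
have LamD0 : 0 < 2 * Lam * D + 1 by rewrite ltr_wpDl// mulr_ge0// mulr_ge0.
have delta0 : 0 < delta by rewrite divr_gt0.
have [n _ /(_ n (leqnn n)) n_delta] := near_natSinv_le (exprn_gt0 2 delta0).
exists (fun a => binomial_mean n.+1 (fun l => value a (l%:R / n.+1%:R)) ((1 + sin (K^-1 * a i0)) / 2) 0 * g a).
  apply: test_function_binomial_mean => // l g' tg''.
  exact: (ih (ltnW jq) C L _ (bounded_lipschitz_set_coordinate j _ lip_h)).
move=> a; set v := (1 + _) / 2; have v01 : 0 <= v <= 1.
  by rewrite /v; have := sin_geN1 (K^-1 * a i0); have := sin_le1 (K^-1 * a i0) => ? ?; apply/andP; split; lra.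
rewrite sine_clipS// -/(value a v) -mulrBl normrM distrC.
have bernstein := bernstein_dist Lam0 delta0 v01 (value_lip a) n_delta.
apply: le_trans (ler_pM _ _ bernstein (gD a)) _ => //.
rewrite mulrAC /delta mulrCA ler_piMr ?(ltW e0)// ler_pdivrMr// mul1r lerDl//.
Qed.

Lemma bounded_lipschitz_seq_continuous C L h : bounded_lipschitz C L h -> seq_continuous h.
Proof.
move=> [L0 hC hL] a_ a a_cvg; apply/cvgrPdist_le => e e0.
have L1 : 0 < L + 1 by rewrite ltr_wpDl.
have eL : 0 < e / (L + 1) by rewrite divr_gt0.
have [A _ aA] := near_forall_lt (fun i (_ : (i < q)%N) => (cvgrPdist_le _ _).1 (a_cvg i) _ eL).
exists A => // n /aA an; apply: le_trans (hL _ _ _ (ltW eL) an) _.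
by rewrite mulrA ler_pdivrMr// mulrC ler_pM2l// lerDl.
Qed.

Lemma sine_clip_dist K (z : R) : 0 < K -> `|z - K * sin (K^-1 * z)| <= 2 * z ^+ 2 / K.
Proof.
move=> K0; set u := K^-1 * z; have zE : z = K * u by rewrite /u mulrA divff ?mul1r// gt_eqF.
have u_le : `|u - sin u| <= 2 * u ^+ 2.
  rewrite -[u ^+ 2](real_normK (num_real _)); have u0 := normr_ge0 u; have u2 := sqr_ge0 `|u|.
  have [u1|u1] := leP `|u| 1; first by rewrite distrC (le_trans (norm_sinB_le u))// exprS; nra.
  by apply: le_trans (ler_normB _ _) _; have := norm_sin_le u; nra.
rewrite {1}zE -mulrBr normrM (gtr0_norm K0) [X in 2 * X ^+ 2]zE.
have -> : 2 * (K * u) ^+ 2 / K = K * (2 * u ^+ 2) by field; rewrite gt_eqF.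
by rewrite ler_pM2l.
Qed.

Lemma lipschitz_sine_clip_dist C L h K a : bounded_lipschitz C L h -> 0 < K ->
  `|h a - h (sine_clip K q a)| <= L * (\sum_(i < q) 2 * a i ^+ 2) * K^-1.
Proof.
move=> [L0 hC hL] K0; have a2 i : 0 <= 2 * a i ^+ 2 by rewrite mulr_ge0// sqr_ge0.
rewrite -mulrA; apply: hL => [|i iq]; first by rewrite mulr_ge0 ?sumr_ge0// invr_ge0 ltW.
rewrite /sine_clip iq (le_trans (sine_clip_dist _ K0))// ler_pM2r ?invr_gt0//.
by rewrite (bigD1 (Ordinal iq))//= lerDl sumr_ge0.
Qed.

Lemma expect_sine_clip_dist C L h K (B : R) n : bounded_lipschitz C L h -> 0 < K ->
  (forall i, (i < q)%N -> expect P (fun w => x n i w ^+ 2) <= B) ->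
  `|expect P (fun w => h (fun i => x n i w)) - expect P (fun w => h (sine_clip K q (fun i => x n i w)))|
  <= L * (q%:R * (2 * B)) * K^-1.
Proof.
move=> lip_h K0 xB; have L0 := bounded_lipschitz_ge0 lip_h.
have h_bounded : exists C, forall a, `|h a| <= C by exists C; exact: bounded_lipschitz_norm lip_h.
have bh := bmfun_seq_continuous h_bounded (bounded_lipschitz_seq_continuous lip_h) (mx n).
have t_clip : test_function (fun a => h (sine_clip K q a)).
  by apply: eq_test_function (test_function_sine_clip K0 (leqnn q) lip_h trigonometric1) => a; exact: mulr1.
have b_clip := test_function_bmfun n t_clip.
rewrite -expectB//; apply: (@le_trans _ _ (expect P (fun w => L * K^-1 * (\sum_(i < q) 2 * x n i w ^+ 2)))).
  apply: norm_expect_le => // w; rewrite mulrAC; exact: (lipschitz_sine_clip_dist _ lip_h).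
rewrite expectZ// expect_sum// [leRHS]mulrAC ler_wpM2l ?mulr_ge0 ?invr_ge0 ?(ltW K0)//.
rewrite mulr_natl -[q in leRHS]card_ord -sumr_const; apply: ler_sum => i _.
by rewrite expectZ// ler_pM2l// xB.
Qed.

Lemma bounded_lipschitz_cvg (B C L : R) h : (forall n i, (i < q)%N -> expect P (fun w => x n i w ^+ 2) <= B) ->
  bounded_lipschitz C L h ->
  expect P (fun w => h (fun i => x n i w)) @[n --> \oo] --> expect P' (fun w => h (fun i => y i w)).
Proof.
move=> xB lip_h; have h_bounded : exists C, forall a, `|h a| <= C.
  by exists C; exact: bounded_lipschitz_norm lip_h.
have bh := bmfun_seq_continuous h_bounded (bounded_lipschitz_seq_continuous lip_h) my.
have t_clip K : 0 < K -> test_function (fun a => h (sine_clip K q a)).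
  move=> K0; apply: eq_test_function (test_function_sine_clip K0 (leqnn q) lip_h trigonometric1) => a.
  exact: mulr1.
have clip_cvg a : h (sine_clip K.+1%:R q a) @[K --> \oo] --> h a.
  pose D := L * (\sum_(i < q) 2 * a i ^+ 2).
  have upper : D * harmonic K @[K --> \oo] --> 0.
    by rewrite -[X in _ --> X](mulr0 D); apply: cvgM; [exact: cvg_cst|exact: cvg_harmonic].
  apply/subr_cvg0/norm_cvg0P; apply: (squeeze_cvgr _ (@cvg_cst _ 0 _ \oo _) upper); apply: nearW => K.
  by rewrite normr_ge0/= distrC (lipschitz_sine_clip_dist _ lip_h)// ltr0Sn.
have limit_clip_cvg : expect P' (fun w => h (sine_clip K.+1%:R q (fun i => y i w))) @[K --> \oo] -->
    expect P' (fun w => h (fun i => y i w)).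
  apply: (@bounded_convergence _ _ _ _ _ _ C) => [K||K w|].
  - exact: bmfun_measurable (test_function_limit_bmfun (t_clip _ (ltr0Sn R K))).
  - exact: bmfun_measurable.
  - exact: bounded_lipschitz_norm lip_h _.
  - by apply: aeW => w; exact: clip_cvg.
apply/cvgrPdist_le => e e0; have e3 : 0 < e / 3 by rewrite divr_gt0.
have [K1 _ limK1] := (cvgrPdist_le _ _).1 limit_clip_cvg _ e3.
pose D := L * (q%:R * (2 * B)); have D0 : 0 < `|D| + 1 by rewrite ltr_wpDl.
have [K2 _ invK2] := near_natSinv_le (divr_gt0 e3 D0).
pose K := maxn K1 K2; have K0 : (0 : R) < K.+1%:R by rewrite ltr0n.
have [_ _ clipK_cvg] := t_clip _ K0.
have [A _ clipA] := (cvgrPdist_le _ _).1 clipK_cvg _ e3; exists A => // n /clipA clipn.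
apply: dist_le_three (limK1 K (leq_maxl _ _)) clipn _.
apply: le_trans (expect_sine_clip_dist lip_h K0 (xB n)) _; rewrite -/D.
have := invK2 K (leq_maxr _ _); rewrite /= ler_pdivlMr// mulrC; apply: le_trans.
by rewrite ler_wpM2r ?invr_ge0// (le_trans (ler_norm D))// lerDl.
Qed.

End lipschitz_test_functions.

(** * Tightness *)

(* Summation by parts, as in the Hajek-Renyi inequality. *)
Lemma increment_le_weighted {R : realType} (c x y : nat -> R) (B : R) k K : (k <= K)%N ->
  (forall j, 0 < c j) -> (forall j, c j <= c j.+1) ->
  (forall j, y j.+1 - y j = c j * (x j.+1 - x j)) ->
  (forall j, (k <= j <= K)%N -> `|y j - y k| <= B) -> c k * `|x K - x k| <= B.
Proof.
move=> kK c0 c_nd yE y_le; have cV j : (c j.+1)^-1 <= (c j)^-1 by rewrite lef_pV2 ?posrE.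
have defect j : (k <= j)%N -> (j <= K)%N ->
    `|(x j - x k) - (y j - y k) / c j| <= B * ((c k)^-1 - (c j)^-1).
  move: j; apply: nat_ind_ge => [_|j kj ih jK]; first by rewrite !subrr mul0r subrr mulr0 normr0.
  have -> : (x j.+1 - x k) - (y j.+1 - y k) / c j.+1 =
      ((x j - x k) - (y j - y k) / c j) + (y j.+1 - y k) * ((c j)^-1 - (c j.+1)^-1).
    have -> : x j.+1 = x j + (y j.+1 - y j) / c j by rewrite yE mulrC mulKf ?gt_eqF//; ring.
    by ring.
  apply: le_trans (ler_normD _ _) _.
  rewrite [leRHS](_ : _ = B * ((c k)^-1 - (c j)^-1) + B * ((c j)^-1 - (c j.+1)^-1)); last by ring.
  rewrite lerD ?ih ?(ltnW jK)// normrM (ger0_norm (_ : 0 <= (c j)^-1 - (c j.+1)^-1)) ?subr_ge0//.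
  by rewrite ler_wpM2r ?subr_ge0// y_le// jK leqW.
have y_last : `|(y K - y k) / c K| <= B / c K.
  by rewrite normrM normfV (gtr0_norm (c0 K)) ler_pM2r ?invr_gt0// y_le// kK leqnn.
rewrite mulrC -ler_pdivlMr// -(subrK ((y K - y k) / c K) (x K - x k)).
apply: le_trans (ler_normD _ _) _; apply: le_trans (lerD (defect K kK (leqnn K)) y_last) _.
by rewrite -mulrDr subrK.
Qed.

Section tightness.
Context {R : realType} {d : measure_display} {Om : measurableType d}.
Context (P : probability Om R) (F : nat -> set (set Om)) (M v : nat -> Om -> R) (r : nat -> R).
Context (N : nat) (g c : R) (Minf : Om -> R).
Hypothesis reinfM : reinforced_martingale P F M v r N g c Minf.
Let p := 2 * g - 1.

Let reg := reinforced_regular reinfM.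
Let martM := reinforced_controlled reinfM.
Let bM := martingale_bmfun martM.
Let bMinf := limit_bmfun reinfM.
#[local] Hint Resolve bM bMinf : bmfun.

Let p0 : 0 < p. Proof. by have /andP[] := tail_exponent_range reg. Qed.
Let p01 : 0 < p <= 1. Proof. exact: tail_exponent_range reg. Qed.

Local Notation fluct := (fluctuation M g Minf).
Local Notation amp := (amplitude g).
Implicit Types (n m k K : nat) (t eta e delta T : R) (w : Om).

Lemma amplitude_gt0 n : (0 < n)%N -> 0 < amp n.
Proof. by move=> n0; rewrite powR_gt0// ltr0n. Qed.

Lemma expect_sqr_mul_limit_le (a : R) n :
  expect P (fun w => (a * (Minf w - M n w)) ^+ 2) <= a ^+ 2 * sqr_tail r n.
Proof.
under eq_expect do rewrite exprMn.
by rewrite expectZ// ler_wpM2l ?sqr_ge0// (expect_sqr_limit_le reinfM).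
Qed.

Let weight k : R := k.+1%:R `^ p.

Let weight_gt0 k : 0 < weight k. Proof. by rewrite powR_gt0// ltr0n. Qed.

Lemma weight_nd j k : (j <= k)%N -> weight j <= weight k.
Proof. by move=> jk; rewrite le_powR_base ?(ltW p0)// ler_nat. Qed.

Lemma norm_fluctuation_le_weight n t w : (0 < n)%N -> 0 <= t ->
  amp n * `|fluct n t w| <= weight (truncn (n%:R * t)) * `|M (truncn (n%:R * t)) w - Minf w|.
Proof.
move=> n0 t0; rewrite /fluctuation 2!normrM (ger0_norm (powR_ge0 _ _)) (ger0_norm (amplitude_ge0 _ _)) -/p !mulrA.
rewrite ler_wpM2r// mulrAC -expr2 sqr_amplitude -powRM//.
by apply: le_powR_base; rewrite ?(ltW p0) ?mulr_ge0// ltW// truncnS_gt.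
Qed.

Lemma weighted_dist_limit_le (a : R) K k w : (k <= K)%N ->
  (forall j, (j <= K)%N -> `|mtransform M weight 0 j w| < a / 4) ->
  `|weight K * (Minf w - M K w)| <= a / 2 -> weight k * `|M k w - Minf w| <= a.
Proof.
move=> kK mart_le limit_le; have incr_le : weight k * `|M K w - M k w| <= a / 2.
  apply: (@increment_le_weighted _ weight (fun j => M j w) (fun j => mtransform M weight 0 j w)) => // [j|j|j].
  - exact: weight_nd.
  - by rewrite mtransformS//; ring.
  - move=> /andP[kj jK]; apply: le_trans (ler_normB _ _) _.
    by have := mart_le j jK; have := mart_le k kK; lra.
have {}limit_le : weight k * `|Minf w - M K w| <= a / 2.
  apply: le_trans limit_le; rewrite normrM (gtr0_norm (weight_gt0 K)) ler_wpM2r//.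
  exact: weight_nd.
have := ler_distD (M K w) (Minf w) (M k w); rewrite distrC => /(ler_wpM2l (ltW (weight_gt0 k))).
by rewrite mulrDr; lra.
Qed.

Lemma weighted_martingale_small eta : 0 < eta -> exists2 A : R, 0 < A &
  forall n K (y : R), (0 < n)%N -> 0 <= y -> K%:R `^ p <= n%:R `^ p * y ->
  except_prob P (A * y ^+ 2) (fun w => forall k, (k <= K)%N -> `|mtransform M weight 0 k w| < amp n * eta / 4).
Proof.
move=> eta0; have [C C0 qC] := sum_weighted_sqr_steps_le reg.
exists (11 * C ^+ 2 * 4 ^+ 4 / eta ^+ 4) => [|n K y n0 y0 Ky]; first by rewrite divr_gt0 ?mulr_gt0 ?exprn_gt0.
have a0 := amplitude_gt0 n0.
apply: (mtransform_maximal martM) => //; first by rewrite divr_gt0 ?mulr_gt0.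
have amp4 : amp n ^+ 4 = (n%:R `^ p) ^+ 2 by rewrite -sqr_amplitude -exprM.
rewrite (_ : _ * (amp n * eta / 4) ^+ 4 = 11 * (C * (n%:R `^ p * y)) ^+ 2); last first.
  by rewrite !exprMn amp4; field; rewrite gt_eqF.
have q_le : qvar r weight 0 K <= C * (n%:R `^ p * y) by rewrite (le_trans (qC K))// ler_pM2l.
by rewrite ler_pM2l//; apply: lerXn2r; rewrite ?nnegrE ?qvar_ge0 ?mulr_ge0 ?powR_ge0 ?(ltW C0).
Qed.

Lemma weighted_limit_small eta : 0 < eta -> exists2 A : R, 0 < A &
  forall n K (y : R), (0 < n)%N -> K.+1%:R `^ p <= n%:R `^ p * y ->
  except_prob P (A * y) (fun w => `|weight K * (Minf w - M K w)| <= amp n * eta / 2).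
Proof.
move=> eta0; have [C C0 tailC] := sqr_tail_bound reg.
exists (C * 2 ^+ 2 / eta ^+ 2) => [|n K y n0 Ky]; first by rewrite divr_gt0 ?mulr_gt0 ?exprn_gt0.
have a0 := amplitude_gt0 n0; apply: except_prob_sqr => //; first by rewrite divr_gt0 ?mulr_gt0.
apply: le_trans (expect_sqr_mul_limit_le _ _) _.
apply: le_trans (ler_wpM2l (sqr_ge0 _) (tailC K)) _.
rewrite (_ : _ * (amp n * eta / 2) ^+ 2 = C * (n%:R `^ p * y)); last first.
  by rewrite !exprMn sqr_amplitude -/p; field; rewrite gt_eqF.
have -> : weight K ^+ 2 * (C * K.+1%:R `^ (- (2 * g - 1))) = C * K.+1%:R `^ p.
  by rewrite powRN -/p -/(weight K); field; rewrite gt_eqF.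
by rewrite ler_pM2l.
Qed.

Lemma fluctuation_small_times eta e : 0 < eta -> 0 < e -> exists2 delta : R, 0 < delta &
  \forall n \near \oo, except_prob P e (fun w => forall t, 0 <= t <= delta -> `|fluct n t w| <= eta).
Proof.
move=> eta0 e0; have [A1 A10 martS] := weighted_martingale_small eta0.
have [A2 A20 limitS] := weighted_limit_small eta0; have A0 := addr_gt0 A10 A20.
pose y := minr 1 (e / (A1 + A2)).
have y0 : 0 < y by rewrite lt_min ltr01 divr_gt0.
have y_le : A1 * y ^+ 2 + A2 * y <= e.
  have y1 : y <= 1 by rewrite ge_min lexx.
  apply: (@le_trans _ _ ((A1 + A2) * y)); last by rewrite mulrC -ler_pdivlMr// ge_min lexx orbT.
  by rewrite mulrDl lerD2r expr2 mulrA ler_piMr// mulr_ge0// ltW.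
pose delta := y `^ p^-1 / 3; have delta0 : 0 < delta by rewrite divr_gt0 ?powR_gt0.
exists delta => //; near=> n.
have nR : (0 : R) < n%:R by rewrite ltr0n; near: n; exact: nbhs_infty_gt.
have n0 : (0 < n)%N by rewrite -(ltr0n R).
have n_delta : 1 <= n%:R * delta.
  by rewrite -ler_pdivrMr// div1r; near: n; exact: nbhs_infty_ger.
set K := (truncn (n%:R * delta)).+1.
have K_le : K.+1%:R <= n%:R * (3 * delta).
  have : (truncn (n%:R * delta))%:R <= n%:R * delta by rewrite truncn_le// mulr_ge0 ?ltW.
  by rewrite /K -natr1 -natr1; lra.
have Ky : K.+1%:R `^ p <= n%:R `^ p * y.
  have yE : y = (3 * delta) `^ p.
    by rewrite (_ : 3 * delta = y `^ p^-1) /delta; [rewrite -powRrM mulVf ?powRr1 ?(ltW y0)// gt_eqF|lra].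
  have d3 : 0 <= 3 * delta by rewrite mulr_ge0// ltW.
  by rewrite yE -powRM ?(ltW nR)//; apply: le_powR_base => //; exact: ltW.
have Ky' : K%:R `^ p <= n%:R `^ p * y.
  by apply: le_trans Ky; rewrite le_powR_base ?(ltW p0)// ler_nat.
apply: except_probS y_le _ (except_prob_and (martS n K y n0 (ltW y0) Ky') (limitS n K y n0 Ky)).
move=> w [mart_le limit_le] t /andP[t0 t_delta]; rewrite -(ler_pM2l (amplitude_gt0 n0)).
apply: le_trans (norm_fluctuation_le_weight _ n0 t0) _.
apply: weighted_dist_limit_le mart_le limit_le.
by apply/leqW/le_truncn; rewrite ler_pM2l.
Unshelve. all: by end_near. Qed.

Section time_cell.
Variables (delta T C1 C2 l : R) (m n j : nat).
Hypothesis delta_gt0 : 0 < delta.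
Hypothesis C1_ge0 : 0 <= C1.
Hypothesis step_le : forall n k, (0 < n)%N -> (truncn (n%:R * delta) <= k)%N -> n%:R `^ p * r k ^+ 2 <= C1 / n%:R.
Hypothesis tail_le : n%:R `^ p * sqr_tail r (truncn (n%:R * delta)) <= C2.
Hypothesis l_gt0 : 0 < l.
Hypothesis m_gt0 : (0 < m)%N.
Hypothesis mn : (m <= n)%N.
Hypothesis cell_ge : delta <= j%:R / m%:R.

Let mR : (0 : R) < m%:R. Proof. by rewrite ltr0n. Qed.
Let n_gt0 : (0 < n)%N. Proof. exact: leq_trans mn. Qed.
Let nR : (0 : R) < n%:R. Proof. by rewrite ltr0n. Qed.

Let start := truncn (n%:R * (j%:R / m%:R) : R).
Let stop := truncn (n%:R * (j.+1%:R / m%:R) : R).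
Let lip := p * delta `^ (p - 1).

Lemma start_ge : (truncn (n%:R * delta) <= start)%N.
Proof. by apply: le_truncn; rewrite ler_pM2l. Qed.

Lemma start_le_stop : (start <= stop)%N.
Proof. by apply: le_truncn; rewrite ler_pM2l// ler_pM2r ?invr_gt0// ler_nat. Qed.

Lemma cell_length_le : (stop - start)%:R <= 2 * n%:R / m%:R :> R.
Proof.
rewrite natrB ?start_le_stop//.
have stop_le : stop%:R <= n%:R * (j.+1%:R / m%:R) :> R by rewrite truncn_le// mulr_ge0 ?divr_ge0.
have := truncnS_gt (n%:R * (j%:R / m%:R) : R); rewrite -/start -natr1 => start_gt.
have cellE : n%:R * (j.+1%:R / m%:R) = n%:R * (j%:R / m%:R) + n%:R / m%:R :> R by rewrite -natr1; ring.
have : 1 <= (n%:R : R) / m%:R by rewrite ler_pdivlMr// mul1r ler_nat.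
by rewrite -mulrA; lra.
Qed.

Lemma qvar_cell_le : qvar r (fun=> amp n) start stop <= 2 * C1 / m%:R.
Proof.
apply: (@le_trans _ _ (\sum_(start <= k < stop) C1 / n%:R)).
  rewrite /qvar big_nat [leRHS]big_nat; apply: ler_sum => k /andP[ak _].
  by rewrite exprMn sqr_amplitude; apply: step_le => //; exact: leq_trans start_ge ak.
rewrite sumr_const_nat -[leLHS]mulr_natr.
apply: le_trans (ler_wpM2l _ cell_length_le) _; first by rewrite divr_ge0.
by rewrite le_eqVlt; apply/orP; left; apply/eqP; field; rewrite (gt_eqF mR) (gt_eqF nR).
Qed.

Lemma cell_increments_small : except_prob P (11 * (2 * C1) ^+ 2 / l ^+ 4 / m%:R ^+ 2)
  (fun w => forall k, (k <= stop)%N -> `|mtransform M (fun=> amp n) start k w| < l).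
Proof.
apply: (mtransform_maximal martM) => //; first exact: start_le_stop.
rewrite (_ : _ * l ^+ 4 = 11 * (2 * C1 / m%:R) ^+ 2); last by field; rewrite (gt_eqF l_gt0) (gt_eqF mR).
by rewrite ler_pM2l//; apply: lerXn2r; rewrite ?nnegrE ?qvar_ge0 ?divr_ge0 ?mulr_ge0// qvar_cell_le.
Qed.

Lemma cell_limit_small eta : 0 < eta -> except_prob P (lip ^+ 2 * C2 / eta ^+ 2 / m%:R ^+ 2)
  (fun w => `|lip / m%:R * amp n * (Minf w - M start w)| <= eta).
Proof.
move=> eta0; apply: except_prob_sqr => //; apply: le_trans (expect_sqr_mul_limit_le _ _) _.
rewrite (_ : _ * eta ^+ 2 = (lip / m%:R) ^+ 2 * C2); last by field; rewrite (gt_eqF eta0) (gt_eqF mR).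
rewrite exprMn sqr_amplitude -mulrA ler_wpM2l ?sqr_ge0//; apply: le_trans tail_le.
by rewrite ler_wpM2l ?powR_ge0// sqr_tail_nincr ?start_ge//; exact: reg.
Qed.

Lemma fluctuation_cell_dist eta t w : (T `^ p + 1) * l <= eta ->
  (forall k, (k <= stop)%N -> `|mtransform M (fun=> amp n) start k w| < l) ->
  `|lip / m%:R * amp n * (Minf w - M start w)| <= eta -> t <= T -> truncn (m%:R * t) = j -> 0 <= t ->
  `|fluct n t w - fluct n (j%:R / m%:R) w| <= 2 * eta.
Proof.
move=> l_le mart_le limit_le tT tj t0.
have jt : j%:R / m%:R <= t by rewrite ler_pdivrMr// mulrC -tj truncn_le// mulr_ge0.
have tjS : t <= j.+1%:R / m%:R by rewrite ler_pdivlMr// mulrC -tj ltW// truncnS_gt.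
set k := truncn (n%:R * t).
have start_k : (start <= k)%N by apply: le_truncn; rewrite ler_pM2l.
have k_stop : (k <= stop)%N by apply: le_truncn; rewrite ler_pM2l.
have incr_le : amp n * `|M k w - M start w| <= l.
  have := mart_le k k_stop; rewrite (mtransform_cst _ _ _ start_k) normrM (ger0_norm (amplitude_ge0 _ _)).
  exact: ltW.
have powR_le : `|t `^ p - (j%:R / m%:R) `^ p| <= lip / m%:R.
  apply: le_trans (powR_lipschitz p01 delta_gt0 cell_ge jt) _; rewrite ler_wpM2l//.
    by rewrite mulr_ge0 ?powR_ge0 ?(ltW p0).
  by have : j.+1%:R / m%:R = j%:R / m%:R + m%:R^-1 :> R; [rewrite -natr1; ring|lra].
rewrite /fluctuation -/p -/k -/start.
rewrite (_ : _ - _ = t `^ p * (amp n * (M k w - M start w)) -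
   (t `^ p - (j%:R / m%:R) `^ p) * (amp n * (Minf w - M start w))); last by ring.
have -> : 2 * eta = eta + eta by ring.
apply: le_trans (ler_normB _ _) _; apply: lerD.
  rewrite normrM (ger0_norm (powR_ge0 _ _)) normrM (ger0_norm (amplitude_ge0 _ _)).
  apply: le_trans l_le; apply: ler_pM; rewrite ?powR_ge0 ?mulr_ge0 ?amplitude_ge0//.
  by rewrite (le_trans (le_powR_base (ltW p0) t0 tT))// lerDl.
apply: le_trans limit_le; rewrite -mulrA normrM [leRHS]normrM ler_wpM2r//.
by rewrite (le_trans powR_le)// ler_norm.
Qed.

End time_cell.

Definition cell_error delta T eta C1 C2 : R :=
  11 * (2 * C1) ^+ 2 / (eta / (T `^ p + 1)) ^+ 4 + (p * delta `^ (p - 1)) ^+ 2 * C2 / eta ^+ 2.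

Lemma cell_error_ge0 delta T eta C1 C2 : 0 <= C2 -> 0 <= cell_error delta T eta C1 C2.
Proof.
move=> C20; apply: addr_ge0; apply: divr_ge0; last exact: sqr_ge0.
- by apply: mulr_ge0 => //; exact: sqr_ge0.
- by rewrite exprn_even_ge0.
- by apply: mulr_ge0 => //; exact: sqr_ge0.
Qed.

Lemma fluctuation_cell_small delta T eta C1 C2 m n j : 0 < delta -> 0 < T -> 0 < eta -> 0 <= C1 -> 0 <= C2 ->
  (forall n k, (0 < n)%N -> (truncn (n%:R * delta) <= k)%N -> n%:R `^ p * r k ^+ 2 <= C1 / n%:R) ->
  n%:R `^ p * sqr_tail r (truncn (n%:R * delta)) <= C2 ->
  (0 < m)%N -> 1 <= m%:R * delta -> (m <= n)%N ->
  except_prob P (cell_error delta T eta C1 C2 / m%:R ^+ 2) (fun w => forall t, 2 * delta <= t <= T -> truncn (m%:R * t) = j ->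
    `|fluct n t w - fluct n (grid_floor m t) w| <= 2 * eta).
Proof.
move=> delta0 T0 eta0 C10 C20 step_le tail_le m0 m_delta mn.
have T1 : 0 < T `^ p + 1 by rewrite ltr_pwDr ?powR_ge0.
have l0 : 0 < eta / (T `^ p + 1) by rewrite divr_gt0.
have mR : (0 : R) < m%:R by rewrite ltr0n.
have [j_lt|j_ge] := ltP (j%:R / m%:R) delta.
  exists set0; split=> //; first by rewrite measure0 divr_ge0 ?cell_error_ge0 ?sqr_ge0.
  move=> w _ t /andP[t_ge _] tj; exfalso; have := truncnS_gt (m%:R * t); rewrite tj -natr1.
  move: j_lt; rewrite ltr_pdivrMr// => j_lt; have : m%:R * (2 * delta) <= m%:R * t by rewrite ler_pM2l.
  lra.
apply: except_probS (except_prob_and (cell_increments_small C10 step_le l0 m0 mn j_ge)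
  (cell_limit_small tail_le m0 mn j_ge eta0)); first by rewrite -mulrDl.
move=> w [mart_le limit_le] t /andP[t_ge tT] tj; rewrite /grid_floor tj.
apply: (fluctuation_cell_dist delta0 m0 mn j_ge _ mart_le limit_le tT tj).
  by rewrite mulrC divfK ?gt_eqF.
by apply: le_trans t_ge; rewrite mulr_ge0// ltW.
Qed.

Lemma fluctuation_grid_large_times delta eta e T : 0 < delta -> 0 < eta -> 0 < e -> 0 < T -> exists m0 : nat,
  forall m, (m0 <= m)%N -> \forall n \near \oo, except_prob P e (fun w => forall t, 2 * delta <= t <= T ->
    `|fluct n t w - fluct n (grid_floor m t) w| <= 2 * eta).
Proof.
move=> delta0 eta0 e0 T0; have [C1 C10 step_le] := sqr_steps_truncn_le reg delta0.
have tail_cvg := sqr_tail_truncn_cvg reg delta0.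
have [C2 C20 tail_le] := cvgn_bounded tail_cvg.
pose D := cell_error delta T eta C1 C2; have D0 : 0 <= D by rewrite cell_error_ge0// ltW.
exists (maxn (truncn delta^-1).+1 (truncn (D * (T + 1) / e)).+1) => m; rewrite geq_max => /andP[m_delta m_e].
have m0 : (0 < m)%N by exact: leq_ltn_trans m_delta.
have mR : (0 : R) < m%:R by rewrite ltr0n.
have {}m_delta : 1 <= m%:R * delta.
  by rewrite -ler_pdivrMr// div1r (le_trans (ltW (truncnS_gt _)))// ler_nat.
have {}m_e : D * (T + 1) / m%:R <= e.
  rewrite ler_pdivrMr// [leRHS]mulrC -ler_pdivrMr// (le_trans (ltW (truncnS_gt _)))// ler_nat//.
exists m => // n /= mn; set J := (truncn (m%:R * T)).+1.
have J_le : J%:R <= m%:R * (T + 1).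
  have : (truncn (m%:R * T))%:R <= m%:R * T by rewrite truncn_le// mulr_ge0 ?ltW.
  by have : (1 : R) <= m%:R; [rewrite ler1n|rewrite /J -natr1 mulrDr; lra].
have Dm : 0 <= D / m%:R ^+ 2 by rewrite divr_ge0 ?exprn_ge0.
apply: except_probS (except_prob_forall Dm (fun j _ => @fluctuation_cell_small delta T eta C1 C2 m n j
  delta0 T0 eta0 (ltW C10) (ltW C20) step_le (tail_le n) m0 m_delta mn)).
  apply: le_trans m_e; apply: le_trans (ler_wpM2r Dm J_le) _.
  by rewrite le_eqVlt; apply/orP; left; apply/eqP; field; rewrite gt_eqF.
move=> w cells t /andP[t_ge tT]; apply: (cells (truncn (m%:R * t))) => //; last by rewrite t_ge.
by rewrite ltnS; apply: le_truncn; rewrite ler_pM2l.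
Qed.

Lemma fluctuation_tight eta e T : 0 < eta -> 0 < e -> 0 < T -> exists m0 : nat,
  forall m, (m0 <= m)%N -> \forall n \near \oo, except_prob P e (fun w => forall t, 0 <= t <= T ->
    `|fluct n t w - fluct n (grid_floor m t) w| <= eta).
Proof.
move=> eta0 e0 T0; have eta2 : 0 < eta / 2 by rewrite divr_gt0.
have e2 : 0 < e / 2 by rewrite divr_gt0.
have [delta delta0 small] := fluctuation_small_times eta2 e2.
have delta2 : 0 < delta / 2 by rewrite divr_gt0.
have [m0 large] := fluctuation_grid_large_times delta2 eta2 e2 T0.
exists m0 => m mm; have {}large := large m mm.
near=> n; have smalln : except_prob P (e / 2) (fun w => forall t, 0 <= t <= delta -> `|fluct n t w| <= eta / 2).
  by near: n.
have largen : except_prob P (e / 2) (fun w => forall t, 2 * (delta / 2) <= t <= T ->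
    `|fluct n t w - fluct n (grid_floor m t) w| <= 2 * (eta / 2)) by near: n.
apply: except_probS (except_prob_and smalln largen); first by lra.
move=> w [small_w large_w] t /andP[t0 tT]; have [t_delta|/ltW delta_t] := leP t delta; last first.
  by have := large_w t; rewrite tT andbT !(mulrC 2) !divfK//; apply.
apply: le_trans (ler_normB _ _) _; rewrite [leRHS]splitr lerD ?small_w ?t0// grid_floor_ge0.
exact: le_trans (grid_floor_le _ t0) t_delta.
Unshelve. all: by end_near. Qed.

End tightness.

(** * Paths *)

Section paths.
Context {R : realType}.
Implicit Types (x y : R -> R) (t s e T v : R) (a : nat -> R).

Lemma halfline_continuous_right y t : halfline_continuous y -> 0 <= t -> y s @[s --> t^'+] --> y t.
Proof.
move=> /halfline_continuousP cy t0; apply/cvgrPdist_le => e e0; have [delta delta0 near_t] := cy t e t0 e0.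
near=> s; have ts : t < s by near: s; exact: nbhs_right_gt.
rewrite distrC; apply: near_t; first by rewrite ltW// (le_lt_trans t0).
rewrite gtr0_norm ?subr_gt0// ltrBlDl.
by near: s; apply: nbhs_right_lt; rewrite ltrDl.
Unshelve. all: by end_near. Qed.

Lemma halfline_continuous_left y t : halfline_continuous y -> 0 < t -> y s @[s --> t^'-] --> y t.
Proof.
move=> /halfline_continuousP cy t0; apply/cvgrPdist_le => e e0; have [delta delta0 near_t] := cy t e (ltW t0) e0.
near=> s; have ts : s < t by near: s; exact: nbhs_left_lt.
rewrite distrC; apply: near_t; first by near: s; apply: nbhs_left_ge.
rewrite ltr0_norm ?subr_lt0// opprB ltrBlDl -ltrBlDr.
by near: s; apply: nbhs_left_gt; rewrite ltrBlDr ltrDl.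
Unshelve. all: by end_near. Qed.

Lemma halfline_continuous_bounded y T : halfline_continuous y ->
  exists2 B : R, 0 < B & forall t, 0 <= t <= T -> `|y t| <= B.
Proof.
move=> cy; have [T0|T0] := leP 0 T; last first.
  by exists 1 => // t /andP[t0 tT]; have := le_trans t0 tT; rewrite leNgt T0.
have cyT : {within `[0, T]%classic, continuous y}.
  by apply: continuous_subspaceW cy => s /=; rewrite !in_itv/= => /andP[->].
have cy_norm : {within `[0, T]%classic, continuous (fun t => `|y t|)}.
  by move=> t; apply: cvg_norm; exact: cyT.
have [t _ t_max] := EVT_max T0 cy_norm.
exists (`|y t| + 1) => [|s s0T]; first by rewrite ltr_wpDl.
by rewrite (le_trans (t_max s _))// lerDl.
Qed.

Lemma truncn_right v t : 0 <= v -> 0 <= t -> \forall s \near t^'+, truncn (v * s) = truncn (v * t).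
Proof.
rewrite le_eqVlt => /predU1P[<- _|v0 t0]; first by apply: nearW => s; rewrite !mul0r.
have vt := truncnS_gt (v * t); near=> s.
have ts : t < s by near: s; exact: nbhs_right_gt.
apply: truncn_def; apply/andP; split.
  by rewrite (@le_trans _ _ (v * t)) ?ler_pM2l ?(ltW ts)// truncn_le// mulr_ge0// ltW.
rewrite mulrC -ltr_pdivlMr//.
by near: s; apply: nbhs_right_lt; rewrite ltr_pdivlMr// mulrC.
Unshelve. all: by end_near. Qed.

Lemma truncn_left v t : 0 <= v -> 0 < t -> exists k : nat, \forall s \near t^'-, truncn (v * s) = k.
Proof.
rewrite le_eqVlt => /predU1P[<- _|v0 t0]; first by exists 0%N; apply: nearW => s; rewrite mul0r truncn0.
have vt : 0 < v * t by rewrite mulr_gt0.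
have [k /andP[k_lt k_ge]] : exists k : nat, k%:R < v * t <= k.+1%:R.
  have /andP[le_vt lt_vt] := truncn_itv (ltW vt).
  have [vtE|vt_neq] := eqVneq (truncn (v * t))%:R (v * t); last first.
    by exists (truncn (v * t)); rewrite lt_neqAle vt_neq le_vt ltW.
  case: (truncn (v * t)) vtE => [|k] vtE; first by rewrite -vtE ltxx in vt.
  by exists k; rewrite -vtE lexx ltr_nat ltnSn.
exists k; near=> s.
have st : s < t by near: s; exact: nbhs_left_lt.
apply: truncn_def; rewrite (lt_le_trans _ k_ge) ?ltr_pM2l// andbT -ler_pdivrMl// mulrC ltW//.
by near: s; apply: nbhs_left_gt; rewrite ltr_pdivrMr// mulrC.
Unshelve. all: by end_near. Qed.

Definition step_path y v a t : R := if t < 0 then 0 else y t * a (truncn (v * t)).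

Lemma cadlag_step_path y v a : halfline_continuous y -> 0 <= v -> cadlag (step_path y v a).
Proof.
move=> cy v0; split; [by move=> t t0; rewrite /step_path t0|split=> t t0].
- rewrite [X in _ --> X]/step_path ltNge t0 /=.
  apply: cvg_trans (cvgM (halfline_continuous_right cy t0) (@cvg_cst _ (a (truncn (v * t))) _ _ _)).
  apply: near_eq_cvg; near=> s; have ts : t < s by near: s; exact: nbhs_right_gt.
  rewrite /step_path ltNge ltW ?(le_lt_trans t0)//=; congr (_ * a _); apply/esym.
  by near: s; exact: truncn_right.
- have [k near_k] := truncn_left v0 t0; exists (y t * a k).
  apply: cvg_trans (cvgM (halfline_continuous_left cy t0) (@cvg_cst _ (a k) _ _ _)).
  apply: near_eq_cvg; near=> s; have s0 : 0 < s by near: s; exact: nbhs_left_gt.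
  rewrite /step_path ltNge ltW//=; congr (_ * a _); apply/esym.
  by near: s.
Unshelve. all: by end_near. Qed.

Definition extend0 y t : R := if t < 0 then 0 else y t.

Lemma cadlag_extend0 y : halfline_continuous y -> cadlag (extend0 y).
Proof.
move=> cy; have := @cadlag_step_path y 0 (fun=> 1) cy (lexx 0); congr cadlag.
by apply/funext => t; rewrite /step_path /extend0 mulr1.
Qed.

Definition locally_uniform_cvg (xs : nat -> R -> R) y : Prop := forall T e, 0 < T -> 0 < e ->
  \forall k \near \oo, forall t, 0 <= t <= T -> `|xs k t - y t| <= e.

Definition path_functional (F : (R -> R) -> R) (B : R) : Prop :=
  (forall x, cadlag x -> `|F x| <= B) /\
  forall xs y, (forall k, cadlag (xs k)) -> cadlag y -> locally_uniform_cvg xs y -> F (xs k) @[k --> \oo] --> F y.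

Lemma path_functionalN F B : path_functional F B -> path_functional (fun x => - F x) B.
Proof.
move=> [FB cF]; split=> [x cx|xs y cxs cy xs_cvg]; first by rewrite normrN; exact: FB.
by apply: cvgN; exact: cF.
Qed.

Lemma skorohod_path_functional f : skorohod_bcont f -> exists B, path_functional f B.
Proof.
move=> [[B fB] cf]; exists B; split=> // xs y cxs cy xs_cvg; apply: cf => //.
exists (fun _ t => t); split=> [_|T T0 e e0].
  split; first by apply: continuous_subspaceT => t; exact: cvg_id.
  by split=> //; split=> // u u0; exists u.
have [A _ close] := xs_cvg T e T0 e0; exists A => // k /close xs_k t tT; split; last exact: xs_k.
by rewrite subrr normr0 ltW.
Qed.

Lemma locally_uniform_cvg_step_path y v (a_ : nat -> nat -> R) a : halfline_continuous y -> 0 <= v ->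
  (forall k, a_ n k @[n --> \oo] --> a k) ->
  locally_uniform_cvg (fun n => step_path y v (a_ n)) (step_path y v a).
Proof.
move=> cy v0 a_cvg T e T0 e0; have [B B0 yB] := halfline_continuous_bounded T cy.
have eB : 0 < e / B by rewrite divr_gt0.
have [A _ aA] := near_forall_lt (fun k (_ : (k < (truncn (v * T)).+1)%N) => (cvgrPdist_le _ _).1 (a_cvg k) _ eB).
exists A => // n /aA an t /andP[t0 tT]; rewrite /step_path ltNge t0 /= -mulrBr normrM.
apply: (@le_trans _ _ (B * (e / B))); last by rewrite mulrC divfK// gt_eqF.
apply: ler_pM => //; first by apply: yB; rewrite t0.
by rewrite distrC; apply: an; rewrite ltnS le_truncn// ler_wpM2l.
Qed.

Definition grid_path m y : R -> R := step_path (fun=> 1) m.+1%:R (fun i => y (i%:R / m.+1%:R)).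

Lemma grid_pathE m y t : 0 <= t -> grid_path m y t = y (grid_floor m.+1 t).
Proof. by move=> t0; rewrite /grid_path /step_path ltNge t0 /= mul1r. Qed.

Lemma cadlag_grid_path m y : cadlag (grid_path m y).
Proof. by apply: cadlag_step_path => //; exact: halfline_continuous_cst. Qed.

Lemma locally_uniform_cvg_grid_path y : halfline_continuous y ->
  locally_uniform_cvg (fun m => grid_path m y) (extend0 y).
Proof.
move=> /halfline_continuousP cy T e T0 e0.
have /compact_near_coveringP/(_ nat \oo (fun m t => 0 <= t -> `|y (grid_floor m.+1 t) - y t| <= e)) :
  compact `[0, T] by exact: segment_compact.
case=> [t tT /=|n _ near_n]; last first.
  exists n => // m nm t /andP[t0 tT]; rewrite grid_pathE// /extend0 ltNge t0 /=.
  by apply: (near_n m) => //=; rewrite in_itv/= t0.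
move: tT; rewrite /= in_itv/= => /andP[t0 _]; have e2 : 0 < e / 2 by rewrite divr_gt0.
have [delta delta0 near_t] := cy t _ t0 e2; have delta2 : 0 < delta / 2 by rewrite divr_gt0.
have [A _ mA] := near_natSinv_le (divr_gt0 delta2 (ltr0n R 2)).
exists (ball t (delta / 2), [set m | (A <= m)%N]); first by split; [exact: nbhsx_ballx|exists A].
move=> [s m] [/= ts Am] s0; have st : `|s - t| < delta / 2 by rewrite distrC.
have := mA m Am; rewrite /= => m_le; have floor_s := le_trans (grid_floor_dist (ltn0Sn m) s0) m_le.
have y_s : `|y t - y s| <= e / 2 by rewrite distrC; apply: near_t => //; apply: lt_trans st _; lra.
have y_floor : `|y (grid_floor m.+1 s) - y t| <= e / 2.
  apply: near_t; first exact: grid_floor_ge0.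
  by apply: le_lt_trans (ler_distD s _ _) _; apply: le_lt_trans (lerD floor_s (ltW st)) _; lra.
by apply: le_trans (ler_distD (y t) _ _) _; rewrite [leRHS]splitr lerD.
Qed.

End paths.

(** * Weak convergence in path space *)

(* Lipschitz regularisation from below: [minorant k] increases to [F] and is Lipschitz for
   the uniform distance on [[0, k]], hence only sees finitely many grid values of a step path. *)
Section minorant.
Context {R : realType} (F : (R -> R) -> R) (B : R).
Hypothesis functionalF : path_functional F B.
Implicit Types (x y : R -> R) (k : nat).

Definition minorant_set k x : set R := [set v | exists y (delta : R), [/\ cadlag y, 0 <= delta,
  (forall t, 0 <= t <= k%:R -> `|x t - y t| <= delta) & v = F y + k%:R * delta]].

Definition minorant k x : R := inf (minorant_set k x).

Let FB x : cadlag x -> `|F x| <= B. Proof. exact: functionalF.1. Qed.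

Lemma path_functional_bound_ge0 : 0 <= B.
Proof. exact: le_trans (FB (cadlag_grid_path 0 (fun=> 0))). Qed.

Lemma minorant_set_self k x : cadlag x -> minorant_set k x (F x).
Proof.
by move=> cx; exists x, 0; split; rewrite ?mulr0 ?addr0// => t _; rewrite subrr normr0.
Qed.

Lemma minorant_set_ge k x v : minorant_set k x v -> - B <= v.
Proof.
move=> [y [delta [cy delta0 _ ->]]]; apply: (@le_trans _ _ (F y)); last by rewrite lerDl mulr_ge0.
by have := FB cy; rewrite ler_norml => /andP[].
Qed.

Lemma minorant_le_member k x v : minorant_set k x v -> minorant k x <= v.
Proof. by move=> xv; apply: ge_inf => //; exists (- B) => u; exact: minorant_set_ge. Qed.

Lemma minorant_le k x : cadlag x -> minorant k x <= F x.
Proof. by move=> cx; apply: minorant_le_member; exact: minorant_set_self. Qed.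

Lemma minorant_ge k x b : cadlag x -> (forall v, minorant_set k x v -> b <= v) -> b <= minorant k x.
Proof. by move=> cx lb; apply: lb_le_inf => //; exists (F x); exact: minorant_set_self. Qed.

Lemma minorant_norm k x : cadlag x -> `|minorant k x| <= B.
Proof.
move=> cx; rewrite ler_norml; apply/andP; split.
  by apply: minorant_ge => // v; exact: minorant_set_ge.
by apply: le_trans (minorant_le k cx) _; have := FB cx; rewrite ler_norml => /andP[].
Qed.

Lemma minorant_leD k x y (D : R) : cadlag x -> cadlag y -> 0 <= D ->
  (forall t, 0 <= t <= k%:R -> `|x t - y t| <= D) -> minorant k x <= minorant k y + k%:R * D.
Proof.
move=> cx cy D0 xy; rewrite -lerBlDr; apply: minorant_ge => // _ [z [delta [cz delta0 yz ->]]].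
rewrite lerBlDr -addrA -mulrDr; apply: minorant_le_member; exists z, (delta + D); split=> //; first exact: addr_ge0.
by move=> t tk; apply: le_trans (ler_distD (y t) _ _) _; rewrite addrC lerD ?yz ?xy.
Qed.

Lemma minorant_dist k x y (D : R) : cadlag x -> cadlag y -> 0 <= D ->
  (forall t, 0 <= t <= k%:R -> `|x t - y t| <= D) -> `|minorant k x - minorant k y| <= k%:R * D.
Proof.
move=> cx cy D0 xy; have le_xy := minorant_leD cx cy D0 xy.
have le_yx : minorant k y <= minorant k x + k%:R * D by apply: minorant_leD => // t /xy; rewrite distrC.
by rewrite ler_norml; apply/andP; split; lra.
Qed.

Lemma minorant_path_functional k : path_functional (minorant k) B.
Proof.
split=> [x|xs y cxs cy xs_cvg]; first exact: minorant_norm.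
apply/cvgrPdist_le => e e0; have k1 : (0 : R) < k%:R + 1 by rewrite ltr_wpDl.
have ek : 0 < e / (k%:R + 1) by rewrite divr_gt0.
have [A _ close] := xs_cvg _ _ k1 ek; exists A => // n /close xs_n.
rewrite distrC; apply: le_trans (minorant_dist (cxs n) cy (ltW ek) _) _.
  by move=> t /andP[t0 tk]; apply: xs_n; rewrite t0 (le_trans tk)// lerDl.
by rewrite mulrCA ler_piMr ?(ltW e0)// ler_pdivrMr// mul1r lerDl.
Qed.

Lemma minorant_nd k l x : (k <= l)%N -> cadlag x -> minorant k x <= minorant l x.
Proof.
move=> kl cx; apply: minorant_ge => // _ [y [delta [cy delta0 xy ->]]].
apply: (@le_trans _ _ (F y + k%:R * delta)); last by rewrite lerD2l ler_wpM2r// ler_nat.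
apply: minorant_le_member; exists y, delta; split=> // t /andP[t0 tk]; apply: xy.
by rewrite t0 (le_trans tk)// ler_nat.
Qed.

(* If the minorants stay below [F x - e], near minimisers at each level converge to [x]
   locally uniformly, which contradicts the continuity of [F]. *)
Lemma minorant_eventually_ge x (e : R) : cadlag x -> 0 < e -> exists k, F x - e <= minorant k x.
Proof.
move=> cx e0; apply: contrapT => no_k.
have minorant_lt k : minorant k x < F x - e by rewrite ltNge; apply/negP => Fx; apply: no_k; exists k.
have /choice[y y_near] : forall k, exists y : R -> R, exists delta : R, [/\ cadlag y, 0 <= delta,
    (forall t, 0 <= t <= k%:R -> `|x t - y t| <= delta) & F y + k%:R * delta < F x - e].
  move=> k; have has_inf_k : has_inf (minorant_set k x).
    split; first by exists (F x); exact: minorant_set_self.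
    by exists (- B) => u; exact: minorant_set_ge.
  have gap : 0 < F x - e - minorant k x by rewrite subr_gt0.
  have [_ [y [delta [cy delta0 xy ->]]] lt_v] := inf_adherent gap has_inf_k.
  by exists y, delta; split=> //; move: lt_v; rewrite -/(minorant k x); lra.
have cy k : cadlag (y k) by have [delta []] := y_near k.
have y_cvg : locally_uniform_cvg y x.
  move=> T eps T0 eps0; exists (maxn (truncn T).+1 (truncn (2 * B / eps)).+1) => // k /=.
  rewrite geq_max => /andP[kT kB] t /andP[t0 tT].
  have kR : (0 : R) < k%:R by rewrite ltr0n (leq_trans _ kT).
  have [delta [_ delta0 xy lt_v]] := y_near k; rewrite distrC; apply: le_trans (xy t _) _.
    by rewrite t0 (le_trans tT)// (le_trans (ltW (truncnS_gt T)))// ler_nat.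
  have Fx := FB cx; have Fy := FB (cy k); rewrite !ler_norml in Fx Fy.
  have : k%:R * delta <= 2 * B by lra.
  rewrite mulrC -ler_pdivlMr// => /le_trans; apply; rewrite ler_pdivrMr// [leRHS]mulrC -ler_pdivrMr//.
  by rewrite (le_trans (ltW (truncnS_gt (2 * B / eps))))// ler_nat.
have : F x <= F x - e.
  apply: (cvgr_to_le (functionalF.2 _ _ cy cx y_cvg)); apply: nearW => k.
  have [delta [_ delta0 _ lt_v]] := y_near k; have : 0 <= k%:R * delta by rewrite mulr_ge0.
  lra.
lra.
Qed.

Lemma minorant_cvg x : cadlag x -> minorant k x @[k --> \oo] --> F x.
Proof.
move=> cx; apply/cvgrPdist_le => e e0; have [k0 Fx] := minorant_eventually_ge cx e0.
exists k0 => // k /= k0k; have := minorant_nd k0k cx; have := minorant_le k cx.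
by move=> le_F le_k; rewrite ger0_norm; lra.
Qed.

End minorant.

Section grid_functional.
Context {R : realType} (F : (R -> R) -> R) (B : R) (k m : nat).
Hypothesis functionalF : path_functional F B.

Definition grid_functional (a : nat -> R) : R :=
  minorant F k (step_path (fun=> 1) m.+1%:R (fun i => if i is j.+1 then a j else 0)).

Let cadlag_step (a : nat -> R) : cadlag (step_path (fun=> 1) m.+1%:R a).
Proof. by apply: cadlag_step_path => //; exact: halfline_continuous_cst. Qed.

Lemma grid_functional_bounded_lipschitz : bounded_lipschitz (m.+1 * k) B k%:R grid_functional.
Proof.
split=> // [a|a b D D0 ab]; first exact: (minorant_norm functionalF).
apply: (minorant_dist functionalF) => // t /andP[t0 tk].
rewrite /step_path ltNge t0 /= !mul1r.
have : (truncn (m.+1%:R * t) <= m.+1 * k)%N.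
  rewrite -(ler_nat R) (@le_trans _ _ (m.+1%:R * t)) ?truncn_le ?mulr_ge0//.
  by rewrite natrM ler_wpM2l.
by case: (truncn _) => [|j] jk; [rewrite subrr normr0|exact: ab].
Qed.

Lemma grid_functionalE (y : R -> R) : y 0 = 0 ->
  grid_functional (fun i => y (i.+1%:R / m.+1%:R)) = minorant F k (grid_path m y).
Proof.
move=> y0; congr minorant; apply/funext => t; rewrite /grid_path /step_path; case: ifP => // _.
by case: (truncn _) => [|j]; rewrite ?mul0r ?y0.
Qed.

End grid_functional.

Section path_functional_measurability.
Context {R : realType} {d} {T : measurableType d} (F : (R -> R) -> R) (B : R).
Hypothesis functionalF : path_functional F B.

Lemma bmfun_grid_path (xi : T -> R -> R) m : (forall (t : R), 0 <= t -> measurable_fun setT (xi ^~ t)) ->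
  bmfun (fun w => F (grid_path m (xi w))).
Proof.
move=> mxi; split; last by exists B => w; apply: functionalF.1; exact: cadlag_grid_path.
apply: (@measurable_seq_continuous _ _ _ (fun i w => xi w (i%:R / m.+1%:R))
  (fun a => F (step_path (fun=> 1) m.+1%:R a))) => [i|a_ a a_cvg].
  by apply: mxi; rewrite divr_ge0.
have c1 : halfline_continuous (fun=> (1 : R)) by exact: halfline_continuous_cst.
by apply: functionalF.2 => [n||]; [exact: cadlag_step_path|exact: cadlag_step_path|exact: locally_uniform_cvg_step_path].
Qed.

Lemma grid_path_functional_cvg y : halfline_continuous y ->
  F (grid_path m y) @[m --> \oo] --> F (extend0 y).
Proof.
move=> cy; apply: functionalF.2 => [m||]; [exact: cadlag_grid_path|exact: cadlag_extend0|].
exact: locally_uniform_cvg_grid_path.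
Qed.

Lemma bmfun_extend0 (xi : T -> R -> R) : (forall w, halfline_continuous (xi w)) ->
  (forall (t : R), 0 <= t -> measurable_fun setT (xi ^~ t)) -> bmfun (fun w => F (extend0 (xi w))).
Proof.
move=> cxi mxi; split; last by exists B => w; apply: functionalF.1; exact: cadlag_extend0.
apply: (@measurable_fun_cvg _ _ _ _ (fun m w => F (grid_path m (xi w)))) => // [m|w _].
  exact: bmfun_measurable (bmfun_grid_path m mxi).
exact: grid_path_functional_cvg.
Qed.

End path_functional_measurability.

Section weak_convergence.
Context {R : realType} {d d' : measure_display} {Om : measurableType d} {Om' : measurableType d'}.
Context (P : probability Om R) (P' : probability Om' R) (X : nat -> Om -> R -> R) (Y : Om' -> R -> R).
Hypothesis cX : forall n w, cadlag (X n w).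
Hypothesis X0 : forall n w, X n w 0 = 0.
Hypothesis mFX : forall F B n, path_functional F B -> measurable_fun setT (fun w => F (X n w)).
Hypothesis mX : forall n (t : R), 0 <= t -> measurable_fun setT (fun w => X n w t).
Hypothesis cY : forall w, halfline_continuous (Y w).
Hypothesis Y0 : forall w, Y w 0 = 0.
Hypothesis mY : forall t : R, 0 <= t -> measurable_fun setT (fun w => Y w t).
Hypothesis tightX : forall eta e T : R, 0 < eta -> 0 < e -> 0 < T -> exists m0 : nat,
  forall m, (m0 <= m)%N -> \forall n \near \oo, except_prob P e (fun w => forall t : R, 0 <= t <= T ->
    `|X n w t - X n w (grid_floor m t)| <= eta).
Hypothesis fddX : forall m q (C L : R) h, (0 < m)%N -> bounded_lipschitz q C L h ->
  expect P (fun w => h (fun i => X n w (i.+1%:R / m%:R))) @[n --> \oo] -->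
  expect P' (fun w => h (fun i => Y w (i.+1%:R / m%:R))).

Section functional.
Context (F : (R -> R) -> R) (B : R).
Hypothesis functionalF : path_functional F B.
Let B0 : 0 <= B. Proof. exact: path_functional_bound_ge0 functionalF. Qed.

Let bmfun_FX n : bmfun (fun w => F (X n w)).
Proof. by split; [exact: mFX functionalF|exists B => w; exact: functionalF.1]. Qed.

Lemma minorant_grid_path_cvg k m : expect P (fun w => minorant F k (grid_path m (X n w))) @[n --> \oo] -->
  expect P' (fun w => minorant F k (grid_path m (Y w))).
Proof.
have := @fddX m.+1 _ _ _ _ isT (grid_functional_bounded_lipschitz k m functionalF).
have -> : expect P' (fun w => grid_functional F k m (fun i => Y w (i.+1%:R / m.+1%:R))) =
    expect P' (fun w => minorant F k (grid_path m (Y w))).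
  by apply: eq_expect => w; exact: grid_functionalE.
by apply: cvg_trans; apply: near_eq_cvg; apply: nearW => n; apply: eq_expect => w; rewrite grid_functionalE.
Qed.

Lemma expect_minorant_grid_path_le k m n (eta eps : R) : 0 <= eta ->
  except_prob P eps (fun w => forall t : R, 0 <= t <= k%:R -> `|X n w t - X n w (grid_floor m.+1 t)| <= eta) ->
  expect P (fun w => minorant F k (grid_path m (X n w))) <=
  expect P (fun w => F (X n w)) + (k%:R * eta + 2 * B * eps).
Proof.
move=> eta0 [A [mA PA close]].
have bG : bmfun (fun w => minorant F k (grid_path m (X n w))).
  by apply: (bmfun_grid_path (minorant_path_functional functionalF k)) => t t0; exact: mX.
have bA : bmfun (fun w => k%:R * eta + 2 * B * \1_A w) by bmfun.
apply: (@le_trans _ _ (expect P (fun w => F (X n w) + (k%:R * eta + 2 * B * \1_A w)))).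
  apply: le_expect => [//||w]; first by apply: bmfunD.
  have [Aw|nAw] := pselect (A w).
    rewrite indicE mem_set//= mulr1; have := functionalF.1 _ (cX n w).
    have := minorant_norm functionalF k (cadlag_grid_path m (X n w)); rewrite !ler_norml => /andP[_ leB] /andP[geB _].
    have : 0 <= k%:R * eta by rewrite mulr_ge0.
    lra.
  rewrite indicE memNset//= mulr0 addr0.
  apply: le_trans (minorant_leD functionalF (cadlag_grid_path m _) (cX n w) eta0 _) _.
    by move=> t /andP[t0 tk]; rewrite distrC grid_pathE//; apply: close => //; rewrite t0.
  by rewrite lerD2r; exact: (minorant_le functionalF).
rewrite expectD// lerD2l expectD ?expect_cst ?lerD2l; [|bmfun..].
by rewrite expectZ ?expect_indic ?ler_wpM2l ?mulr_ge0//; bmfun.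
Qed.

Lemma minorant_limit_cvg : expect P' (fun w => minorant F k (extend0 (Y w))) @[k --> \oo] -->
  expect P' (fun w => F (extend0 (Y w))).
Proof.
apply: (@bounded_convergence _ _ _ P' _ _ B).
- by move=> k; exact: bmfun_measurable (bmfun_extend0 (minorant_path_functional functionalF k) cY mY).
- exact: bmfun_measurable (bmfun_extend0 functionalF cY mY).
- by move=> k w; apply: (minorant_norm functionalF); exact: cadlag_extend0.
- by apply: aeW => w; apply: (minorant_cvg functionalF); exact: cadlag_extend0.
Qed.

Lemma minorant_grid_path_limit_cvg k : expect P' (fun w => minorant F k (grid_path m (Y w))) @[m --> \oo] -->
  expect P' (fun w => minorant F k (extend0 (Y w))).
Proof.
have functional_k := minorant_path_functional functionalF k.
apply: (@bounded_convergence _ _ _ P' _ _ B).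
- by move=> m; exact: bmfun_measurable (bmfun_grid_path functional_k m mY).
- exact: bmfun_measurable (bmfun_extend0 functional_k cY mY).
- by move=> m w; apply: (minorant_norm functionalF); exact: cadlag_grid_path.
- by apply: aeW => w; exact: grid_path_functional_cvg functional_k _ _.
Qed.

Lemma near_expect_path_functional_ge (e : R) : 0 < e ->
  \forall n \near \oo, expect P' (fun w => F (extend0 (Y w))) - e <= expect P (fun w => F (X n w)).
Proof.
move=> e0; have e4 : 0 < e / 4 by rewrite divr_gt0.
have e8 : 0 < e / 8 by rewrite divr_gt0.
have [k _ /(_ k (leqnn k))/= limit_k] := (cvgrPdist_le _ _).1 minorant_limit_cvg _ e4.
have [m1 _ limit_grid] := (cvgrPdist_le _ _).1 (@minorant_grid_path_limit_cvg k) _ e4.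
have k1 : (0 : R) < k%:R + 1 by rewrite ltr_wpDl.
have B1 : 0 < 2 * B + 1 by rewrite ltr_wpDl ?mulr_ge0.
have [m0 tight] := tightX (divr_gt0 e8 k1) (divr_gt0 e8 B1) k1; pose m := maxn m1 m0.
have grid_m := limit_grid m (leq_maxl _ _); rewrite /= in grid_m.
have grid_cvg : \forall n \near \oo, `|expect P' (fun w => minorant F k (grid_path m (Y w))) -
    expect P (fun w => minorant F k (grid_path m (X n w)))| <= e / 4.
  by exact: (cvgrPdist_le _ _).1 (@minorant_grid_path_cvg k m) _ e4.
have grid_tight : \forall n \near \oo, except_prob P (e / 8 / (2 * B + 1)) (fun w => forall t : R, 0 <= t <= k%:R ->
    `|X n w t - X n w (grid_floor m.+1 t)| <= e / 8 / (k%:R + 1)).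
  have [A _ tight_n] := tight m.+1 (leqW (leq_maxr _ _)); exists A => // n /tight_n.
  apply: except_probS => // w close t /andP[t0 tk]; apply: close.
  by rewrite t0 (le_trans tk)// lerDl.
near=> n; have near_grid : `|expect P' (fun w => minorant F k (grid_path m (Y w))) -
    expect P (fun w => minorant F k (grid_path m (X n w)))| <= e / 4 by near: n.
have near_tight : except_prob P (e / 8 / (2 * B + 1)) (fun w => forall t : R, 0 <= t <= k%:R ->
    `|X n w t - X n w (grid_floor m.+1 t)| <= e / 8 / (k%:R + 1)) by near: n.
have le_grid := expect_minorant_grid_path_le (ltW (divr_gt0 e8 k1)) near_tight.
have small_k : k%:R * (e / 8 / (k%:R + 1)) <= e / 8 by rewrite mulrA ler_pdivrMr// mulrC ler_wpM2l ?(ltW e8)// lerDl.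
have small_B : 2 * B * (e / 8 / (2 * B + 1)) <= e / 8 by rewrite mulrA ler_pdivrMr// mulrC ler_wpM2l ?(ltW e8)// lerDl.
move: limit_k grid_m near_grid; rewrite !ler_norml => /andP[_ ?] /andP[_ ?] /andP[_ ?].
lra.
Unshelve. all: by end_near. Qed.

End functional.

Lemma path_functional_weak_cvg F B : path_functional F B ->
  expect P (fun w => F (X n w)) @[n --> \oo] --> expect P' (fun w => F (extend0 (Y w))).
Proof.
move=> functionalF; have functionalN := path_functionalN functionalF.
have bFX n : bmfun (fun w => F (X n w)) by split; [exact: mFX functionalF|exists B => w; exact: functionalF.1].
apply/cvgrPdist_le => e e0.
have [A _ ge_F] := near_expect_path_functional_ge functionalF e0.
have [A' _ le_F] := near_expect_path_functional_ge functionalN e0.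
exists (maxn A A') => // n /=; rewrite geq_max => /andP[/ge_F /= geF /le_F /= leF].
rewrite (expectN _ (bFX n)) (expectN _ (bmfun_extend0 functionalF cY mY)) in leF.
by rewrite ler_norml; apply/andP; split; lra.
Qed.

End weak_convergence.

Section null_sets.
Context {R : realType} {d} {T : measurableType d} (mu : {measure set T -> \bar R}).
Implicit Types f g : T -> \bar R.
Local Open Scope ereal_scope.

(* No measurability is assumed: the integral of a nonnegative function is a supremum. *)
Lemma ge0_integral_le f g : (forall w, 0 <= f w) -> (forall w, f w <= g w) ->
  \int[mu]_w f w <= \int[mu]_w g w.
Proof.
move=> f0 fg; rewrite !ge0_integralTE//; last by move=> w; exact: le_trans (fg w).
apply: ereal_sup_le => _ [h hf <-]; exists h => //= w; exact: le_trans (fg w).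
Qed.

Lemma ge0_null_eq_integral (N : set T) f g : measurable N -> mu N = 0 -> (forall w, 0 <= f w) ->
  (forall w, 0 <= g w) -> measurable_fun setT g -> (forall w, ~ N w -> f w = g w) ->
  \int[mu]_w f w = \int[mu]_w g w.
Proof.
move=> mN N0 f0 g0 mg fg; have aeN : {ae mu, forall w, ~ N w} by exists N; split=> // w /=; exact: contrapT.
have mindic (A : set T) : measurable A -> measurable_fun setT (fun w => (\1_A w)%:E : \bar R).
  by move=> mA; apply/measurable_EFinP; exact: measurable_indic.
pose lower w := g w * (\1_(~` N) w)%:E; pose upper w := g w + +oo * (\1_N w)%:E.
have mlower : measurable_fun setT lower by apply: emeasurable_funM => //; apply: mindic; exact: measurableC.
have mupper : measurable_fun setT upper.
  by apply: emeasurable_funD => //; apply: emeasurable_funM; [exact: measurable_cst|exact: mindic].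
have int_lower : \int[mu]_w lower w = \int[mu]_w g w.
  apply: ae_eq_integral => //; apply: filterS aeN => w nN _.
  by rewrite /lower indicE mem_set// mule1.
have int_upper : \int[mu]_w upper w = \int[mu]_w g w.
  apply: ae_eq_integral => //; apply: filterS aeN => w nN _.
  by rewrite /upper indicE memNset// mule0 adde0.
apply/eqP; rewrite eq_le -{1}int_upper -int_lower; apply/andP; split; apply: ge0_integral_le => // w;
  rewrite /lower /upper !indicE; have [Nw|nNw] := pselect (N w).
- by rewrite (mem_set Nw) mule1 addey ?leey// gt_eqF// (lt_le_trans _ (g0 w)).
- by rewrite (memNset nNw) mule0 adde0 fg.
- by rewrite mule_ge0// lee_fin.
- by rewrite mule_ge0// lee_fin.
- by rewrite memNset ?mule0 ?f0//=; apply.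
- by rewrite mem_set// mule1 fg.
Qed.

Lemma null_eq_integral (N : set T) f g : measurable N -> mu N = 0 -> measurable_fun setT g ->
  (forall w, ~ N w -> f w = g w) -> \int[mu]_w f w = \int[mu]_w g w.
Proof.
move=> mN N0 mg fg; rewrite integralE [RHS]integralE; congr (_ - _).
  apply: (ge0_null_eq_integral mN N0) => //; first exact: measurable_funepos.
  by move=> w /fg; rewrite !funeposE => ->.
apply: (ge0_null_eq_integral mN N0) => //; first exact: measurable_funeneg.
by move=> w /fg; rewrite !funenegE => ->.
Qed.

End null_sets.

(** * The functional central limit theorem *)

Definition clip {R : realType} (z : R) : R := maxr 0 (minr z 1).

Lemma clip01 {R : realType} (z : R) : 0 <= clip z <= 1.
Proof. by rewrite /clip le_max lexx/= ge_max ler01/= ge_min lexx orbT. Qed.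

Lemma clip_id {R : realType} (z : R) : 0 <= z <= 1 -> clip z = z.
Proof. by move=> /andP[z0 z1]; rewrite /clip (min_idPl z1) (max_idPr z0). Qed.

Lemma measurable_clip {R : realType} : measurable_fun setT (@clip R).
Proof. by apply: measurable_maxr => //; apply: measurable_minr. Qed.

Section wiener_comp.
Context {R : realType} {d d' : measure_display} {Om : measurableType d} {Om' : measurableType d'}.
Context (P : probability Om R) (P' : probability Om' R) (W : R -> Om' -> R) (Z' : Om' -> R) (Z : Om -> R).
Hypothesis wienerW : wiener_with_copy P P' W Z' Z.

Lemma wiener_with_copy_comp (f : R -> R) : measurable_fun setT f ->
  wiener_with_copy P P' W (f \o Z') (f \o Z).
Proof.
have [mZ mZ' mW W0 cW lawW] := wienerW; move=> mf; split=> //; try exact: measurableT_comp.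
move=> m ts A B ts0 ts_incr mA mB; apply: (lawW m ts (f @^-1` A) B ts0 ts_incr _ mB).
exact: measurable_preimageT.
Qed.

End wiener_comp.

Section functional_clt.
Context {R : realType} {d d' : measure_display} {Om : measurableType d} {Om' : measurableType d'}.
Context (P : probability Om R) (F : nat -> set (set Om)) (M v : nat -> Om -> R) (r : nat -> R).
Context (N : nat) (g c : R) (Minf : Om -> R).
Hypothesis reinfM : reinforced_martingale P F M v r N g c Minf.
Context (P' : probability Om' R) (W : R -> Om' -> R) (Z' : Om' -> R).
Hypothesis wienerW : wiener_with_copy P P' W Z' Minf.
Hypothesis copy01 : forall w, 0 <= Z' w <= 1.
Let p := 2 * g - 1.

Let reg := reinforced_regular reinfM.
Let bM := martingale_bmfun (reinforced_controlled reinfM).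
Let bMinf := limit_bmfun reinfM.
Let p0 : 0 < p. Proof. by have /andP[] := tail_exponent_range reg. Qed.
Let N_gt0 := population_gt0 reinfM.
Let cp0 : 0 <= c ^+ 2 / p. Proof. exact: divr_ge0 (sqr_ge0 _) (ltW p0). Qed.

Definition limit_speed (z : R) : R := c ^+ 2 / p * mean_var N z.

Definition limit_path (w : Om') (t : R) : R := W (limit_speed (Z' w) * t `^ p) w.

Definition fluctuation_path (n : nat) (w : Om) : R -> R :=
  step_path (fun t => t `^ p * amplitude g n) n%:R (fun k => M k w - Minf w).

Lemma fluctuation_pathE n w (t : R) : 0 <= t -> fluctuation_path n w t = fluctuation M g Minf n t w.
Proof. by move=> t0; rewrite /fluctuation_path /step_path ltNge t0. Qed.

Let scaling_continuous n : halfline_continuous (fun t : R => t `^ p * amplitude g n).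
Proof.
rewrite (_ : (fun t => _) = fun t => amplitude g n * t `^ p); last by apply/funext => t; rewrite mulrC.
exact: halfline_continuousZ (halfline_continuous_powR p0).
Qed.

Lemma cadlag_fluctuation_path n w : cadlag (fluctuation_path n w).
Proof. exact: cadlag_step_path. Qed.

Lemma fluctuation_path0 n w : fluctuation_path n w 0 = 0.
Proof. by rewrite fluctuation_pathE// /fluctuation powR0 ?mul0r// gt_eqF. Qed.

Lemma bmfun_fluctuation_path n (t : R) : 0 <= t -> bmfun (fun w => fluctuation_path n w t).
Proof.
move=> t0; rewrite (_ : (fun w => _) = fluctuation M g Minf n t).
  exact: fluctuation_bmfun reinfM n t.
by apply/funext => w; rewrite fluctuation_pathE.
Qed.

Lemma measurable_fluctuation_path G B n : path_functional G B ->
  measurable_fun setT (fun w => G (fluctuation_path n w)).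
Proof.
move=> functionalG; apply: (@measurable_seq_continuous _ _ _ (fun k w => M k w - Minf w)
  (fun a => G (step_path (fun t => t `^ p * amplitude g n) n%:R a))) => [k|a_ a a_cvg].
  by apply: measurable_funB; exact: bmfun_measurable.
by apply: functionalG.2 => [k||]; [exact: cadlag_step_path|exact: cadlag_step_path|exact: locally_uniform_cvg_step_path].
Qed.

Lemma limit_speed_range z : 0 <= z <= 1 -> 0 <= limit_speed z <= (truncn (c ^+ 2 / p)).+1%:R.
Proof.
move=> z01; rewrite mulr_ge0 ?mean_var_ge0//=; apply: le_trans (ltW (truncnS_gt (c ^+ 2 / p))).
by rewrite ler_piMr// mean_var_le1.
Qed.

Lemma measurable_limit_speed : measurable_fun setT limit_speed.
Proof. by apply: measurable_funM => //; exact: continuous_measurable_fun (@continuous_mean_var R N). Qed.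

Lemma limit_path_continuous w : halfline_continuous (limit_path w).
Proof.
have /andP[speed0 _] := limit_speed_range (copy01 w).
apply: (halfline_continuous_comp (y := W ^~ w) (z := fun t => limit_speed (Z' w) * t `^ p)) => [t t0||].
- by rewrite mulr_ge0 ?powR_ge0.
- exact: wiener_continuous wienerW w.
- exact: halfline_continuousZ (halfline_continuous_powR p0).
Qed.

Lemma limit_path0 w : limit_path w 0 = 0.
Proof. by rewrite /limit_path powR0 ?gt_eqF// mulr0 (wiener0 wienerW). Qed.

Lemma measurable_limit_path (t : R) : 0 <= t -> measurable_fun setT (fun w => limit_path w t).
Proof.
move=> t0; apply: (measurable_random_parameter (wiener_measurable wienerW) (wiener_continuous wienerW)) => [|w].
  apply: measurable_funM => //; apply: measurableT_comp (copy_measurable wienerW).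
  exact: measurable_limit_speed.
by have /andP[? _] := limit_speed_range (copy01 w); rewrite mulr_ge0 ?powR_ge0.
Qed.

Lemma expect_sqr_fluctuation_bound : exists2 C : R, 0 < C & forall n (t : R), 0 < t ->
  expect P (fun w => fluctuation M g Minf n t w ^+ 2) <= C * t `^ p.
Proof.
have [C C0 tail_le] := sqr_tail_bound reg; exists C => // n t t0.
have tp : 0 < t `^ p by rewrite powR_gt0.
apply: le_trans (expect_sqr_fluctuation_le reinfM n t) _; rewrite -/p.
case: n => [|n]; first by rewrite powR0 ?gt_eqF// mul0r mulr0 mulr_ge0// ltW.
have nt : 0 < n.+1%:R * t by rewrite mulr_gt0.
have tail_nt : n.+1%:R `^ p * sqr_tail r (truncn (n.+1%:R * t)) <= C * t `^ (- p).
  apply: (@le_trans _ _ (n.+1%:R `^ p * (C * (n.+1%:R * t) `^ (- p)))).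
    rewrite ler_wpM2l ?powR_ge0// (le_trans (tail_le _))// ler_pM2l// le_powR_base_neg ?ltW ?truncnS_gt//.
    by rewrite oppr_lt0.
  by rewrite powRM ?(ltW t0)// mulrCA [n.+1%:R `^ p * _]mulrA powRK ?ltr0n// mul1r.
apply: le_trans (ler_wpM2l (sqr_ge0 _) tail_nt) _.
by rewrite expr2 mulrCA -mulrA powRK// mulr1.
Qed.

Lemma expect_cos_limit_path m q (theta : nat -> R) phi : (0 < m)%N ->
  expect P' (fun w => cos (phi + \sum_(i < q) theta i * limit_path w (i.+1%:R / m%:R))) =
  expect P (fun w => normal_cf (mean_var N (Minf w) *
    fluctuation_form g c q (fun i => i.+1%:R / m%:R) theta) * cos phi).
Proof.
move=> m0; have mV : (0 : R) < m%:R^-1 by rewrite invr_gt0 ltr0n.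
pose s i : R := (i%:R / m%:R) `^ p.
have s0 : s 0%N = 0 by rewrite /s mul0r powR0// gt_eqF.
have s_incr j : (j < q)%N -> s j < s j.+1.
  by move=> _; apply: gt0_ltr_powR; rewrite ?nnegrE ?divr_ge0// ltr_pM2r// ltr_nat.
have s_ge0 j : 0 <= s j by exact: powR_ge0.
have clip_range z : 0 <= limit_speed (clip z) <= (truncn (c ^+ 2 / p)).+1%:R.
  exact: limit_speed_range (clip01 z).
have m_speed : measurable_fun setT (limit_speed \o clip).
  exact: measurableT_comp measurable_limit_speed measurable_clip.
have := expect_cos_wiener_copy wienerW theta s0 s_incr s_ge0 phi m_speed clip_range.
under eq_expect do rewrite /= clip_id//; move=> ->; apply: eq_expect => w.
rewrite /= clip_id ?(limit01 reinfM)// /limit_speed [c ^+ 2 / p * _]mulrC -mulrA.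
congr (normal_cf (_ * (_ * _)) * _); apply: eq_bigr => i _; apply: eq_bigr => j _.
congr (_ * _ `^ _); have [ij|/ltnW ij] := leqP i j.
  by rewrite (min_idPl _)// ler_pM2r// ler_nat.
by rewrite (min_idPr _)// ler_pM2r// ler_nat.
Qed.

Lemma expect_bounded_lipschitz_cvg m q (C L : R) h : (0 < m)%N -> bounded_lipschitz q C L h ->
  expect P (fun w => h (fun i => fluctuation_path n w (i.+1%:R / m%:R))) @[n --> \oo] -->
  expect P' (fun w => h (fun i => limit_path w (i.+1%:R / m%:R))).
Proof.
move=> m0 lip_h; have mR : (0 : R) < m%:R by rewrite ltr0n.
have t0 i : 0 < i.+1%:R / m%:R :> R by rewrite divr_gt0.
have [C1 C10 C1_ge] := expect_sqr_fluctuation_bound.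
apply: (@bounded_lipschitz_cvg _ _ _ _ _ P P' q (fun n i w => fluctuation_path n w (i.+1%:R / m%:R))
  (fun i w => limit_path w (i.+1%:R / m%:R)) _ _ _ (C1 * (q%:R / m%:R) `^ p) C L h _ lip_h).
- by move=> n i; exact: bmfun_fluctuation_path (ltW (t0 i)).
- by move=> i; exact: measurable_limit_path (ltW (t0 i)).
- move=> theta phi; rewrite expect_cos_limit_path//.
  apply: cvg_trans (expect_cos_fluctuation_cvg reinfM (theta := theta) (phi := phi)
    (fun i (_ : (i < q)%N) => t0 i)).
  apply: near_eq_cvg; apply: nearW => n; apply: eq_expect => w; congr (cos (_ + _)).
  by apply: eq_bigr => i _; rewrite fluctuation_pathE// ltW.
- move=> n i iq; under eq_expect do rewrite fluctuation_pathE ?(ltW (t0 i))//.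
  apply: le_trans (C1_ge n _ (t0 i)) _; rewrite ler_pM2l// le_powR_base ?(ltW p0) ?(ltW (t0 i))//.
  by rewrite ler_pM2r ?invr_gt0// ler_nat.
Qed.

Lemma fluctuation_path_weak_cvg G B : path_functional G B ->
  expect P (fun w => G (fluctuation_path n w)) @[n --> \oo] -->
  expect P' (fun w => G (extend0 (limit_path w))).
Proof.
apply: path_functional_weak_cvg; [exact: cadlag_fluctuation_path|exact: fluctuation_path0|
  exact: measurable_fluctuation_path| |exact: limit_path_continuous|exact: limit_path0|
  exact: measurable_limit_path| |exact: expect_bounded_lipschitz_cvg].
  by move=> n t t0; exact: bmfun_measurable (bmfun_fluctuation_path n t0).
move=> eta e T eta0 e0 T0; have [m0 tight] := fluctuation_tight reinfM eta0 e0 T0.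
exists m0 => m m0m; have [A _ tight_n] := tight m m0m; exists A => // n /tight_n.
apply: except_probS => // w close t t0T; have /andP[t0 _] := t0T.
by rewrite !fluctuation_pathE ?grid_floor_ge0//; exact: close.
Qed.

End functional_clt.

Section skorohod.
Context {R : realType} {d d' : measure_display} {Om : measurableType d} {Om' : measurableType d'}.
Context (P : probability Om R) (P' : probability Om' R).

Lemma cvg_dist_skorohod_path_functional (X X' : nat -> Om -> R -> R) (Y Y' : Om' -> R -> R)
    (S : set Om) (S' : set Om') :
  (forall f B, path_functional f B -> forall n, bmfun (fun w => f (X n w))) ->
  (forall f B, path_functional f B -> bmfun (fun w => f (Y w))) ->
  (forall f B, path_functional f B ->
    expect P (fun w => f (X n w)) @[n --> \oo] --> expect P' (fun w => f (Y w))) ->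
  measurable S -> P S = 0%E -> (forall n w, ~ S w -> X' n w = X n w) ->
  measurable S' -> P' S' = 0%E -> (forall w, ~ S' w -> Y' w = Y w) ->
  cvg_dist_skorohod P X' P' Y'.
Proof.
move=> bX bY XY mS S0 eqX mS' S'0 eqY f /skorohod_path_functional[B functional_f].
have bfX := bX f B functional_f; have bfY := bY f B functional_f.
have -> : (\int[P']_w (f (Y' w))%:E)%E = (expect P' (fun w => f (Y w)))%:E.
  rewrite -integral_expect//; apply: (null_eq_integral mS' S'0) => [|w /eqY -> //].
  by apply/measurable_EFinP; exact: bmfun_measurable.
have -> : (fun n => \int[P]_w (f (X' n w))%:E)%E = fun n => (expect P (fun w => f (X n w)))%:E.
  apply/funext => n; rewrite -integral_expect//; apply: (null_eq_integral mS S0) => [|w /eqX -> //].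
  by apply/measurable_EFinP; exact: bmfun_measurable.
by apply: cvg_EFin; [exact: nearW|exact: XY functional_f].
Qed.

End skorohod.

(** * The interacting reinforcement model *)

Record interacting_reinforcement {R : realType} {d : measure_display} {Om : measurableType d}
    (P : probability Om R) (N : nat) (alpha : R) (r : nat -> R) (Z I : nat -> 'I_N -> Om -> R) : Prop :=
  InteractingReinforcement {
  agents_gt0 : (0 < N)%N;
  interaction01 : 0 < alpha <= 1;
  reinforcement01 : forall n, 0 <= r n < 1;
  state_measurable : forall n i, measurable_fun setT (Z n i);
  action_measurable : forall n i, measurable_fun setT (I n i);
  state01 : forall n i w, 0 <= Z n i w <= 1;
  action01 : forall n i w, I n i w = 0 \/ I n i w = 1;
  state_step : forall n i w, Z n.+1 i w = (1 - r n) * Z n i w + r n * I n.+1 i w;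
  action_cond_law : forall n (A : set Om), filtr Z n A -> forall e : {ffun 'I_N -> bool},
    P (A `&` [set w | forall i, I n.+1 i w = (e i)%:R]) =
    (\int[P]_(w in A) (\prod_(i < N) (if e i then (1 - alpha) * Z n i w + alpha * zmean Z n w
      else 1 - ((1 - alpha) * Z n i w + alpha * zmean Z n w)))%:E)%E }.

Lemma norm_average_le1 {R : realFieldType} (N : nat) (x : 'I_N -> R) : (0 < N)%N ->
  (forall i, `|x i| <= 1) -> `|(\sum_(i < N) x i) / N%:R| <= 1.
Proof.
move=> N0 x1; rewrite normrM normfV normr_nat ler_pdivrMr ?ltr0n// mul1r.
rewrite (le_trans (ler_norm_sum _ _ _))//; apply: le_trans (ler_sum _ (fun i _ => x1 i)) _.
by rewrite sumr_const card_ord.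
Qed.

Section interacting_agents.
Context {R : realType} {d : measure_display} {Om : measurableType d}.
Context (P : probability Om R) (N : nat) (alpha : R) (r : nat -> R) (Z I : nat -> 'I_N -> Om -> R).
Hypothesis modelZ : interacting_reinforcement P alpha r Z I.
Implicit Types (n m : nat) (i k : 'I_N) (w : Om) (G : Om -> R) (e : {ffun 'I_N -> bool}).

Let N_gt0 := agents_gt0 modelZ.
Let NR0 : (0 : R) < N%:R. Proof. by rewrite ltr0n. Qed.

Definition history n : set (set Om) :=
  [set A | exists (k : nat) (i : 'I_N) (B : set R), (k <= n)%N /\ measurable B /\ A = Z k i @^-1` B].

Lemma history_measurable n : history n `<=` measurable.
Proof. by move=> _ [k [i [B [_ [mB ->]]]]]; exact: measurable_preimageT (state_measurable modelZ k i) mB. Qed.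

Lemma history_nd n m : (n <= m)%N -> history n `<=` history m.
Proof. by move=> nm _ [k [i [B [kn [mB ->]]]]]; exists k, i, B; split=> //; exact: leq_trans kn nm. Qed.

Let history_bmfun n G : past history n G -> bmfun G.
Proof. exact/bmfun_generated/history_measurable. Qed.

Definition choice_prob n i w : R := (1 - alpha) * Z n i w + alpha * zmean Z n w.

Definition innovation n i w : R := I n.+1 i w - choice_prob n i w.

Definition mean_innovation n w : R := (\sum_(i < N) innovation n i w) / N%:R.

Definition mean_step_var n w : R := (\sum_(i < N) bernoulli_var (choice_prob n i w)) / N%:R ^+ 2.

Definition deviation n i w : R := Z n i w - zmean Z n w.

Lemma sum_state n w : \sum_(i < N) Z n i w = N%:R * zmean Z n w.
Proof. by rewrite /zmean mulrC divfK// gt_eqF. Qed.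

Lemma zmean01 n w : 0 <= zmean Z n w <= 1.
Proof.
have state_norm i : `|Z n i w| <= 1 by have /andP[? ?] := state01 modelZ n i w; rewrite ger0_norm.
have := norm_average_le1 N_gt0 state_norm; rewrite ler_norml => /andP[_ ->]; rewrite andbT.
by rewrite divr_ge0// sumr_ge0// => i _; have /andP[] := state01 modelZ n i w.
Qed.

Lemma choice_prob01 n i w : 0 <= choice_prob n i w <= 1.
Proof.
have /andP[? ?] := state01 modelZ n i w; have /andP[? ?] := zmean01 n w.
by have /andP[? ?] := interaction01 modelZ; rewrite /choice_prob; apply/andP; split; nra.
Qed.

Lemma sum_choice_prob n w : \sum_(i < N) choice_prob n i w = N%:R * zmean Z n w.
Proof.
rewrite /choice_prob big_split/= -mulr_sumr sumr_const card_ord sum_state -mulr_natl.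
by ring.
Qed.

Lemma norm_innovation_le1 n i w : `|innovation n i w| <= 1.
Proof.
have /andP[? ?] := choice_prob01 n i w; rewrite ler_norml /innovation.
by case: (action01 modelZ n.+1 i w) => ->; apply/andP; split; lra.
Qed.

Lemma norm_mean_innovation_le1 n w : `|mean_innovation n w| <= 1.
Proof. by apply: norm_average_le1 => // i; exact: norm_innovation_le1. Qed.

Lemma zmean_step n w : zmean Z n.+1 w - zmean Z n w = r n * mean_innovation n w.
Proof.
have -> : zmean Z n.+1 w = (\sum_(i < N) ((1 - r n) * Z n i w + r n * I n.+1 i w)) / N%:R.
  by congr (_ / _); apply: eq_bigr => i _; exact: state_step modelZ n i w.
rewrite big_split/= -!mulr_sumr sum_state /mean_innovation sumrB sum_choice_prob.
by move: (N%:R : R) NR0 => m m0; field; rewrite gt_eqF.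
Qed.

Lemma past_state n i : past history n (Z n i).
Proof.
split; last by exists 1 => w; have /andP[? ?] := state01 modelZ n i w; rewrite ger0_norm.
by move=> _ B mB; rewrite setTI; apply: sub_gen_smallest; exists n, i, B.
Qed.

Lemma past_zmean n : past history n (zmean Z n).
Proof. by apply: bmfunM; [apply: bmfun_sum => i _; exact: past_state|exact: bmfun_cst]. Qed.

Lemma past_choice_prob n i : past history n (choice_prob n i).
Proof.
by apply: bmfunD; apply: bmfunM; [exact: bmfun_cst|exact: past_state|exact: bmfun_cst|exact: past_zmean].
Qed.

Lemma past_mean_step_var n : past history n (mean_step_var n).
Proof.
apply: bmfunM; last exact: bmfun_cst.
by apply: bmfun_sum => i _; apply: bmfun_bernoulli_var; exact: past_choice_prob.
Qed.

Lemma past_deviation n i : past history n (deviation n i).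
Proof. by apply: bmfunD; [exact: past_state|apply: bmfunN; exact: past_zmean]. Qed.

Lemma bmfun_choice_prob n i : bmfun (choice_prob n i).
Proof. exact: history_bmfun (past_choice_prob n i). Qed.

Lemma bmfun_action n i : bmfun (I n i).
Proof.
split; first exact: action_measurable modelZ n i.
by exists 1 => w; case: (action01 modelZ n i w) => ->; rewrite ?normr0 ?normr1.
Qed.
#[local] Hint Resolve bmfun_choice_prob bmfun_action : bmfun.

Lemma bmfun_innovation n i : bmfun (innovation n i).
Proof. by rewrite /innovation; bmfun. Qed.
#[local] Hint Resolve bmfun_innovation : bmfun.

Lemma bmfun_mean_innovation n : bmfun (mean_innovation n).
Proof. by rewrite /mean_innovation; bmfun. Qed.
#[local] Hint Resolve bmfun_mean_innovation : bmfun.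

Definition action_event n e : set Om := [set w | forall i, I n.+1 i w = (e i)%:R].

Definition action_weight n e w : R :=
  \prod_(i < N) (if e i then choice_prob n i w else 1 - choice_prob n i w).

Lemma measurable_action_event n e : measurable (action_event n e).
Proof.
have -> : action_event n e = \bigcap_(i in [set: 'I_N]) (I n.+1 i @^-1` [set (e i)%:R]).
  by apply/seteqP; split=> w /= eI i //=; exact: eI.
apply: fin_bigcap_measurable => // i _.
by apply: measurable_preimageT (action_measurable modelZ n.+1 i) _; exact: measurable_set1.
Qed.

Lemma bmfun_action_weight n e : bmfun (action_weight n e).
Proof. by apply: bmfun_prod => i _; case: (e i); bmfun. Qed.
#[local] Hint Resolve measurable_action_event bmfun_action_weight : bmfun.

Lemma expect_action_event n e G : past history n G ->
  expect P (fun w => G w * \1_(action_event n e) w) = expect P (fun w => G w * action_weight n e w).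
Proof.
move=> pG.
have mD : measurable_fun (T := Om) (U := g_sigma_algebraType (history n)) setT id.
  move=> _ A mA; rewrite setTI; apply: smallest_sub mA; first exact: sigma_algebra_measurable.
  exact: history_measurable.
have bE : bmfun (\1_(action_event n e) : Om -> R) by bmfun.
have bw : bmfun (action_weight n e) by bmfun.
apply: (bounded_functional_ext (expect_functional P mD bE) (expect_functional P mD bw) _ pG) => A FA.
have mA : measurable (A : set Om) by rewrite -[A]setTI; exact: mD.
transitivity (fine (P (A `&` action_event n e))).
  rewrite -expect_indic; first by apply: eq_expect => w; rewrite indicI.
  by apply: measurableI => //; exact: measurable_action_event.
rewrite (action_cond_law modelZ)// integral_mkcond; congr fine; apply: eq_integral => w _.
by rewrite /patch indicE; case: ifP => _; rewrite ?mul1r ?mul0r.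
Qed.

Lemma prod_action n (Q : pred 'I_N) w : \prod_(i < N | Q i) I n.+1 i w =
  \sum_(e : {ffun 'I_N -> bool}) (\prod_(i < N) (if Q i then (e i)%:R else 1)) * \1_(action_event n e) w.
Proof.
pose e0 := [ffun i => I n.+1 i w == 1].
have e0E i : I n.+1 i w = (e0 i)%:R.
  by rewrite ffunE; case: (action01 modelZ n.+1 i w) => ->; rewrite ?eqxx// eq_sym oner_eq0.
rewrite (bigD1 e0)//= [X in _ + X]big1 => [|e /eqP ne]; last first.
  rewrite indicE memNset ?mulr0// => eI; apply: ne; apply/ffunP => i; have := eI i; rewrite e0E => /eqP.
  by case: (e i) (e0 i) => -[]//; rewrite ?oner_eq0// eq_sym oner_eq0.
rewrite addr0 indicE mem_set// mulr1 big_mkcond; apply: eq_bigr => i _.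
by rewrite -e0E.
Qed.

Lemma prod_choice_prob n (Q : pred 'I_N) w : \prod_(i < N | Q i) choice_prob n i w =
  \sum_(e : {ffun 'I_N -> bool}) (\prod_(i < N) (if Q i then (e i)%:R else 1)) * action_weight n e w.
Proof.
under [RHS]eq_bigr do rewrite /action_weight -big_split/=.
rewrite -(bigA_distr_bigA (fun i (b : bool) => (if Q i then b%:R else 1) *
  (if b then choice_prob n i w else 1 - choice_prob n i w))).
rewrite big_mkcond; apply: eq_bigr => i _; rewrite big_bool/=.
by case: (Q i); rewrite ?mul1r ?mul0r ?addr0// addrC subrK.
Qed.

Lemma expect_prod_action n (Q : pred 'I_N) G : past history n G ->
  expect P (fun w => G w * \prod_(i < N | Q i) I n.+1 i w) =
  expect P (fun w => G w * \prod_(i < N | Q i) choice_prob n i w).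
Proof.
move=> pG; have bG := history_bmfun pG.
pose a e : R := \prod_(i < N) (if Q i then (e i)%:R else 1).
transitivity (expect P (fun w => \sum_(e : {ffun 'I_N -> bool}) a e * (G w * \1_(action_event n e) w))).
  by apply: eq_expect => w; rewrite prod_action mulr_sumr; apply: eq_bigr => e _; rewrite mulrCA.
transitivity (expect P (fun w => \sum_(e : {ffun 'I_N -> bool}) a e * (G w * action_weight n e w))); last first.
  by apply: eq_expect => w; rewrite prod_choice_prob mulr_sumr; apply: eq_bigr => e _; rewrite mulrCA.
have bE e : bmfun (fun w => G w * \1_(action_event n e) w) by bmfun.
have bw e : bmfun (fun w => G w * action_weight n e w) by bmfun.
rewrite !expect_sum => [|e _|e _]; [|by bmfun..].
by apply: eq_bigr => e _; rewrite !expectZ// expect_action_event.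
Qed.

Lemma expect_action n i G : past history n G ->
  expect P (fun w => G w * I n.+1 i w) = expect P (fun w => G w * choice_prob n i w).
Proof.
move=> pG; under eq_expect do rewrite -(big_pred1_eq *%R i (I n.+1 ^~ _)).
by rewrite (expect_prod_action (pred1 i) pG); under eq_expect do rewrite big_pred1_eq.
Qed.

Lemma expect_action_pair n i k G : i != k -> past history n G ->
  expect P (fun w => G w * (I n.+1 i w * I n.+1 k w)) =
  expect P (fun w => G w * (choice_prob n i w * choice_prob n k w)).
Proof.
move=> ik pG; have pair (x : 'I_N -> R) : \prod_(j < N | pred2 i k j) x j = x i * x k.
  rewrite (bigD1 i) /= ?eqxx//; congr (_ * _); rewrite (big_pred1 k)// => j /=.
  by case: (eqVneq j i) => [->|] /=; rewrite ?(negbTE ik) ?andbT.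
under eq_expect do rewrite -(pair (I n.+1 ^~ _)).
by rewrite (expect_prod_action (pred2 i k) pG); under eq_expect do rewrite pair.
Qed.

Lemma expect_innovation n i G : past history n G -> expect P (fun w => G w * innovation n i w) = 0.
Proof.
move=> pG; have bG := history_bmfun pG.
under eq_expect do rewrite /innovation mulrBr.
by rewrite expectB ?expect_action ?subrr//; bmfun.
Qed.

Lemma expect_innovation_pair n i k G : past history n G ->
  expect P (fun w => G w * (innovation n i w * innovation n k w)) =
  (i == k)%:R * expect P (fun w => G w * bernoulli_var (choice_prob n i w)).
Proof.
move=> pG; have bG := history_bmfun pG.
have pGp j : past history n (fun w => G w * choice_prob n j w) by apply: bmfunM (past_choice_prob n j).
have -> : expect P (fun w => G w * (innovation n i w * innovation n k w)) =
    expect P (fun w => G w * (I n.+1 i w * I n.+1 k w)) -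
    expect P (fun w => G w * choice_prob n k w * choice_prob n i w) -
    expect P (fun w => G w * choice_prob n i w * innovation n k w).
  rewrite -(expect_action i (pGp k)) -!expectB; [|bmfun..].
  by apply: eq_expect => w; rewrite /innovation; ring.
rewrite (expect_innovation k (pGp i)) subr0; case: eqVneq => [<-|ik].
  have -> : expect P (fun w => G w * (I n.+1 i w * I n.+1 i w)) = expect P (fun w => G w * choice_prob n i w).
    rewrite -expect_action//; apply: eq_expect => w.
    by case: (action01 modelZ n.+1 i w) => ->; rewrite ?mulr0 ?mulr1.
  rewrite mul1r -expectB; [|bmfun..].
  by apply: eq_expect => w; rewrite /bernoulli_var; ring.
rewrite mul0r expect_action_pair// -expectB; [|bmfun..].
by rewrite -[RHS](expect_cst P); apply: eq_expect => w; ring.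
Qed.

Lemma expect_mean_innovation n G : past history n G ->
  expect P (fun w => G w * mean_innovation n w) = 0.
Proof.
move=> pG; have bG := history_bmfun pG.
transitivity (expect P (fun w => \sum_(i < N) N%:R^-1 * (G w * innovation n i w))).
  by apply: eq_expect => w; rewrite -mulr_sumr -mulr_sumr /mean_innovation; ring.
rewrite expect_sum => [|i _]; last by bmfun.
by rewrite big1// => i _; rewrite expectZ ?expect_innovation ?mulr0//; bmfun.
Qed.

Lemma expect_sqr_mean_innovation n G : past history n G ->
  expect P (fun w => G w * mean_innovation n w ^+ 2) = expect P (fun w => G w * mean_step_var n w).
Proof.
move=> pG; have bG := history_bmfun pG.
have bpair i k : bmfun (fun w => G w * (innovation n i w * innovation n k w)) by bmfun.
have bvar i : bmfun (fun w => G w * bernoulli_var (choice_prob n i w)) by bmfun.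
transitivity (expect P (fun w => \sum_(i < N) \sum_(k < N)
    N%:R ^- 2 * (G w * (innovation n i w * innovation n k w)))).
  apply: eq_expect => w; rewrite /mean_innovation exprMn exprVn expr2 big_distrlr/= mulr_suml mulr_sumr.
  by apply: eq_bigr => i _; rewrite mulr_suml mulr_sumr; apply: eq_bigr => k _; ring.
transitivity (expect P (fun w => \sum_(i < N) N%:R ^- 2 * (G w * bernoulli_var (choice_prob n i w)))); last first.
  by apply: eq_expect => w; rewrite -mulr_sumr -mulr_sumr /mean_step_var; ring.
rewrite !expect_sum => [|i _|i _]; [|by bmfun..].
apply: eq_bigr => i _; rewrite expect_sum => [|k _]; last by bmfun.
rewrite (bigD1 i)//= big1 ?addr0 => [|k ki]; rewrite expectZ// expect_innovation_pair//.
  by rewrite eqxx mul1r expectZ.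
by rewrite eq_sym (negbTE ki) mul0r mulr0.
Qed.

Lemma mean_step_var_ge0 n w : 0 <= mean_step_var n w.
Proof. by rewrite divr_ge0 ?sqr_ge0// sumr_ge0// => i _; have /andP[] := bernoulli_var01 (choice_prob01 n i w). Qed.

(* The choice probabilities average to the mean, and the Bernoulli variance is concave. *)
Lemma mean_step_var_le n w : mean_step_var n w <= mean_var N (zmean Z n w).
Proof.
set z := zmean Z n w; rewrite /mean_step_var ler_pdivrMr ?exprn_gt0//.
have -> : mean_var N z * N%:R ^+ 2 = N%:R * bernoulli_var z.
  by rewrite /mean_var; move: (N%:R : R) NR0 => m m0; field; rewrite gt_eqF.
have expand i : bernoulli_var (choice_prob n i w) =
    bernoulli_var z + (1 - 2 * z) * (choice_prob n i w - z) - (choice_prob n i w - z) ^+ 2.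
  by rewrite /bernoulli_var; ring.
under eq_bigr do rewrite expand.
have centered : \sum_(i < N) (choice_prob n i w - z) = 0.
  by rewrite sumrB sum_choice_prob -/z sumr_const card_ord -[z *+ _]mulr_natl subrr.
rewrite sumrB big_split/= -[\sum_i (1 - 2 * z) * _]mulr_sumr centered mulr0 addr0 sumr_const card_ord -[_ *+ N]mulr_natl lerBlDr lerDl.
by apply: sumr_ge0 => i _; exact: sqr_ge0.
Qed.

Lemma mean_step_var_le_bernoulli n w : mean_step_var n w <= bernoulli_var (zmean Z n w).
Proof.
apply: le_trans (mean_step_var_le n w) _; have /andP[b0 _] := bernoulli_var01 (zmean01 n w).
by rewrite ler_pdivrMr// ler_peMr// ler1n.
Qed.

Lemma zmean_controlled_martingale : controlled_martingale P history (zmean Z) mean_step_var r.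
Proof.
have r0 n : 0 <= r n by have /andP[] := reinforcement01 modelZ n.
split=> //; [exact: history_measurable|exact: history_nd|exact: past_zmean|exact: past_mean_step_var|..].
- move=> n w; rewrite mean_step_var_ge0 (le_trans (mean_step_var_le_bernoulli n w))//.
  by have /andP[] := bernoulli_var01 (zmean01 n w).
- by move=> n w; rewrite zmean_step normrM ger0_norm// ler_piMr// norm_mean_innovation_le1.
- move=> n G pG; have bG := history_bmfun pG.
  under eq_expect do rewrite zmean_step mulrCA.
  by rewrite expectZ ?expect_mean_innovation ?mulr0//; bmfun.
- move=> n G pG; have bG := history_bmfun pG.
  under eq_expect do rewrite zmean_step exprMn mulrCA.
  by rewrite expectZ ?expect_sqr_mean_innovation//; bmfun.
Qed.

Lemma deviationS n i w : deviation n.+1 i w =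
  (1 - alpha * r n) * deviation n i w + r n * (innovation n i w - mean_innovation n w).
Proof.
have -> : deviation n.+1 i w = Z n.+1 i w - zmean Z n w - (zmean Z n.+1 w - zmean Z n w).
  by rewrite /deviation; ring.
by rewrite zmean_step (state_step modelZ) /innovation /choice_prob /deviation; ring.
Qed.

Lemma bmfun_deviation n i : bmfun (deviation n i).
Proof. exact: history_bmfun (past_deviation n i). Qed.
#[local] Hint Resolve bmfun_deviation : bmfun.

Lemma expect_sqr_deviationS_le n i : expect P (fun w => deviation n.+1 i w ^+ 2) <=
  (1 - alpha * r n) * expect P (fun w => deviation n i w ^+ 2) + 4 * r n ^+ 2.
Proof.
pose noise w := innovation n i w - mean_innovation n w; have bnoise : bmfun noise by rewrite /noise; bmfun.
have b_dev2 : bmfun (fun w => deviation n i w ^+ 2) by bmfun.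
have b_noise2 : bmfun (fun w => noise w ^+ 2) by bmfun.
have b_cross : bmfun (fun w => deviation n i w * noise w) by bmfun.
have cross0 : expect P (fun w => deviation n i w * noise w) = 0.
  under eq_expect do rewrite mulrBr.
  rewrite expectB ?expect_innovation ?expect_mean_innovation ?subrr//; try exact: past_deviation; by bmfun.
have noise_le : expect P (fun w => noise w ^+ 2) <= 4.
  apply: expect_le_cst => // w; have : `|noise w| <= 1 + 1.
    by rewrite (le_trans (ler_normB _ _))// lerD ?norm_innovation_le1 ?norm_mean_innovation_le1.
  by rewrite ler_norml => /andP[? ?]; nra.
have -> : expect P (fun w => deviation n.+1 i w ^+ 2) =
    (1 - alpha * r n) ^+ 2 * expect P (fun w => deviation n i w ^+ 2) + r n ^+ 2 * expect P (fun w => noise w ^+ 2).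
  transitivity (expect P (fun w => ((1 - alpha * r n) ^+ 2 * deviation n i w ^+ 2 + r n ^+ 2 * noise w ^+ 2)
     + (2 * (1 - alpha * r n) * r n) * (deviation n i w * noise w))).
    by apply: eq_expect => w; rewrite deviationS -/(noise w); ring.
  rewrite expectD; [|by bmfun..].
  by rewrite [X in _ + X]expectZ// cross0 mulr0 addr0 expectD ?expectZ//; bmfun.
have /andP[r0 r1] := reinforcement01 modelZ n; have /andP[a0 a1] := interaction01 modelZ.
apply: lerD; last by rewrite mulrC ler_wpM2r ?sqr_ge0.
apply: ler_wpM2r; first by apply: expect_ge0 => w; exact: sqr_ge0.
by rewrite expr2 ler_piMl//; nra.
Qed.

Lemma expect_norm_deviation_cvg0 g c i : regular_steps r g c ->
  expect P (fun w => `|deviation n i w|) @[n --> \oo] --> 0.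
Proof.
move=> reg; have /andP[a0 _] := interaction01 modelZ.
apply: expect_norm_cvg0 => [n|]; first by bmfun.
apply: (contraction_cvg0 (a := fun n => alpha * r n) (b := fun n => 4 * r n ^+ 2)).
- by move=> n; rewrite mulr_ge0 ?(ltW a0)//; have /andP[] := reinforcement01 modelZ n.
- move=> cvg_ar; apply: (dvg_series_steps reg).
  have -> : r = fun n => alpha^-1 * (alpha * r n) by apply/funext => n; rewrite mulKf ?gt_eqF.
  exact: is_cvg_seriesZ cvg_ar.
- by move=> n; rewrite mulr_ge0 ?sqr_ge0.
- exact: is_cvg_seriesZ (is_cvg_series_sqr_steps reg).
- by move=> n; apply: expect_ge0 => w; exact: sqr_ge0.
- by move=> n; exact: expect_sqr_deviationS_le.
Qed.

Lemma mean_step_var_dist n w :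
  `|mean_step_var n w - mean_var N (zmean Z n w)| <= \sum_(i < N) `|deviation n i w|.
Proof.
set z := zmean Z n w.
have -> : mean_step_var n w - mean_var N z =
    (\sum_(i < N) (bernoulli_var (choice_prob n i w) - bernoulli_var z)) / N%:R ^+ 2.
  rewrite sumrB sumr_const card_ord -[_ *+ N]mulr_natl /mean_step_var /mean_var.
  by move: (N%:R : R) NR0 => m m0; field; rewrite gt_eqF.
rewrite normrM normfV normrX normr_nat ler_pdivrMr ?exprn_gt0//.
rewrite -[X in X <= _]mulr1 ler_pM ?exprn_ege1 ?ler1n// (le_trans (ler_norm_sum _ _ _))//.
apply: ler_sum => i _; apply: le_trans (bernoulli_var_lipschitz (choice_prob01 n i w) (zmean01 n w)) _.
rewrite -/z (_ : choice_prob n i w - z = (1 - alpha) * deviation n i w); last first.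
  by rewrite /choice_prob /deviation -/z; ring.
have /andP[a0 a1] := interaction01 modelZ.
by rewrite normrM ler_piMl// ger0_norm ?subr_ge0// gerBl ltW.
Qed.

Lemma mean_step_var_cvg g c : regular_steps r g c ->
  expect P (fun w => `|mean_step_var n w - mean_var N (zmean Z n w)|) @[n --> \oo] --> 0.
Proof.
move=> reg; have bz n : bmfun (zmean Z n) := history_bmfun (past_zmean n).
have bv n : bmfun (mean_step_var n) := history_bmfun (past_mean_step_var n).
have sum_cvg : \sum_(i < N) expect P (fun w => `|deviation n i w|) @[n --> \oo] --> 0.
  rewrite -[X in _ --> X](_ : \sum_(i < N) 0 = 0); last by rewrite big1.
  apply: cvg_big => [|i _]; first exact: add_continuous.
  exact: expect_norm_deviation_cvg0 reg.
apply: (squeeze_cvgr _ (@cvg_cst _ 0 _ \oo _) sum_cvg); apply: nearW => n.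
rewrite expect_ge0//= -expect_sum => [|i _]; last by bmfun.
by apply: le_expect => [||w]; [bmfun|bmfun|exact: mean_step_var_dist].
Qed.

End interacting_agents.

(** * The limit of the mean and its fluctuations *)

Lemma prob_lt1_of_expect_neq0 {R : realType} {d} {T : measurableType d} (P : probability T R)
    (A : set T) (X : T -> R) : measurable A -> bmfun X -> (forall w, A w -> X w = 0) ->
  expect P X != 0 -> (P A < 1)%E.
Proof.
move=> mA bX X0; apply: contraNT; rewrite -leNgt => PA; have {}PA : P A = 1%E.
  by apply/eqP; rewrite eq_le probability_le1.
rewrite -(expect_cst P 0); apply/eqP; apply: ae_eq_expect => //.
exists (~` A); split=> [||w /= Xw /X0//]; first exact: measurableC.
by rewrite probability_setC// PA subee.
Qed.

Section limit_of_mean.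
Context {R : realType} {d : measure_display} {Om : measurableType d}.
Context (P : probability Om R) (N : nat) (alpha g c : R) (r : nat -> R) (Z I : nat -> 'I_N -> Om -> R).
Context (Zlim : Om -> R).
Hypothesis modelZ : interacting_reinforcement P alpha r Z I.
Hypothesis reg : regular_steps r g c.
Hypothesis mZlim : measurable_fun setT Zlim.
Hypothesis cvgZ : {ae P, forall w, zmean Z n w @[n --> \oo] --> Zlim w}.

Lemma ae_limit01 : {ae P, forall w, 0 <= Zlim w <= 1}.
Proof.
apply: filterS cvgZ => w Zw; apply/andP; split.
  by apply: (cvgr_to_ge Zw); apply: nearW => n; have /andP[] := zmean01 modelZ n w.
by apply: (cvgr_to_le Zw); apply: nearW => n; have /andP[] := zmean01 modelZ n w.
Qed.

Let outside : set R := ~` `[0, 1]%classic.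

Let measurable_outside : measurable outside. Proof. exact: measurableC. Qed.

Lemma prob_limit_outside : P (Zlim @^-1` outside) = 0%E.
Proof.
have [A [mA PA outA]] := ae_limit01; apply: (subset_measure0 _ mA _ PA).
  exact: measurable_preimageT.
by move=> w /= Zw; apply: outA => Zw01; apply: Zw; rewrite /= in_itv.
Qed.

Lemma clip_inside z : ~ outside z -> clip z = z.
Proof. by move=> /contrapT; rewrite /= in_itv/= => /clip_id. Qed.

Lemma zmean_reinforced_martingale :
  reinforced_martingale P (history Z) (zmean Z) (mean_step_var alpha Z) r N g c (clip \o Zlim).
Proof.
split=> //.
- exact: zmean_controlled_martingale modelZ.
- exact: agents_gt0 modelZ.
- exact: zmean01 modelZ.
- by move=> w; exact: clip01.
- exact: measurableT_comp measurable_clip mZlim.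
- by apply: filterS2 cvgZ ae_limit01 => w Zw Zw01; rewrite /= clip_id.
- exact: (mean_step_var_cvg modelZ reg).
Qed.

Lemma limit_not_degenerate : 0 < expect P (fun w => bernoulli_var (zmean Z 0 w)) ->
  (P (Zlim @^-1` [set 0%R; 1%R]) < 1)%E.
Proof.
move=> var0; have reinfZ := zmean_reinforced_martingale.
have := expect_bernoulli_var_limit_gt0 reinfZ (mean_step_var_le_bernoulli modelZ) var0.
move=> var_gt0; apply: prob_lt1_of_expect_neq0 _ _ _ (lt0r_neq0 var_gt0).
- by apply: measurable_preimageT mZlim _; apply: measurableU; exact: measurable_set1.
- exact: bmfun_bernoulli_var (limit_bmfun reinfZ).
- by move=> w [] /= ->; rewrite clip_id ?lexx ?ler01// /bernoulli_var ?mul0r// subrr mulr0.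
Qed.

Lemma limit_no_atom z : 0 < z < 1 -> P (Zlim @^-1` [set z]) = 0%E.
Proof.
move=> z01; apply: (subset_measure0 _ _ _ (no_atom zmean_reinforced_martingale z01)).
- by apply: measurable_preimageT mZlim _; exact: measurable_set1.
- apply: measurable_preimageT (measurable_set1 z).
  exact: measurableT_comp measurable_clip mZlim.
- by move=> w /= ->; rewrite clip_id//; have /andP[? ?] := z01; rewrite !ltW.
Qed.

Lemma rescaled_cvg_dist {d'} {Om' : measurableType d'} (P' : probability Om' R) (W : R -> Om' -> R)
    (Z' : Om' -> R) : wiener_with_copy P P' W Z' Zlim ->
  cvg_dist_skorohod P (rescaled Z Zlim g) P' (time_changed_bm N c g W Z').
Proof.
move=> wienerW; have reinfZ := zmean_reinforced_martingale.
have wiener_clip := wiener_with_copy_comp wienerW measurable_clip.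
have clip_copy01 w : 0 <= (clip \o Z') w <= 1 by exact: clip01.
have mZ' := copy_measurable wienerW.
have NR0 : (0 : R) < N%:R by rewrite ltr0n (agents_gt0 modelZ).
have /andP[p0 _] := tail_exponent_range reg.
apply: (cvg_dist_skorohod_path_functional (X := fluctuation_path (zmean Z) g (clip \o Zlim))
  (Y := fun w => extend0 (limit_path N g c W (clip \o Z') w)) (S := Zlim @^-1` outside) (S' := Z' @^-1` outside)).
- move=> f B functional_f n; split; last first.
    by exists B => w; apply: functional_f.1; exact: cadlag_fluctuation_path reinfZ n w.
  exact: measurable_fluctuation_path reinfZ _ _ _ functional_f.
- move=> f B functional_f; apply: (bmfun_extend0 functional_f) => [w|t t0].
    exact: (limit_path_continuous reinfZ wiener_clip clip_copy01).
  exact: (measurable_limit_path reinfZ wiener_clip clip_copy01 t0).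
- by move=> f B functional_f; exact: (fluctuation_path_weak_cvg reinfZ wiener_clip clip_copy01 functional_f).
- exact: measurable_preimageT.
- exact: prob_limit_outside.
- by move=> n w /= /clip_inside Zw; apply/funext => t; rewrite /rescaled /fluctuation_path /step_path /= Zw.
- exact: measurable_preimageT.
- have := copy_law wienerW measurable_outside.
  rewrite expect_indic ?prob_limit_outside; last exact: measurable_preimageT.
  by move=> /= P'0; rewrite -[LHS]fineK ?fin_num_measure ?P'0//; exact: measurable_preimageT.
- move=> w /= /clip_inside Zw; apply/funext => t; rewrite /time_changed_bm /extend0; case: ifP => // _.
  rewrite /limit_path /limit_speed /mean_var /bernoulli_var /= Zw; congr (W _ w).
  by move: (2 * g - 1) p0 (N%:R : R) NR0 => p p0 m m0; field; rewrite !gt_eqF.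
Qed.

End limit_of_mean.

Theorem theorem2p5 (R : realType) (d : measure_display) (Om : measurableType d)
  (P : probability Om R) (N : nat) (alpha gamma c : R) (r : nat -> R)
  (Z : nat -> 'I_N -> Om -> R) (I : nat -> 'I_N -> Om -> R) (Zlim : Om -> R) :
  (0 < N)%N ->
  0 < alpha <= 1 ->
  (forall n, 0 <= r n < 1) ->
  2^-1 < gamma <= 1 ->
  0 < c ->
  powR n%:R gamma * r n @[n --> \oo] --> c ->
  (forall n i, measurable_fun setT (Z n i)) ->
  (forall n i, measurable_fun setT (I n i)) ->
  (forall n i w, 0 <= Z n i w <= 1) ->
  (forall n i w, I n i w = 0 \/ I n i w = 1) ->
  (forall n i w, Z n.+1 i w = (1 - r n) * Z n i w + r n * I n.+1 i w) ->
  (* I_{n+1}(1..N) conditionally independent given F_n, with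
     P(I_{n+1}(i) = 1 | F_n) = (1 - alpha) Z_n(i) + alpha Z_n *)
  (forall n (A : set Om), filtr Z n A -> forall e : {ffun 'I_N -> bool},
     P (A `&` [set w | forall i, I n.+1 i w = (e i)%:R]) =
     (\int[P]_(w in A)
        (\prod_(i < N)
           (if e i then (1 - alpha) * Z n i w + alpha * zmean Z n w
            else 1 - ((1 - alpha) * Z n i w + alpha * zmean Z n w)))%:E)%E) ->
  (* the law of (Z_0(1), ..., Z_0(N)) is permutation invariant *)
  (forall (s : {perm 'I_N}) (B : 'I_N -> set R), (forall i, measurable (B i)) ->
     P [set w | forall i, B i (Z 0%N i w)] =
     P [set w | forall i, B i (Z 0%N (s i) w)]) ->
  (forall i, ('E_P[Z 0%N i] = (2^-1)%:E)%E) ->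
  (0 < 'E_P[fun w => (zmean Z 0 w * (1 - zmean Z 0 w))%R])%E ->
  (* Z is the almost sure limit of Z_n *)
  measurable_fun setT Zlim ->
  {ae P, forall w, zmean Z n w @[n --> \oo] --> Zlim w} ->
  (P (Zlim @^-1` [set 0%R; 1%R]) < 1)%E /\
  (forall z, 0 < z < 1 -> P (Zlim @^-1` [set z]) = 0%E) /\
  (* for any standard Wiener process W independent of a random variable Z'
     distributed as Z (on any probability space), the rescaled process
     converges in distribution in D[0,+oo) to (W_{V_t})_t *)
  (forall (d' : measure_display) (Om' : measurableType d')
     (P' : probability Om' R) (W : R -> Om' -> R) (Z' : Om' -> R),
     measurable_fun setT Z' ->
     (forall t, measurable_fun setT (W t)) ->
     (forall w, W 0 w = 0) ->
     (forall w, {within `[0, +oo[%classic, continuous (fun t => W t w)}) ->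
     (* joint law: Z' ~ Z, and for 0 = t_0 < t_1 < ... < t_m the increments
        W_{t_j} - W_{t_{j-1}} are independent N(0, t_j - t_{j-1}) and
        independent of Z' *)
     (forall (m : nat) (ts : nat -> R) (A : set R) (B : nat -> set R),
        ts 0%N = 0 -> (forall j, (j < m)%N -> ts j < ts j.+1) ->
        measurable A -> (forall j, measurable (B j)) ->
        P' (Z' @^-1` A `&`
            [set w | forall j, (1 <= j <= m)%N -> B j (W (ts j) w - W (ts j.-1) w)])
        = (P (Zlim @^-1` A) *
           \prod_(1 <= j < m.+1) normal_prob 0 (Num.sqrt (ts j - ts j.-1)) (B j))%E) ->
     cvg_dist_skorohod P (rescaled Z Zlim gamma)
       P' (time_changed_bm N c gamma W Z')).
Proof.
move=> N_gt0 alpha01 r01 gamma_range c_gt0 r_cvg mZ mI Z01 I01 Z_step I_cond _ _ var0 mZlim cvgZ.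
have modelZ := InteractingReinforcement N_gt0 alpha01 r01 mZ mI Z01 I01 Z_step I_cond.
have reg := RegularSteps r01 gamma_range c_gt0 r_cvg.
have bZ0 : bmfun (zmean Z 0).
  exact: bmfun_generated (history_measurable modelZ (n := 0)) (past_zmean modelZ 0).
split; [|split].
- apply: (limit_not_degenerate modelZ reg mZlim cvgZ).
  by move: var0; rewrite unlock integral_expect ?lte_fin//; exact: bmfun_bernoulli_var.
- by move=> z; exact: limit_no_atom modelZ reg mZlim cvgZ z.
- move=> d' Om' P' W Z' mZ' mW W0 cW lawW.
  exact (rescaled_cvg_dist modelZ reg mZlim cvgZ (WienerWithCopy mZlim mZ' mW W0 cW lawW)).
Qed.
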